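(* Let $n\ge 2$. The space $\mathrm{crw}(\mathbb{R}^n)$ of all pairs of compact convex bodies of constant relative width in $\mathbb{R}^n$ is a contractible $Q$-manifold.
   Context: $\mathrm{cc}(\mathbb{R}^n)$ denotes the set of all nonempty compact convex subsets of Euclidean space $\mathbb{R}^n$, with the topology generated by the Hausdorff metric. Two compact convex sets $K_1,K_2\subset\mathbb{R}^n$ are a pair of constant relative width if $K_1-K_2=\{x-y\mid x\in K_1,\ y\in K_2\}$ is a (closed Euclidean) ball (of positive radius). $\mathrm{crw}(\mathbb{R}^n)$ is the set of all such pairs $(K_1,K_2)$, with the subspace topology inherited from $\mathrm{cc}(\mathbb{R}^n)\times\mathrm{cc}(\mathbb{R}^n)$. The Hilbert cube is $Q=[0,1]^{\mathbb{N}}$ with the product topology; a $Q$-manifold (Hilbert cube manifold) is a separable metrizable space in which every point has an open neighborhood homeomorphic to an open subset of $Q$. *)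

(* Defs.v *)
From HB Require Import structures.
From mathcomp Require Import all_boot all_order all_algebra.
From mathcomp Require Import all_classical all_reals all_analysis.
From mathcomp Require Import ring lra.

Set Implicit Arguments.
Unset Strict Implicit.
Unset Printing Implicit Defensive.

Import Order.TTheory GRing.Theory Num.Theory.
Import numFieldNormedType.Exports.

Local Open Scope classical_set_scope.
Local Open Scope ring_scope.

Section Euclidean.
Context {R : realType} {n : nat}.
Implicit Types (x y z : 'rV[R]_n) (A B C : set 'rV[R]_n) (r s : R).

(* The library norm `|x| on 'rV[R]_n is the sup norm; it induces the same
   topology as [enorm]. *)
Definition enorm x : R := Num.sqrt (\sum_i x ord0 i ^+ 2).

Definition eball x r : set 'rV[R]_n := [set y | enorm (y - x) <= r].

Definition minkowski_sub A B : set 'rV[R]_n := [set x - y | x in A & y in B].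

Definition thickening r A : set 'rV[R]_n :=
  [set x | exists2 y, A y & enorm (x - y) <= r].

Definition hausdorff_radii A B : set R :=
  [set r | [/\ 0 <= r, A `<=` thickening r B & B `<=` thickening r A]].

Definition hausdorff_dist A B : R := inf (hausdorff_radii A B).

Let sumsq_ge0 x : 0 <= \sum_i x ord0 i ^+ 2.
Proof. by apply: sumr_ge0 => i _; exact: sqr_ge0. Qed.

Lemma enorm_ge0 x : 0 <= enorm x.
Proof. exact: sqrtr_ge0. Qed.

Lemma sqr_enorm x : enorm x ^+ 2 = \sum_i x ord0 i ^+ 2.
Proof. by rewrite sqr_sqrtr. Qed.

Lemma enorm0 : enorm 0 = 0.
Proof.
by rewrite /enorm big1 ?sqrtr0// => i _; rewrite mxE expr0n.
Qed.

Lemma enorm0_eq0 x : enorm x = 0 -> x = 0.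
Proof.
move=> x0; have /eqP := sqr_enorm x; rewrite x0 expr0n /= eq_sym.
rewrite psumr_eq0 => [/allP s0|i _]; last exact: sqr_ge0.
apply/rowP => i; rewrite mxE; apply/eqP.
by have := s0 i (mem_index_enum i); rewrite sqrf_eq0.
Qed.

Lemma enorm_subC x y : enorm (x - y) = enorm (y - x).
Proof.
congr Num.sqrt; apply: eq_bigr => i _.
by rewrite !mxE -sqrrN opprB.
Qed.

Lemma enorm_dot_le x y : \sum_i x ord0 i * y ord0 i <= enorm x * enorm y.
Proof.
set S := \sum_i _; set a := enorm x; set b := enorm y.
have [a0|a0] := eqVneq a 0.
  rewrite a0 mul0r /S big1// => i _.
  by rewrite (enorm0_eq0 a0) mxE mul0r.
have [b0|b0] := eqVneq b 0.
  rewrite b0 mulr0 /S big1// => i _.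
  by rewrite (enorm0_eq0 b0) mxE mulr0.
have ab_gt0 : 0 < a * b.
  by rewrite mulr_gt0// lt_neqAle eq_sym enorm_ge0 ?a0 ?b0.
have : 0 <= \sum_i (b * x ord0 i - a * y ord0 i) ^+ 2.
  by apply: sumr_ge0 => i _; exact: sqr_ge0.
have -> : \sum_i (b * x ord0 i - a * y ord0 i) ^+ 2 =
    (a * b) * (a * b - S) *+ 2.
  transitivity (b ^+ 2 * (\sum_i x ord0 i ^+ 2) +
      a ^+ 2 * (\sum_i y ord0 i ^+ 2) - (a * b * S) *+ 2).
    rewrite /S !mulr_sumr -sumrMnl -big_split -sumrB /=.
    by apply: eq_bigr => i _; ring.
  by rewrite -!sqr_enorm -/a -/b; ring.
by rewrite pmulrn_lge0// pmulr_rge0// subr_ge0.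
Qed.

Lemma enormD x y : enorm (x + y) <= enorm x + enorm y.
Proof.
rewrite -ler_sqr ?nnegrE ?addr_ge0 ?enorm_ge0// sqrrD !sqr_enorm.
rewrite (_ : \sum_i _ = \sum_i x ord0 i ^+ 2 +
  (\sum_i x ord0 i * y ord0 i) *+ 2 + \sum_i y ord0 i ^+ 2); last first.
  rewrite -sumrMnl -!big_split /=; apply: eq_bigr => i _.
  by rewrite mxE sqrrD.
by rewrite lerD2r lerD2l lerMn2r enorm_dot_le orbT.
Qed.

Lemma enorm_le_norm x : enorm x <= `|x| *+ n.
Proof.
have key : enorm x <= \sum_i `|x ord0 i|.
  rewrite -ler_sqr ?nnegrE ?enorm_ge0 ?sumr_ge0// sqr_enorm.
  suff [] : 0 <= \sum_i `|x ord0 i| /\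
    \sum_i x ord0 i ^+ 2 <= (\sum_i `|x ord0 i|) ^+ 2 by [].
  apply: (big_ind2 (fun s t : R => 0 <= s /\ t <= s ^+ 2)).
  - by rewrite expr0n.
  - move=> a a' b b' [a0 aa'] [b0 bb']; split; first exact: addr_ge0.
    by have := mulr_ge0 a0 b0; nra.
  - by move=> i _; split; [exact: normr_ge0|rewrite real_normK ?num_real].
apply: le_trans key _.
rewrite -[X in _ *+ X]card_ord -sumr_const; apply: ler_sum => i _.
rewrite [leRHS]mx_normrE.
by apply: (le_bigmax _ (fun ij : 'I_1 * 'I_n => `|x ij.1 ij.2|) (ord0, i)).
Qed.

Lemma norm_le_enorm x : `|x| <= enorm x.
Proof.
rewrite [leLHS]mx_normrE; apply: bigmax_le => [|[i j] _] /=.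
  exact: enorm_ge0.
rewrite -ler_sqr ?nnegrE ?enorm_ge0// real_normK ?num_real// sqr_enorm.
rewrite (ord1 i) (bigD1 j)//= lerDl.
by apply: sumr_ge0 => k _; exact: sqr_ge0.
Qed.

End Euclidean.

Section HausdorffDistance.
Context {R : realType} {n : nat}.
Implicit Types (A B C : set 'rV[R]_n) (r s : R).

Lemma hausdorff_radii_sym A B : hausdorff_radii A B = hausdorff_radii B A.
Proof. by apply/seteqP; split => r [? ? ?]. Qed.

Lemma hausdorff_radii_lbound A B : has_lbound (hausdorff_radii A B).
Proof. by exists 0 => r []. Qed.

Lemma hausdorff_radii_neq0 A B : A !=set0 -> B !=set0 ->
  compact A -> compact B -> hausdorff_radii A B !=set0.
Proof.
move=> [a Aa] [b Bb] /compact_bounded[M [_ AM]] /compact_bounded[N [_ BN]].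
set r := ((`|M| + 1) + (`|N| + 1)) *+ n.
have dist_le x y : A x -> B y -> enorm (x - y) <= r.
  move=> Ax By; apply: le_trans (enorm_le_norm _) _.
  rewrite lerMn2r (le_trans (ler_normB _ _)) ?orbT// lerD//.
    by apply: AM => //; rewrite (le_lt_trans (ler_norm _))// ltrDl.
  by apply: BN => //; rewrite (le_lt_trans (ler_norm _))// ltrDl.
exists r; split.
- by rewrite mulrn_wge0// addr_ge0 ?addr_ge0.
- by move=> x Ax; exists b => //; exact: dist_le.
- by move=> y By; exists a => //; rewrite enorm_subC; exact: dist_le.
Qed.

Lemma thickeningD A B C r s : A `<=` thickening r B -> B `<=` thickening s C ->
  A `<=` thickening (r + s) C.
Proof.
move=> AB BC x /AB[y /BC[z Cz yz] xy]; exists z => //.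
by rewrite -(subrKA y) (le_trans (enormD _ _))// lerD.
Qed.

Lemma hausdorff_dist_triangle A B C :
  hausdorff_radii A B !=set0 -> hausdorff_radii B C !=set0 ->
  hausdorff_dist A C <= hausdorff_dist A B + hausdorff_dist B C.
Proof.
move=> AB0 BC0; apply/ler_addgt0Pr => e e0.
have e2 : 0 < e / 2 by rewrite divr_gt0.
have [r [r0 rAB rBA] re] := inf_adherent e2
  (conj AB0 (hausdorff_radii_lbound A B)).
have [s [s0 sBC sCB] se] := inf_adherent e2
  (conj BC0 (hausdorff_radii_lbound B C)).
have /ge_inf : hausdorff_radii A C (r + s).
  split; first exact: addr_ge0.
  - exact: thickeningD rAB sBC.
  - by rewrite addrC; exact: thickeningD sCB rBA.
move=> /(_ (hausdorff_radii_lbound A C)) /le_trans; apply.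
rewrite /hausdorff_dist; lra.
Qed.

Lemma hausdorff_dist_eq0_sub A B : hausdorff_radii A B !=set0 -> closed B ->
  hausdorff_dist A B = 0 -> A `<=` B.
Proof.
move=> AB0 cB d0 x Ax; apply: cB => U /nbhs_ballP[e /= e0 eU].
have [r [r0 rAB _] re] := inf_adherent e0
  (conj AB0 (hausdorff_radii_lbound A B)).
have [y By xy] := rAB x Ax; exists y; split => //; apply: eU.
rewrite -ball_normE /=; apply: le_lt_trans (norm_le_enorm _) _.
by apply: le_lt_trans xy _; move: re; rewrite -/(hausdorff_dist A B) d0 add0r.
Qed.

End HausdorffDistance.

Section ConvexCompacta.
Context {R : realType} {n : nat}.

Record cc := CC {
  cc_set :> set 'rV[R]_n ;
  cc_neq0 : cc_set !=set0 ;
  cc_compact : compact cc_set ;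
  cc_convex : convex_set (cc_set : set (convex_lmodType 'rV[R]_n)) }.

Lemma cc_eq (A B : cc) : cc_set A = cc_set B -> A = B.
Proof.
case: A B => [A a1 a2 a3] [B b1 b2 b3] /= AB; move: AB b1 b2 b3 => <- *.
by congr CC; exact: Prop_irrelevance.
Qed.

HB.instance Definition _ := gen_eqMixin cc.
HB.instance Definition _ := gen_choiceMixin cc.

Implicit Types A B C : cc.

Let radii_neq0 A B : hausdorff_radii A B !=set0.
Proof.
by apply: hausdorff_radii_neq0; [exact: cc_neq0|exact: cc_neq0|
  exact: cc_compact|exact: cc_compact].
Qed.

Let cc_closed A : closed A.
Proof. by apply: compact_closed; [exact: norm_hausdorff|exact: cc_compact]. Qed.

Let distxx A : hausdorff_dist A A = 0.
Proof.
apply/eqP; rewrite eq_le; apply/andP; split.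
  apply: ge_inf; first exact: hausdorff_radii_lbound.
  by split=> // x Ax; exists x => //; rewrite subrr enorm0.
by apply: lb_le_inf => // r [].
Qed.

Let dist_sym A B : hausdorff_dist A B = hausdorff_dist B A.
Proof. by rewrite /hausdorff_dist hausdorff_radii_sym. Qed.

Let dist_positivity A B : hausdorff_dist A B = 0 -> A = B.
Proof.
move=> d0; apply: cc_eq; apply/seteqP; split.
  exact: hausdorff_dist_eq0_sub.
by apply: hausdorff_dist_eq0_sub => //; rewrite dist_sym.
Qed.

Let dist_triangle B A C :
  hausdorff_dist A C <= hausdorff_dist A B + hausdorff_dist B C.
Proof. exact: hausdorff_dist_triangle. Qed.

HB.instance Definition _ :=
  isMetric.Build R cc distxx dist_positivity dist_sym dist_triangle.

End ConvexCompacta.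
Arguments cc R n : clear implicits.

(* The space of pairs of constant relative width is [set_type (crw R n)]: a
   set coerces to its subtype, which the library endows with the subspace
   topology, here inherited from the product [cc R n * cc R n]. *)
Definition crw (R : realType) (n : nat) : set (cc R n * cc R n) :=
  [set K : cc R n * cc R n | exists (c : 'rV[R]_n) (r : R),
    0 < r /\ minkowski_sub K.1 K.2 = eball c r].
Arguments crw R n : clear implicits.

Definition homeomorphic (T U : topologicalType) : Prop :=
  exists (f : T -> U) (g : U -> T),
    [/\ cancel f g, cancel g f, continuous f & continuous g].

Definition separable (T : topologicalType) : Prop :=
  exists2 D : set T, countable D & dense D.

Definition metrizable (R : realType) (T : topologicalType) : Prop :=
  exists M : metricType R, homeomorphic T M.

Definition contractible (R : realType) (T : topologicalType) : Prop :=
  exists (x0 : T) (H : T * R -> T),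
    [/\ {within [set: T] `*` `[0, 1], continuous H},
        forall x, H (x, 0) = x & forall x, H (x, 1) = x0].

Definition hilbert_cube (R : realType) : Type :=
  prod_topology (fun _ : nat => set_type (`[0, 1]%classic : set R)).

HB.instance Definition _ (R : realType) := Topological.on (hilbert_cube R).

Definition Q_manifold (R : realType) (T : topologicalType) : Prop :=
  [/\ separable T, metrizable R T &
    forall x : T, exists U : set T, open_nbhs x U /\
      exists2 V : set (hilbert_cube R), open V &
        homeomorphic (set_type U) (set_type V)].

(* Main.v *)
(** Up to two translations and a dilation, a pair of constant relative width is
    given by a function [g] such that [|u| + g u] and [|u| - g u] are both
    sublinear: the support functions are [<l1,u> + r (|u| + g u)] and
    [<l2,u> + r (|u| - g (- u))].  Normalised [g]'s form a symmetric convex set,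
    compact for pointwise convergence; evaluation at a dense sequence of
    directions embeds it in the space of sequences, and since bump functions are
    admissible up to scaling, its projections on the first coordinates have
    nonempty interior.  Such a set is homeomorphic to the Hilbert cube (Keller):
    if [B_k] is its projection on the first [k] coordinates, then
    [B_k * [-1,1]] is homeomorphic to [B_(k+1)] by a map moving the first [k]
    coordinates arbitrarily little, namely rescale the fibres over [(1-d) B_k],
    where they are nondegenerate and vary continuously, and then push radially.
    The composites of these maps converge to a homeomorphism.  Hence the space is
    homeomorphic to the product of [2n+1] lines and the Hilbert cube, an open
    star-shaped subset of the cube. *)
From HB Require Import structures.
Require Import Defs.
From mathcomp Require Import all_boot all_order all_algebra.
From mathcomp Require Import all_classical all_reals all_analysis.
From mathcomp Require Import ring lra.

Set Implicit Arguments.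
Unset Strict Implicit.
Unset Printing Implicit Defensive.

Import Order.TTheory GRing.Theory Num.Theory.
Import numFieldNormedType.Exports.

Local Open Scope classical_set_scope.
Local Open Scope ring_scope.

(** * Continuity and the space of real sequences *)

(** Two obstacles shape the construction. Over the boundary of [B_k] the fibres of [B_(k+1)] may
    shrink to a point and their ends may jump, so they cannot be rescaled continuously over all of
    [B_k]; shrinking by [1 - d] avoids this, and regaining the lost margin radially costs a
    displacement of order [d], which is free to choose. Moreover, a uniform limit of homeomorphisms
    need not be injective, so each displacement is chosen after the preceding composite, against its
    modulus of uniform injectivity on the compact cube. The dimension enters through the sphere: for
    [n >= 2] it carries infinitely many directions off the coordinate axes, whereas for [n = 1] a
    shape is a multiple of the absolute value and the space is finite dimensional. Evenness at the
    coordinate vectors removes the linear part of a shape, which no inequality on the defect of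
    additivity can see; this makes the decomposition of a pair unique and the set of shapes
    bounded. *)

Section ContinuousAt.
Context {R : realType} {T : topologicalType}.
Implicit Types (f g : T -> R) (x : T).

Lemma cts_cst x (c : R) : continuous_at x (fun _ : T => c).
Proof. exact: cvg_cst. Qed.

Lemma ctsD x f g : continuous_at x f -> continuous_at x g ->
  continuous_at x (fun y => f y + g y).
Proof. exact: cvgD. Qed.

Lemma ctsN x f : continuous_at x f -> continuous_at x (fun y => - f y).
Proof. exact: cvgN. Qed.

Lemma ctsB x f g : continuous_at x f -> continuous_at x g ->
  continuous_at x (fun y => f y - g y).
Proof. exact: cvgB. Qed.

Lemma ctsM x f g : continuous_at x f -> continuous_at x g ->
  continuous_at x (fun y => f y * g y).
Proof. exact: cvgM. Qed.

Lemma ctsV x f : f x != 0 -> continuous_at x f ->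
  continuous_at x (fun y => (f y)^-1).
Proof. exact: cvgV. Qed.

Lemma cts_norm x f : continuous_at x f -> continuous_at x (fun y => `|f y|).
Proof. exact: cvg_norm. Qed.

Lemma cts_max x f g : continuous_at x f -> continuous_at x g ->
  continuous_at x (fun y => Num.max (f y) (g y)).
Proof. by move=> fx gx; exact: (@continuous_max _ _ f g). Qed.

Lemma cts_sum x (I : Type) (r : seq I) (P : pred I) (F : I -> T -> R) :
  (forall i, P i -> continuous_at x (F i)) ->
  continuous_at x (fun y => \sum_(i <- r | P i) F i y).
Proof.
move=> Fx; elim: r => [|i r IH].
  by rewrite (_ : (fun _ => _) = fun=> 0);
    [exact: cts_cst|apply/funext => y; rewrite big_nil].
rewrite (_ : (fun _ => _) = fun y => (if P i then F i y else 0) +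
    \sum_(j <- r | P j) F j y); last first.
  by apply/funext => y; rewrite big_cons; case: ifP; rewrite ?add0r.
apply: ctsD IH; have [/Fx//|_] := boolP (P i); exact: cts_cst.
Qed.

Lemma cts_comp (U V : topologicalType) x (f : T -> U) (g : U -> V) :
  continuous_at x f -> continuous_at (f x) g ->
  continuous_at x (fun y => g (f y)).
Proof. by move=> fx gx; exact: continuous_comp. Qed.

Lemma cts_dist x f :
  (forall e, 0 < e -> \forall y \near x, `|f x - f y| < e) <->
  continuous_at x f.
Proof. by split => [fx|/cvgrPdist_lt//]; exact/cvgrPdist_lt. Qed.

End ContinuousAt.

(** One ambient space serves every stage: a function of the first [k] coordinates stands for a
    function on the [k]-dimensional space, so that stages and maps never change type. *)
Definition rseq (R : realType) : Type := prod_topology (fun _ : nat => R).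

HB.instance Definition _ (R : realType) := Uniform.on (rseq R).

Section SequenceSpace.
Context {R : realType}.
Notation S := (rseq R).

Lemma cts_coords (T : topologicalType) (x : T) (f : T -> S) :
  (forall i, continuous_at x (fun y => f y i)) -> continuous_at x f.
Proof.
by move=> fx; exact/(@pointwise_cvgP nat R (f @ x) (f x) (fmap_filter _ _)).
Qed.

Lemma cts_coord i (x : S) : continuous_at x (fun y : S => y i).
Proof. exact: (@proj_continuous nat (fun=> R) i x). Qed.

Lemma near_coords (x : S) k (e : R) : 0 < e ->
  \forall y \near x, forall i, (i < k)%N -> `|x i - (y : S) i| < e.
Proof.
move=> e0; elim: k => [|k IH]; first by near=> y => i; rewrite ltn0.
have /cts_dist/(_ e e0) xk := @cts_coord k x.
near=> y => i; rewrite ltnS leq_eqVlt => /predU1P[->|]; first by near: y.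
by move: i; near: y.
Unshelve. all: by end_near. Qed.

Definition cube : set S := [set x | forall i, `|x i| <= 1].

Lemma compact_cube : compact cube.
Proof.
have -> : cube = [set f : S | forall i, `[(-1), 1]%classic (f i)].
  by apply/seteqP; split=> f fi i; have := fi i; rewrite /= in_itv /= ler_norml.
apply: (@tychonoff nat (fun=> R) (fun=> `[(-1), 1]%classic)) => i.
exact: segment_compact.
Qed.

Lemma hausdorff_seq : hausdorff_space S.
Proof.
by apply: (@hausdorff_product nat (fun=> R)) => i; exact: Rhausdorff.
Qed.

End SequenceSpace.
Arguments cube R : clear implicits.

(** * Keller's theorem *)

(* The gauges of the projections, on the first [k] coordinates, of a symmetric
   compact convex set of sequences; [tower_lift] makes [N k] the quotient norm
   of [N k.+1]. *)
Record norm_tower (R : realType) (M : R) (N : nat -> rseq R -> R) : Prop :=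
  NormTower {
  tower_local : forall k (x y : rseq R),
    (forall i, (i < k)%N -> x i = y i) -> N k x = N k y ;
  towerD : forall k (x y : rseq R), N k (fun i => x i + y i) <= N k x + N k y ;
  towerZ : forall k a (x : rseq R), N k (fun i => a * x i) = `|a| * N k x ;
  tower_mono : forall k x, N k x <= N k.+1 x ;
  tower_lift : forall k x c, N k x < c ->
    exists2 y : rseq R, (forall i, (i < k)%N -> y i = x i) & N k.+1 y < c ;
  tower_coord : forall k x i, (i < k)%N -> `|x i| <= M * N k x ;
  tower_bound : forall k, exists2 C, 0 <= C &
    forall x, N k x <= C * \sum_(i < k) `|x i| }.

Section NormTower.
Context {R : realType} (M : R) (N : nat -> rseq R -> R).
Hypothesis M0 : 0 < M.
Hypothesis tN : norm_tower M N.
Notation S := (rseq R).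
Implicit Types (x y z : S) (k : nat).

Lemma tower0 k : N k (fun=> 0) = 0.
Proof.
rewrite -[RHS](mul0r (N k (fun=> 0))) -[X in X * _](normr0 R) -(towerZ tN).
by apply: (tower_local tN) => i _; rewrite mul0r.
Qed.

Lemma towerN k x : N k (fun i => - x i) = N k x.
Proof.
rewrite -[RHS]mul1r -(normrN1 R) -(towerZ tN).
by apply: (tower_local tN) => i _; rewrite mulN1r.
Qed.

Lemma tower_ge0 k x : 0 <= N k x.
Proof.
have := towerD tN k x (fun i => - x i); rewrite towerN.
rewrite (_ : N k _ = 0); first by rewrite -mulr2n pmulrn_lge0.
by rewrite -[RHS](tower0 k); apply: (tower_local tN) => i _; rewrite subrr.
Qed.

Lemma tower_distC k x y : N k (fun i => x i - y i) = N k (fun i => y i - x i).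
Proof.
by rewrite -towerN; apply: (tower_local tN) => i _; rewrite opprB.
Qed.

Lemma tower_leB k x y : N k x <= N k y + N k (fun i => x i - y i).
Proof.
apply: le_trans (towerD tN _ _ _); rewrite le_eqVlt; apply/orP; left; apply/eqP.
by apply: (tower_local tN) => i _; rewrite addrC subrK.
Qed.

Lemma tower_le_mono k m x : (k <= m)%N -> N k x <= N m x.
Proof.
move=> km; rewrite -(subnKC km); elim: (m - k)%N => [|j IH]; first by rewrite addn0.
by rewrite addnS (le_trans IH)// (tower_mono tN).
Qed.

Lemma near_tower_dist k x (e : R) : 0 < e ->
  \forall y \near x, N k (fun i => x i - (y : S) i) < e.
Proof.
move=> e0; have [C C0 NC] := tower_bound tN k.
set d := e / (C * k%:R + 1).
have Ck0 : 0 < C * k%:R + 1 by rewrite ltr_wpDl// mulr_ge0.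
have d0 : 0 < d by rewrite divr_gt0.
have de : e = d * (C * k%:R + 1) by rewrite divfK ?gt_eqF.
clearbody d; near=> y; apply: le_lt_trans (NC _) _.
have xy : forall i, (i < k)%N -> `|x i - (y : S) i| < d.
  by near: y; exact: near_coords.
apply: (@le_lt_trans _ _ (C * \sum_(i < k) d)).
  by apply: ler_wpM2l => //; apply: ler_sum => i _; rewrite ltW// xy.
rewrite sumr_const card_ord -mulr_natr de; lra.
Unshelve. all: by end_near. Qed.

Lemma cts_tower k x : continuous_at x (N k : S -> R).
Proof.
apply/cts_dist => e e0.
apply: filterS (near_tower_dist k x e0) => y xy.
rewrite ltr_norml; have := tower_leB k x y; have := tower_leB k y x.
by rewrite tower_distC => ? ?; apply/andP; split; lra.
Qed.

Definition upd x k t : S := fun i => if i == k then t else x i.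

Lemma upd_lt x k t i : (i < k)%N -> upd x k t i = x i.
Proof. by rewrite /upd; case: eqVneq => // ->; rewrite ltnn. Qed.

Lemma upd_eq x k t : upd x k t k = t.
Proof. by rewrite /upd eqxx. Qed.

Definition fibre k x : set R := [set t | N k.+1 (upd x k t) <= 1].

Definition top k x : R := sup (fibre k x).

Lemma fibre_local k x y : (forall i, (i < k)%N -> x i = y i) ->
  fibre k x = fibre k y.
Proof.
move=> xy; apply/seteqP; split=> t; rewrite /fibre /=;
  apply: le_trans; rewrite le_eqVlt; apply/orP; left; apply/eqP;
  apply: (tower_local tN) => i; rewrite ltnS leq_eqVlt => /predU1P[->|ik];
  by rewrite ?upd_eq// !upd_lt// xy.
Qed.

Lemma fibreN k x t : fibre k x t -> fibre k (fun i => - x i) (- t).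
Proof.
rewrite /fibre /= -towerN; apply: le_trans.
rewrite le_eqVlt; apply/orP; left; apply/eqP; apply: (tower_local tN) => i _.
by rewrite /upd; case: ifP; rewrite ?opprK.
Qed.

Lemma fibre_le k x t : fibre k x t -> `|t| <= M.
Proof.
move=> xt; have := tower_coord tN (upd x k t) (ltnSn k); rewrite upd_eq.
move=> /le_trans; apply.
by rewrite ger_pMr.
Qed.

Lemma fibre_ubound k x : has_ubound (fibre k x).
Proof. by exists M => t /fibre_le; exact: le_trans (ler_norm _). Qed.

(** Strictness is the point: a value below 1 leaves room on both sides, which makes the fibre a
    nondegenerate interval in [bot_lt_top]. *)
Lemma fibre_neq0 k x : N k x < 1 -> exists t, N k.+1 (upd x k t) < 1.
Proof.
move=> /(tower_lift tN)[y yx Ny]; exists (y k); apply: le_lt_trans Ny.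
rewrite le_eqVlt; apply/orP; left; apply/eqP; apply: (tower_local tN) => i.
rewrite ltnS leq_eqVlt => /predU1P[->|ik]; first by rewrite upd_eq.
by rewrite upd_lt// yx.
Qed.

Lemma fibre_convex k x y s t (l : R) : 0 <= l <= 1 ->
  fibre k x s -> fibre k y t ->
  fibre k (fun i => (1 - l) * x i + l * y i) ((1 - l) * s + l * t).
Proof.
move=> /andP[l0 l1] xs yt; rewrite /fibre /=.
rewrite (_ : upd _ _ _ = fun i => (1 - l) * upd x k s i + l * upd y k t i).
  apply: le_trans (towerD tN _ _ _) _; rewrite !(towerZ tN).
  rewrite !ger0_norm ?subr_ge0//.
  apply: (@le_trans _ _ ((1 - l) * 1 + l * 1)); last by rewrite !mulr1 subrK.
  by apply: lerD; apply: ler_wpM2l => //; rewrite subr_ge0.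
by apply/funext => i; rewrite /upd; case: ifP.
Qed.

Lemma fibre_lipschitz k : exists2 C, 0 <= C & forall t s x,
  N k.+1 (upd x k t) <= N k.+1 (upd x k s) + C * `|t - s|.
Proof.
have [C C0 NC] := tower_bound tN k.+1; exists C => // t s x.
apply: le_trans (tower_leB _ _ (upd x k s)) _; rewrite lerD2l.
apply: le_trans (NC _) _; rewrite ler_wpM2l//.
rewrite big_ord_recr /= !upd_eq big1 ?add0r// => i _.
by rewrite !upd_lt// subrr normr0.
Qed.

(** The supremum is attained because the gauge depends on the last coordinate in a Lipschitz way. *)
Lemma fibre_top k x : N k x < 1 -> fibre k x (top k x).
Proof.
move=> /fibre_neq0[s /ltW xs]; have [C C0 NC] := fibre_lipschitz k.
apply/ler_addgt0Pr => e e0.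
have d0 : 0 < e / (C + 1) by rewrite divr_gt0// ltr_wpDl.
have supx : has_sup (fibre k x) by split; [exists s|exact: fibre_ubound].
have [t xt te] := sup_adherent d0 supx.
have tt : t <= top k x by exact: ub_le_sup (fibre_ubound _ _) _ xt.
apply: le_trans (NC (top k x) t x) _; apply: lerD => //.
rewrite ger0_norm ?subr_ge0//.
apply: (@le_trans _ _ ((C + 1) * (e / (C + 1)))); last first.
  by rewrite mulrC divfK// gt_eqF// ltr_wpDl.
apply: ler_pM => //; first by rewrite subr_ge0.
  by rewrite lerDl.
rewrite lerBlDl -lerBlDr; exact: ltW.
Qed.

(** The lower end of the fibre: the ball is symmetric, so the fibre over [- x] is the mirror image,
    and facts on lower ends follow from those on [top]. *)
Definition bot k x : R := - top k (fun i => - x i).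

Lemma towerN_lt1 k x : N k x < 1 -> N k (fun i => - x i) < 1.
Proof. by rewrite towerN. Qed.

Lemma fibre_bot k x : N k x < 1 -> fibre k x (bot k x).
Proof.
move=> /towerN_lt1/fibre_top/fibreN; rewrite -/(bot k x).
by rewrite (@fibre_local k _ x)// => i _; rewrite opprK.
Qed.

Lemma fibre_le_top k x t : fibre k x t -> t <= top k x.
Proof. exact: ub_le_sup (fibre_ubound _ _) _. Qed.

Lemma fibre_ge_bot k x t : fibre k x t -> bot k x <= t.
Proof. by move=> /fibreN/fibre_le_top; rewrite lerNl. Qed.

Lemma bot_lt_top k x : N k x < 1 -> bot k x < top k x.
Proof.
move=> /fibre_neq0[s xs]; have [C C0 NC] := fibre_lipschitz k.
set d := (1 - N k.+1 (upd x k s)) / (C + 1).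
have d0 : 0 < d by rewrite divr_gt0 ?subr_gt0// ltr_wpDl.
have Cd : C * d <= 1 - N k.+1 (upd x k s).
  apply: (@le_trans _ _ ((C + 1) * d)); first by rewrite ler_pM2r// lerDl.
  by rewrite mulrC divfK// gt_eqF// ltr_wpDl.
have xd t : `|t - s| = d -> fibre k x t.
  by move=> td; have := NC t s x; rewrite td /fibre /=; lra.
have /fibre_le_top : fibre k x (s + d) by apply: xd; rewrite addrAC subrr add0r gtr0_norm.
have /fibre_ge_bot : fibre k x (s - d).
  by apply: xd; rewrite addrAC subrr add0r normrN gtr0_norm.
by move: d0; clear; lra.
Qed.

Lemma fibreP k x t : N k x < 1 -> bot k x <= t <= top k x -> fibre k x t.
Proof.
move=> x1 /andP[bt tt]; have bx := bot_lt_top x1.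
pose l := (t - bot k x) / (top k x - bot k x).
have bx0 : 0 < top k x - bot k x by rewrite subr_gt0.
have l01 : 0 <= l <= 1.
  by rewrite divr_ge0 ?subr_ge0 ?(ltW bx)//= ler_pdivrMr// mul1r lerD2r.
have := fibre_convex l01 (fibre_bot x1) (fibre_top x1).
rewrite (@fibre_local k _ x); last by move=> i _; ring.
have -> : (1 - l) * bot k x + l * top k x = t; last by [].
rewrite (_ : _ + _ = bot k x + l * (top k x - bot k x)); last by ring.
by rewrite divfK ?gt_eqF// addrC subrK.
Qed.

(** The point [y] is [(1 - l) x + l z] with [z = x + l^-1 (y - x)], and [z] still lies strictly
    inside the ball. Convexity puts [(1 - l) * top k x + l * s] in the fibre over [y], where [s] is
    some height over [z]; heights are at most [M] in absolute value. *)
Lemma top_le_near k x y d l : N k x <= 1 - d -> 0 < l <= 1 ->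
  N k (fun i => y i - x i) < l * d -> top k x <= top k y + l * (M *+ 2).
Proof.
move=> xd /andP[l0 l1] yxd; have d0 : 0 < d.
  by rewrite -(pmulr_rgt0 _ l0) (le_lt_trans (tower_ge0 _ _) yxd).
have x1 : N k x < 1 by rewrite (le_lt_trans xd)// gtrBl.
have [s] : exists s, N k.+1 (upd (fun i => x i + l^-1 * (y i - x i)) k s) < 1.
  apply: fibre_neq0; apply: le_lt_trans (towerD tN _ _ _) _.
  rewrite (towerZ tN k _ (fun i => y i - x i)) gtr0_norm ?invr_gt0//.
  have : l^-1 * N k (fun i => y i - x i) < d by rewrite mulrC ltr_pdivrMr// mulrC.
  by move: xd; clear; lra.
move=> /ltW zs; have l01 : 0 <= l <= 1 by rewrite ltW.
have := fibre_convex l01 (fibre_top x1) zs.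
rewrite (@fibre_local k _ y); last first.
  by move=> i _; rewrite mulrDr mulVKf ?gt_eqF//; ring.
move=> /fibre_le_top; have := fibre_le (fibre_top x1); have := fibre_le zs.
rewrite !ler_norml => /andP[s1 s2] /andP[t1 t2].
have : l * (top k x - s) <= l * (M *+ 2).
  by apply: ler_wpM2l; [exact: ltW|move: s1 t2; clear; lra].
by clear; lra.
Qed.

Lemma cts_top k x : N k x < 1 -> continuous_at x (top k).
Proof.
move=> x1; apply/cts_dist => e e0.
(* Half the margin of [x], so that a nearby [y] keeps the margin [d] as well and [top_le_near]
   applies in both directions. *)
pose d := (1 - N k x) / 2; have d0 : 0 < d by rewrite divr_gt0 ?subr_gt0.
pose l := Num.min 1 (e / (M *+ 4)).
have l0 : 0 < l by rewrite lt_min ltr01 divr_gt0// pmulrn_lgt0.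
have l1 : 0 < l <= 1 by rewrite l0 ge_min lexx.
have le : l * (M *+ 2) < e.
  have : l * (M *+ 4) <= e by rewrite -ler_pdivlMr ?pmulrn_lgt0// ge_min lexx orbT.
  by have := mulr_gt0 l0 M0; lra.
apply: filterS (near_tower_dist k x (mulr_gt0 l0 d0)) => y xy.
have xd : N k x <= 1 - d by rewrite /d; lra.
have yd : N k y <= 1 - d.
  have := tower_leB k y x; rewrite tower_distC.
  have : l * d <= d by rewrite ger_pMl//; case/andP: l1.
  by move: xy; rewrite /d; lra.
have := top_le_near yd l1 xy; rewrite tower_distC in xy.
have := top_le_near xd l1 xy; move: le; clear => ? ? ?.
by rewrite ltr_norml; apply/andP; split; lra.
Qed.

Lemma cts_bot k x : N k x < 1 -> continuous_at x (bot k).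
Proof.
move=> /towerN_lt1/cts_top x1; apply: ctsN.
apply: (@cts_comp S S R x (fun y i => - y i)) x1.
by apply: cts_coords => i; apply: ctsN; exact: cts_coord.
Qed.

Section Step.
Variables (k : nat) (d : R).
Hypothesis d01 : 0 < d < 1.
Let a := 1 - d.

Let a0 : 0 < a. Proof. by rewrite subr_gt0; case/andP: d01. Qed.
Let a1 : a < 1. Proof. by rewrite gtrBl; case/andP: d01. Qed.

(* The gauge of the part of the unit ball of [N k.+1] lying over [1 - d] times
   the unit ball of [N k]. *)
Definition capped z := Num.max (N k.+1 z) (N k z / (1 - d)).

(** Radial rescaling that turns the gauge [capped] into [N k.+1], and so carries the capped body
    onto the full ball. Where [N k.+1 z] is 0 the quotient is 0. *)
Definition push z : S := fun i => capped z / N k.+1 z * z i.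

(** The sequences on which [N k.+1] is a genuine norm. *)
Definition short z := forall i, (k < i)%N -> z i = 0.

Lemma short_eq0 z : short z -> N k.+1 z = 0 -> z = fun=> 0.
Proof.
move=> zk z0; apply/funext => i; have [/zk//|ik] := ltnP k i.
by apply/eqP; rewrite -normr_le0 -[leRHS](mulr0 M) -z0 (tower_coord tN).
Qed.

Lemma cappedZ c z : capped (fun i => c * z i) = `|c| * capped z.
Proof. by rewrite /capped !(towerZ tN) maxr_pMr// mulrA. Qed.

Lemma capped_ge z : N k.+1 z <= capped z.
Proof. by rewrite le_max lexx. Qed.

Lemma capped_le z : capped z <= N k.+1 z / a.
Proof.
rewrite ge_max; apply/andP; split.
  by rewrite ler_pdivlMr// ler_piMr ?tower_ge0// ltW.
by rewrite ler_pM2r ?invr_gt0// (tower_mono tN).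
Qed.

Lemma capped_eq0 z : N k.+1 z = 0 -> capped z = 0.
Proof.
move=> z0; apply/eqP; rewrite eq_le -{2}z0 capped_ge andbT.
by rewrite (le_trans (capped_le _))// z0 mul0r.
Qed.

Lemma short_push z : short z -> short (push z).
Proof. by move=> zk i ik; rewrite /push zk// mulr0. Qed.

Lemma tower_push z : N k.+1 (push z) = capped z.
Proof.
rewrite (towerZ tN k.+1 _ z) ger0_norm; last first.
  by rewrite divr_ge0 ?tower_ge0// (le_trans (tower_ge0 k.+1 z))// capped_ge.
have [z0|z0] := eqVneq (N k.+1 z) 0; last by rewrite divfK.
by rewrite z0 mulr0 capped_eq0.
Qed.

(** Points with equal images are proportional, and the common value of [capped], which is the gauge
    of the image, makes the factor 1. *)
Lemma push_inj y z : short y -> short z -> push y = push z -> y = z.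
Proof.
move=> yk zk yz; have cyz : capped y = capped z by rewrite -!tower_push yz.
have [y0|y0] := eqVneq (N k.+1 y) 0.
  have z0 : N k.+1 z = 0.
    apply/eqP; rewrite eq_le tower_ge0 andbT (le_trans (capped_ge z))//.
    by rewrite -cyz capped_eq0.
  by rewrite (short_eq0 yk y0) (short_eq0 zk z0).
have cy0 : capped y != 0.
  by rewrite gt_eqF// (lt_le_trans _ (capped_ge _))// lt_neqAle eq_sym y0 tower_ge0.
have z0 : N k.+1 z != 0.
  by apply: contra_neq cy0; rewrite cyz; exact: capped_eq0.
have yE : y = fun i => N k.+1 y / N k.+1 z * z i.
  apply/funext => i; have := congr1 (fun f : S => f i) yz; rewrite /push -cyz.
  rewrite -!mulrA => /(mulfI cy0) yzi.
  by rewrite -[LHS](mulVKf y0) yzi mulrA.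
have : capped y = N k.+1 y / N k.+1 z * capped z.
  by rewrite {1}yE cappedZ ger0_norm// divr_ge0 ?tower_ge0.
rewrite -cyz -[LHS]mul1r => /(mulIf cy0) c1.
by rewrite yE -c1; apply/funext => i; rewrite mul1r.
Qed.

Definition unpush y : S := fun i => N k.+1 y / capped y * y i.

Lemma capped_unpush y : capped (unpush y) = N k.+1 y.
Proof.
have c0 : 0 <= capped y by rewrite (le_trans (tower_ge0 k.+1 y))// capped_ge.
rewrite cappedZ ger0_norm ?divr_ge0 ?tower_ge0//.
have [y0|y0] := eqVneq (capped y) 0; last by rewrite divfK.
rewrite y0 mulr0; apply/eqP; rewrite eq_le tower_ge0/= -[leRHS]y0.
exact: capped_ge.
Qed.

Lemma unpushK y : short y -> push (unpush y) = y.
Proof.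
move=> yk; have [y0|y0] := eqVneq (N k.+1 y) 0.
  by rewrite (short_eq0 yk y0); apply/funext => i; rewrite /push /unpush !mulr0.
have cy0 : capped y != 0.
  by rewrite gt_eqF// (lt_le_trans _ (capped_ge _))// lt_neqAle eq_sym y0 tower_ge0.
apply/funext => i; rewrite /push capped_unpush.
rewrite (towerZ tN k.+1 _ y) ger0_norm; last first.
  by rewrite divr_ge0 ?tower_ge0// (le_trans (tower_ge0 k.+1 y))// capped_ge.
by rewrite /unpush; field; rewrite ?y0 ?cy0.
Qed.

(** The extra factor [a] is the one by which [lift] shrinks the first coordinates: together the two
    moves multiply them by a number within [d] of 1. *)
Lemma push_factor z : N k.+1 z != 0 -> a <= capped z / N k.+1 z * a <= 1.
Proof.
move=> z0; have zgt : 0 < N k.+1 z by rewrite lt_neqAle eq_sym z0 tower_ge0.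
apply/andP; split.
  by rewrite ler_pMl// ler_pdivlMr// mul1r capped_ge.
by rewrite -ler_pdivlMr// mul1r ler_pdivrMr// mulrC capped_le.
Qed.

Definition flat x : S := fun i => (1 - d) * x i.

(** Affine in [x k], taking -1 to the lower end and 1 to the upper end of the fibre over the
    shrunken point. *)
Definition height x : R :=
  ((1 - x k) * bot k (flat x) + (1 + x k) * top k (flat x)) / 2.

Definition lift x : S := fun i =>
  if (i < k)%N then (1 - d) * x i else if i == k then height x else 0.

Definition step x : S := fun i => if (i <= k)%N then push (lift x) i else x i.

(* [stage 0] is the cube, and the stages converge to the convex set. *)
Definition stage (j : nat) : set S :=
  [set x | N j x <= 1 /\ forall i, (j <= i)%N -> `|x i| <= 1].

Lemma short_lift x : short (lift x).
Proof. by move=> i ki; rewrite /lift ltnNge (ltnW ki) /= gtn_eqF. Qed.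

Lemma lift_upd x i : (i <= k)%N -> lift x i = upd (flat x) k (height x) i.
Proof.
rewrite leq_eqVlt => /predU1P[->|ik]; first by rewrite upd_eq /lift ltnn eqxx.
by rewrite upd_lt// /lift ik.
Qed.

Lemma tower_flat x : N k (flat x) = a * N k x.
Proof. by rewrite (towerZ tN k (1 - d) x) gtr0_norm. Qed.

Lemma flat_lt1 x : N k x <= 1 -> N k (flat x) < 1.
Proof.
by move=> x1; rewrite tower_flat (le_lt_trans _ a1)// ler_piMr// ltW.
Qed.

Lemma fibre_height x : stage k x -> fibre k (flat x) (height x).
Proof.
move=> [x1 /(_ k (leqnn k)) xk]; apply: (fibreP (flat_lt1 x1)).
have bt := bot_lt_top (flat_lt1 x1); move: xk; rewrite ler_norml => /andP[xk1 xk2].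
rewrite /height ler_pdivlMr// ler_pdivrMr//.
have : 0 <= (1 - x k) * (top k (flat x) - bot k (flat x)).
  by rewrite mulr_ge0 ?subr_ge0// ltW.
have : 0 <= (1 + x k) * (top k (flat x) - bot k (flat x)).
  by rewrite mulr_ge0 ?subr_ge0// ?(ltW bt)// -lerBlDl sub0r.
by move=> ? ?; apply/andP; split; lra.
Qed.

Lemma capped_lift x : stage k x -> capped (lift x) <= 1.
Proof.
move=> xk; rewrite ge_max; apply/andP; split.
  apply: le_trans (fibre_height xk); rewrite le_eqVlt; apply/orP; left; apply/eqP.
  by apply: (tower_local tN) => i; rewrite ltnS; exact: lift_upd.
rewrite ler_pdivrMr// mul1r (_ : N k _ = N k (flat x)).
  by rewrite tower_flat ler_piMr ?(ltW a0)//; case: xk.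
by apply: (tower_local tN) => i ik; rewrite /lift ik.
Qed.

Lemma tower_step x : N k.+1 (step x) = capped (lift x).
Proof.
rewrite -tower_push; apply: (tower_local tN) => i; rewrite ltnS => ik.
by rewrite /step ik.
Qed.

Lemma stage_step x : stage k x -> stage k.+1 (step x).
Proof.
move=> xk; split; first by rewrite tower_step capped_lift.
by move=> i ki; rewrite /step leqNgt ki /=; case: xk => _; apply; exact: ltnW.
Qed.

(** Undo [push], then recover the first [k] coordinates, which [lift] only scales; the two fibres
    are now the same interval, and [height] has nonzero slope there. Only agreement up to [k] is
    assumed, so that the statement composes along the stages. *)
Lemma step_inj x y : stage k x -> stage k y ->
  (forall i, (i <= k)%N -> step x i = step y i) ->
  forall i, (i <= k)%N -> x i = y i.
Proof.
move=> xk yk xy; have : push (lift x) = push (lift y).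
  apply/funext => i; have [ki|ik] := ltnP k i.
    by rewrite !(short_push (@short_lift _)).
  by have := xy i ik; rewrite /step ik.
move=> /(push_inj (@short_lift _) (@short_lift _)) lxy.
have xyk i : (i < k)%N -> x i = y i.
  move=> ik; have := congr1 (fun f : S => f i) lxy.
  by rewrite /lift ik; apply: mulfI; rewrite gt_eqF.
move=> i; rewrite leq_eqVlt => /predU1P[->|]; last exact: xyk.
have := congr1 (fun f : S => f k) lxy; rewrite /lift ltnn eqxx /height.
have fxy j : (j < k)%N -> flat x j = flat y j by move=> jk; rewrite /flat xyk.
have topxy : top k (flat y) = top k (flat x) by rewrite /top (fibre_local fxy).
have botxy : bot k (flat y) = bot k (flat x).
  by congr (- _); rewrite /top (@fibre_local k _ (fun i => - flat x i))// => j /fxy ->.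
rewrite topxy botxy => /(mulIf (invr_neq0 _)) h.
have {}h := h (lt0r_neq0 (ltr0Sn R 1)); have bt := bot_lt_top (flat_lt1 xk.1).
have : (x k - y k) * (top k (flat x) - bot k (flat x)) = 0.
  by lra.
move=> /eqP; rewrite mulf_eq0 !subr_eq0 => /orP[/eqP//|].
by rewrite gt_eqF.
Qed.

Lemma step_surj y : stage k.+1 y -> exists2 x, stage k x & step x = y.
Proof.
(* The tail is cut off so that [unpush] inverts [push]; it is put back in [x] below. *)
move=> [y1 yk]; pose y' : S := fun i => if (i <= k)%N then y i else 0.
have y'k : short y' by move=> i ki; rewrite /y' leqNgt ki.
have Ny' : N k.+1 y' = N k.+1 y.
  by apply: (tower_local tN) => i; rewrite ltnS /y' => ->.
pose z := unpush y'; have zk : short z by move=> i ki; rewrite /z /unpush y'k// mulr0.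
have cz : capped z <= 1 by rewrite capped_unpush Ny'.
have Nz : N k z <= a.
  move: cz; rewrite ge_max => /andP[_]; rewrite ler_pdivrMr// mul1r.
  exact.
have z1 : N k z < 1 by rewrite (le_lt_trans Nz).
have bt := bot_lt_top z1.
have zf : fibre k z (z k).
  move: cz; rewrite ge_max => /andP[+ _]; rewrite /fibre /=.
  rewrite (_ : upd z k (z k) = z)//.
  by apply/funext => i; rewrite /upd; case: eqP => // ->.
have bt0 : top k z - bot k z != 0 by rewrite subr_eq0 gt_eqF.
(* The solution of [height x = z k] for the last coordinate. *)
pose t := (2 * z k - bot k z - top k z) / (top k z - bot k z).
have t1 : `|t| <= 1.
  rewrite normrM normfV [`|top k z - _|]gtr0_norm ?subr_gt0// ler_pdivrMr ?subr_gt0//.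
  have := fibre_le_top zf; have := fibre_ge_bot zf.
  by rewrite mul1r ler_norml => ? ?; apply/andP; split; lra.
pose x : S := fun i => if (i < k)%N then z i / a else if i == k then t else y i.
have fx i : (i < k)%N -> flat x i = z i.
  by move=> ik; rewrite /flat /x ik mulrC divfK// gt_eqF.
have topx : top k (flat x) = top k z by rewrite /top (fibre_local fx).
have botx : bot k (flat x) = bot k z.
  by congr (- _); rewrite /top (@fibre_local k _ (fun i => - z i))// => j /fx ->.
have hx : height x = z k.
  rewrite /height topx botx /x ltnn eqxx /t.
  by field.
have lx : lift x = z.
  apply/funext => i; rewrite /lift; case: ltnP => [/fx//|ik].
  by case: eqVneq => [->//|ik']; rewrite zk// ltn_neqAle eq_sym ik'.
exists x; last first.
  apply/funext => i; rewrite /step lx unpushK// /y' /x; case: (leqP i k) => // ki.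
  by rewrite ltnNge (ltnW ki) /= gtn_eqF.
split=> [|i ki].
  have := tower_flat x; rewrite (tower_local tN fx) => Nzx.
  by move: Nz; rewrite Nzx -[leRHS]mulr1 ler_pM2l.
rewrite /x ltnNge ki /=; case: eqVneq => // ik; apply: yk.
by rewrite ltn_neqAle eq_sym ik.
Qed.

Lemma step_close x i : stage k x -> (i < k)%N -> `|step x i - x i| <= d * M.
Proof.
move=> [x1 _] ik; have xM : `|x i| <= M.
  by rewrite (le_trans (tower_coord tN _ ik))// ger_pMr.
have d0 : 0 <= d by case/andP: d01 => /ltW.
have [l0|l0] := eqVneq (N k.+1 (lift x)) 0.
  have := short_eq0 (@short_lift x) l0 => /(congr1 (fun f : S => f i)).
  rewrite /lift ik => /eqP; rewrite mulf_eq0 gt_eqF//= => /eqP xi0.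
  rewrite /step ltnW// /push /lift ik xi0 !mulr0 subr0 normr0.
  by rewrite mulr_ge0// ltW.
have /andP[p1 p2] := push_factor l0.
rewrite /step ltnW// /push {3}/lift ik mulrA -[X in _ - X]mul1r -mulrBl normrM.
apply: ler_pM => //; rewrite ler_norml; move: p1 p2; rewrite /a.
by move=> ? ?; apply/andP; split; lra.
Qed.

Lemma cts_capped z : continuous_at z capped.
Proof.
apply: cts_max; first exact: cts_tower.
by apply: ctsM; [exact: cts_tower|exact: cts_cst].
Qed.

(** Where [N k.+1] vanishes the quotient in [push] need not be continuous, but it is bounded by
    [1 / a] and multiplies a coordinate that tends to 0. *)
Lemma cts_push i z : (i <= k)%N -> continuous_at z (fun y => push y i).
Proof.
move=> ik; have [z0|z0] := eqVneq (N k.+1 z) 0; last first.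
  apply: ctsM; last exact: cts_coord.
  by apply: ctsM; [exact: cts_capped|apply: ctsV => //; exact: cts_tower].
have zi : z i = 0.
  by apply/eqP; rewrite -normr_le0 -[leRHS](mulr0 M) -z0 (tower_coord tN).
apply/cts_dist => e e0; have /cts_dist/(_ _ (mulr_gt0 e0 a0)) := @cts_coord R i z.
apply: filterS => y; rewrite zi sub0r normrN => yi.
rewrite /push zi mulr0 sub0r normrN normrM.
have [y0|y0] := eqVneq (N k.+1 y) 0; first by rewrite y0 invr0 mulr0 normr0 mul0r.
apply: le_lt_trans (_ : `|y i| / a < e); last by rewrite ltr_pdivrMr.
rewrite mulrC ler_wpM2l// ger0_norm; last first.
  by rewrite divr_ge0 ?tower_ge0// (le_trans (tower_ge0 k.+1 y))// capped_ge.
by have /andP[_ +] := push_factor y0; rewrite -ler_pdivlMr// mul1r.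
Qed.

Lemma cts_flat x : continuous_at x flat.
Proof.
apply: cts_coords => i.
by apply: ctsM; [exact: cts_cst|exact: cts_coord].
Qed.

Lemma cts_height x : N k x <= 1 -> continuous_at x height.
Proof.
move=> /flat_lt1 x1; apply: ctsM; last exact: cts_cst.
have cb : continuous_at x (fun y => bot k (flat y)).
  by apply: cts_comp; [exact: cts_flat|exact: cts_bot].
have ct : continuous_at x (fun y => top k (flat y)).
  by apply: cts_comp; [exact: cts_flat|exact: cts_top].
apply: ctsD; apply: ctsM => //.
  by apply: ctsB; [exact: cts_cst|exact: cts_coord].
by apply: ctsD; [exact: cts_cst|exact: cts_coord].
Qed.

Lemma cts_lift x : N k x <= 1 -> continuous_at x lift.
Proof.
move=> x1; apply: cts_coords => i; rewrite /lift; case: (i < k)%N.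
  by apply: ctsM; [exact: cts_cst|exact: cts_coord].
by case: (i == k); [exact: cts_height|exact: cts_cst].
Qed.

Lemma cts_step x : N k x <= 1 -> continuous_at x step.
Proof.
move=> x1; apply: cts_coords => i; rewrite /step; case ik: (i <= k)%N.
  apply: (@cts_comp S S R x lift (push^~ i)); first exact: cts_lift.
  exact: cts_push.
exact: cts_coord.
Qed.

End Step.

(** What the limit needs to know of one step. Smallness concerns the coordinates below [k] only:
    coordinate [k] is stretched over a fibre and may move far, which is harmless as it happens
    once. *)
Record stage_map k (e : R) (h : S -> S) : Prop := StageMap {
  stage_cts : forall x, stage k x -> continuous_at x h ;
  stage_sub : forall x, stage k x -> stage k.+1 (h x) ;
  stage_onto : forall y, stage k.+1 y -> exists2 x, stage k x & h x = y ;
  stage_inj : forall x y, stage k x -> stage k y ->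
    (forall i, (i <= k)%N -> h x i = h y i) ->
    forall i, (i <= k)%N -> x i = y i ;
  stage_near : forall x i, stage k x -> (i < k)%N -> `|h x i - x i| <= e ;
  stage_tail : forall x i, (k < i)%N -> h x i = x i }.

Lemma stage_map_exists k e : 0 < e -> exists h, stage_map k e h.
Proof.
(* The bound 1/2 keeps [d] below 1; the other makes the displacement [d * M] at most [e]. *)
move=> e0; pose d := Num.min 2^-1 (e / M).
have d0 : 0 < d by rewrite lt_min invr_gt0 ltr0Sn divr_gt0.
have d1 : d < 1 by rewrite gt_min invf_lt1 ?ltr1n.
have dM : d * M <= e by rewrite -ler_pdivlMr// ge_min lexx orbT.
have d01 : 0 < d < 1 by rewrite d0.
exists (step k d); split.
- by move=> x [x1 _]; exact: cts_step.
- exact: stage_step.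
- exact: step_surj.
- exact: step_inj.
- by move=> x i xk ik; rewrite (le_trans _ dM)// step_close.
- by move=> x i ki; rewrite /step leqNgt ki.
Qed.

End NormTower.
(** Closed parts of [A] are compact, so their images are compact and hence closed: the inverse map
    pulls closed sets back to closed sets. *)
Lemma compact_inverse_continuous (T U : topologicalType) (A : set T)
    (f : T -> U) (g : U -> T) : hausdorff_space U -> compact A ->
  {within A, continuous f} -> (forall x, A x -> g (f x) = x) ->
  {within f @` A, continuous g}.
Proof.
move=> hU cA cf gf; apply/subspace_continuousP => _ [x Ax <-].
rewrite /from_subspace gf// => V /=; rewrite nbhsE => -[B [oB Bx] BV].
have cB : compact (A `&` ~` B) by apply: compact_closedI => //; exact: open_closedC.
have cfB : closed (f @` (A `&` ~` B)).
  apply: compact_closed => //; apply: continuous_compact => //.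
  by apply: continuous_subspaceW cf; exact: subIsetl.
have : nbhs (f x) (~` (f @` (A `&` ~` B))).
  apply: open_nbhs_nbhs; split; first exact: closed_openC.
  by move=> [y [Ay nBy] /(congr1 g)]; rewrite !gf// => yx; apply: nBy; rewrite yx.
rewrite /nbhs /= /within /=; apply: filterS => z + [a Aa az]; rewrite -{}az => nB.
by rewrite gf//; apply: BV; apply: contrapT => nBa; apply: nB; exists a.
Qed.

(** * The limit of the stage homeomorphisms *)

Section TowerLimit.
Context {R : realType} (M : R) (N : nat -> rseq R -> R).
Hypothesis M0 : 0 < M.
Hypothesis tN : norm_tower M N.
Notation S := (rseq R).

Record stage_homeo k (E : S -> S) : Prop := StageHomeo {
  homeo_cts : forall q, cube R q -> continuous_at q E ;
  homeo_sub : forall q, cube R q -> stage N k (E q) ;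
  homeo_onto : forall x, stage N k x -> exists2 q, cube R q & E q = x ;
  homeo_inj : forall p q, cube R p -> cube R q ->
    (forall i, (i < k)%N -> E p i = E q i) ->
    forall i, (i < k)%N -> p i = q i ;
  homeo_tail : forall q i, (k <= i)%N -> E q i = q i }.

Lemma stage_homeo0 : stage_homeo 0 id.
Proof.
have N0 q : N 0 q = 0.
  by rewrite -(tower0 tN 0); apply: (tower_local tN).
split=> //.
- by move=> q _; exact: cvg_id.
- by move=> q cq; split=> [|i _]; [rewrite N0|exact: cq].
- by move=> x [_ x1]; exists x => // i; exact: x1.
Qed.

Lemma stage_homeoS k E e h : stage_homeo k E -> stage_map N k e h ->
  stage_homeo k.+1 (h \o E).
Proof.
move=> Ek hk; split.
- move=> q cq; apply: (@cts_comp S S S q E h); first exact: homeo_cts Ek _ cq.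
  by apply: (stage_cts hk); exact: homeo_sub Ek _ cq.
- by move=> q cq; apply: (stage_sub hk); exact: homeo_sub Ek _ cq.
- move=> y /(stage_onto hk)[x /(homeo_onto Ek)[q cq <-] <-].
  by exists q.
- move=> p q cp cq pq.
  have Epq := stage_inj hk (homeo_sub Ek cp) (homeo_sub Ek cq) pq.
  move=> i; rewrite ltnS leq_eqVlt => /predU1P[->|].
    by rewrite -(homeo_tail Ek p (leqnn k)) -(homeo_tail Ek q (leqnn k)) Epq.
  by apply: (homeo_inj Ek) => // j jk; apply: Epq; exact: ltnW.
- by move=> q i ki; rewrite /= (stage_tail hk)// (homeo_tail Ek)// ltnW.
Qed.

(** Uniform injectivity: on the compact set of pairs at distance at least [e] in the first [k]
    coordinates, the distance of the images is continuous and positive, so it has a positive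
    minimum. *)
Lemma stage_homeo_modulus k E : stage_homeo k E ->
  forall e, 0 < e -> exists2 d, 0 < d & forall p q, cube R p -> cube R q ->
    (forall i, (i < k)%N -> `|E p i - E q i| <= d) ->
    forall i, (i < k)%N -> `|p i - q i| <= e.
Proof.
move=> Ek e e0.
pose phi (z : S * S) : R := \sum_(i < k) `|E z.1 i - E z.2 i|.
pose psi (z : S * S) : R := \sum_(i < k) `|z.1 i - z.2 i|.
pose Z := (cube R `*` cube R) `&` [set z | e <= psi z].
have ctsfst (z : S * S) : continuous_at z fst by exact: cvg_fst.
have ctssnd (z : S * S) : continuous_at z snd by exact: cvg_snd.
have ctspsi z : continuous_at z psi.
  apply: cts_sum => i _; apply: cts_norm; apply: ctsB.
    by apply: (@cts_comp (S * S)%type S R z fst (fun x => x i)) => //; exact: cts_coord.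
  by apply: (@cts_comp (S * S)%type S R z snd (fun x => x i)) => //; exact: cts_coord.
have ctsphi z : Z z -> continuous_at z phi.
  move=> [[z1 z2] _]; apply: cts_sum => i _; apply: cts_norm; apply: ctsB.
    apply: (@cts_comp (S * S)%type S R z fst (fun x => E x i)) => //.
    apply: (@cts_comp S S R z.1 E (fun x => x i)); last exact: cts_coord.
    exact: homeo_cts Ek _ _.
  apply: (@cts_comp (S * S)%type S R z snd (fun x => E x i)) => //.
  apply: (@cts_comp S S R z.2 E (fun x => x i)); last exact: cts_coord.
  exact: homeo_cts Ek _ _.
have cZ : compact Z.
  apply: compact_closedI; first by apply: compact_setX; exact: compact_cube.
  have -> : [set z | e <= psi z] = psi @^-1` [set t | e <= t] by [].
  by apply: closed_comp; [move=> z _; exact: ctspsi|exact: closed_ge].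
have psiP p q d i : (i < k)%N -> psi (p, q) <= d -> `|p i - q i| <= d.
  move=> ik; apply: le_trans; rewrite /psi (bigD1 (Ordinal ik))//= lerDl.
  exact: sumr_ge0.
have [Z0|/set0P Z0] := eqVneq Z set0.
  exists 1 => // p q cp cq _ i ik; apply: psiP => //; rewrite leNgt.
  apply/negP => epq; have : Z (p, q) by split => //=; exact: ltW.
  by rewrite Z0.
have [c /set_mem cinZ cmin] : exists2 c, c \in Z & forall t, t \in Z -> phi c <= phi t.
  by apply: compact_EVT_min => //; apply: continuous_in_subspaceT => z /set_mem; exact: ctsphi.
have phic : 0 < phi c.
  rewrite lt_neqAle sumr_ge0// andbT eq_sym; apply/negP => /eqP phi0.
  have Ec i : (i < k)%N -> E c.1 i = E c.2 i.
    move=> ik; apply/eqP; rewrite -subr_eq0 -normr_eq0.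
    have /eqP := phi0; rewrite psumr_eq0// => /allP/(_ (Ordinal ik) (mem_index_enum _)).
    by [].
  case: cinZ => -[c1 c2] /= /(lt_le_trans e0); rewrite /psi big1 ?ltxx// => i _.
  by rewrite (homeo_inj Ek c1 c2 Ec)// subrr normr0.
(* Dividing by [k.+1] makes a sum of [k] terms strictly smaller than the minimum, also for
   [k = 0]. *)
exists (phi c / k.+1%:R); first by rewrite divr_gt0.
move=> p q cp cq Epq i ik; apply: psiP => //; rewrite leNgt; apply/negP => epq.
have : phi c <= phi (p, q) by apply: cmin; apply/mem_set; split => //=; exact: ltW.
apply/negP; rewrite -ltNge.
apply: (@le_lt_trans _ _ (\sum_(i < k) (phi c / k.+1%:R))).
  by apply: ler_sum => j _; exact: Epq.
rewrite sumr_const card_ord -[_ *+ k]mulr_natr -mulrA gtr_pMr//.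
by rewrite mulrC ltr_pdivrMr// mul1r ltr_nat.
Qed.

(* [e k] is so small that later perturbations cannot undo [chain_inj], which
   makes the limit injective. *)
Record stage_chain (E : nat -> S -> S) (e : nat -> R) : Prop := StageChain {
  chain_homeo : forall k, stage_homeo k (E k) ;
  chain_gt0 : forall k, 0 < e k ;
  chain_half : forall k, e k.+1 <= e k / 2 ;
  chain_close : forall k q i, cube R q -> (i < k)%N ->
    `|E k.+1 q i - E k q i| <= e k ;
  chain_inj : forall k p q, cube R p -> cube R q ->
    (forall i, (i < k)%N -> `|E k p i - E k q i| <= 4 * e k) ->
    forall i, (i < k)%N -> `|p i - q i| <= k.+1%:R^-1 }.

Lemma stage_chain_exists : exists E e, stage_chain E e.
Proof.
(* Both choices are made for all arguments, with junk where the hypothesis fails, so that the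
   recursion below runs on plain data. *)
have /choice[h hP] : forall ke : nat * R, exists h, 0 < ke.2 -> stage_map N ke.1 ke.2 h.
  move=> [k e]; have [e0|e0] := ltP 0 e; last by exists id.
  by have [h hP] := stage_map_exists M0 tN k e0; exists h.
have /choice[m mP] : forall kE : nat * (S -> S), exists d, stage_homeo kE.1 kE.2 ->
    0 < d /\ forall p q, cube R p -> cube R q ->
    (forall i, (i < kE.1)%N -> `|kE.2 p i - kE.2 q i| <= d) ->
    forall i, (i < kE.1)%N -> `|p i - q i| <= kE.1.+1%:R^-1.
  move=> [k E]; have [Ek|nEk] := pselect (stage_homeo k E); last by exists 0 => /nEk.
  have k0 : 0 < k.+1%:R^-1 :> R by rewrite invr_gt0.
  by have [d d0 dP] := stage_homeo_modulus Ek k0; exists d.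
(* The new tolerance depends on the map just built: a quarter of its modulus [m] gives [chain_inj],
   half of the old tolerance makes all later displacements summable. *)
pose next k (u : (S -> S) * R) :=
  let E := h (k, u.2) \o u.1 in (E, Num.min (u.2 / 2) (m (k.+1, E) / 4)).
pose fix u k := if k is j.+1 then next j (u j) else (id, 1).
have uP k : stage_homeo k (u k).1 /\ 0 < (u k).2.
  elim: k => [|k [uk1 uk2]]; first by split=> //=; exact: stage_homeo0.
  have uk : stage_homeo k.+1 (u k.+1).1 by exact: stage_homeoS uk1 (hP (k, _) uk2).
  split=> //=; rewrite lt_min !divr_gt0//.
  by have [] := mP (k.+1, _) uk.
exists (fun k => (u k).1), (fun k => (u k).2); split.
- by move=> k; case: (uP k).
- by move=> k; case: (uP k).
- by move=> k /=; rewrite ge_min lexx.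
- move=> k q i cq ik; have [uk1 uk2] := uP k.
  by have := stage_near (hP (k, _) uk2) (homeo_sub uk1 cq) ik.
- move=> [//|k] p q cp cq pq; have [uk _] := uP k.+1.
  have [_ +] := mP (k.+1, _) uk; apply=> //= i ik.
  apply: le_trans (pq i ik) _.
  by rewrite mulrC -ler_pdivlMr//= ge_min lexx orbT.
Qed.

Lemma tower_keller : exists H G : S -> S,
  [/\ forall q, cube R q -> forall k, N k (H q) <= 1,
      forall w, (forall k, N k w <= 1) -> cube R (G w) /\ H (G w) = w,
      forall q, cube R q -> G (H q) = q,
      {within cube R, continuous H} &
      {within [set w | forall k, N k w <= 1], continuous G}].
Proof.
have [E [e Ee]] := stage_chain_exists.
have e_half k j : e (k + j)%N <= e k / (2 ^+ j).
  elim: j => [|j IH]; first by rewrite addn0 expr0 divr1.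
  rewrite addnS (le_trans (chain_half Ee _))// exprSr invfM mulrA.
  by rewrite ler_pM2r// invr_gt0.
have e_small x : 0 < x -> forall i, exists2 k, (i < k)%N & e k < x.
  move=> x0 i; have [j ej] : exists j, e i.+1 / x < 2 ^+ j.
    have : 0 <= e i.+1 / x by rewrite divr_ge0// ltW// (chain_gt0 Ee).
    move=> /archi_boundP; set j := Num.bound _ => ej; exists j.
    apply: lt_le_trans ej _; rewrite -natrX ler_nat; apply: ltnW.
    exact: ltn_expl.
  exists (i.+1 + j)%N; first by rewrite leq_addr.
  apply: le_lt_trans (e_half _ _) _; rewrite ltr_pdivrMr ?exprn_gt0//.
  by rewrite mulrC -ltr_pdivrMr.
(* For [k > i] the intervals of radius [2 * e k] about [E k q i] are nested, since [e] at least
   halves each time; the supremum of their left ends lies in all of them. *)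
pose H q : S := fun i => sup [set E k q i - 2 * e k | k in [set k | (i < k)%N]].
have step_le q i k m : cube R q -> (i < k)%N -> (k <= m)%N ->
    E k q i - 2 * e k <= E m q i - 2 * e m /\ E m q i + 2 * e m <= E k q i + 2 * e k.
  move=> cq ik km; rewrite -(subnKC km); elim: (m - k)%N => [|j [IH1 IH2]].
    by rewrite addn0.
  have := chain_close Ee cq (leq_trans ik (leq_addr j k)).
  have := chain_half Ee (k + j); rewrite addnS ler_norml => he /andP[c1 c2].
  by split; lra.
have HE q i k : cube R q -> (i < k)%N -> `|H q i - E k q i| <= 2 * e k.
  move=> cq ik.
  have ub : ubound [set E k q i - 2 * e k | k in [set k | (i < k)%N]] (E k q i + 2 * e k).
    move=> _ [m /= im <-]; have [km|/ltnW mk] := leqP k m.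
      have [_] := step_le q i k m cq ik km; have := chain_gt0 Ee m; lra.
    have [+ _] := step_le q i m k cq im mk; have := chain_gt0 Ee k; lra.
  rewrite ler_distl; apply/andP; split.
    by apply: ub_le_sup; [exists (E k q i + 2 * e k)|exists k].
  by apply: ge_sup => //; exists (E k q i - 2 * e k), k.
have e_anti k m : (k <= m)%N -> e m <= e k.
  move=> km; rewrite -(subnKC km) (le_trans (e_half _ _))// ler_piMr//.
    by rewrite ltW// (chain_gt0 Ee).
  by rewrite invf_le1 ?exprn_gt0// exprn_ege1// ler1n.
have cvg_close (y : nat -> S) (x : S) : (forall k i, (i < k)%N -> `|x i - y k i| <= 2 * e k) ->
    y @ \oo --> x.
  move=> yx; apply/(@pointwise_cvgP nat R (y @ \oo) x _) => i.
  apply/cvgrPdist_lt => c c0; have c2 : 0 < c / 2 by rewrite divr_gt0.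
  have [k ik ek] := e_small _ c2 i.
  exists k => // m /= km; apply: le_lt_trans (yx m i (leq_trans ik km)) _.
  by have := e_anti k m km; lra.
(* For fixed [k] the gauge passes to the limit, and on stage [m] with [m >= k] it is at most [N m],
   hence at most 1. *)
have HW q : cube R q -> forall k, N k (H q) <= 1.
  move=> cq k; have EH : (fun m => E m q) @ \oo --> H q.
    by apply: cvg_close => m i im; exact: HE.
  have : (fun m => N k (E m q)) @ \oo --> N k (H q).
    have ck : continuous_at (H q) (N k) by exact: (cts_tower tN).
    exact: (@continuous_cvg _ _ _ \oo _ (fun m => E m q) (N k) (H q) ck EH).
  apply: (@closed_cvg _ _ _ _ (fun m => N k (E m q)) [set t | t <= 1]
    (@closed_le R 1)) => //.
  exists k => // m /= km; apply: le_trans (tower_le_mono tN _ km) _.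
  by have [] := homeo_sub (chain_homeo Ee m) cq.
have ctsH : {within cube R, continuous H}.
  apply/subspace_continuousP => q cq; rewrite /from_subspace.
  apply/(@pointwise_cvgP nat R (H @ within (cube R) (nbhs q)) (H q) _) => i.
  apply/cvgrPdist_lt => c c0; have c6 : 0 < c / 6 by rewrite divr_gt0.
  have [k ik ek] := e_small _ c6 i; have c3 : 0 < c / 3 by rewrite divr_gt0.
  have ctsE : continuous_at q (fun p => E k p i).
    apply: (@cts_comp S S R q (E k) (fun x => x i)); last exact: cts_coord.
    exact: homeo_cts (chain_homeo Ee k) _ cq.
  have /cts_dist/(_ _ c3) := ctsE.
  rewrite /nbhs /= /nbhs /= /within /=; apply: filterS => p + cp.
  have := HE _ _ _ cq ik; have := HE _ _ _ cp ik.
  rewrite ler_norml ltr_norml ler_norml => /andP[? ?] /andP[? ?] /andP[? ?].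
  by rewrite /preimage /= ltr_norml; apply/andP; split; lra.
(* Two points with the same limit have images within [2 * e k + 2 * e k] of each other at stage [k],
   which is the threshold of [chain_inj]. *)
have Hinj p q : cube R p -> cube R q -> H p = H q -> p = q.
  move=> cp cq pq; apply/funext => j; apply/eqP; rewrite -subr_eq0 -normr_le0.
  rewrite leNgt; apply/negP => pq0.
  have [k kx] : exists k, `|p j - q j|^-1 < k%:R.
    by exists (Num.bound `|p j - q j|^-1); apply: archi_boundP; rewrite invr_ge0 ltW.
  have jm : (j < (j + k).+1)%N by rewrite ltnS leq_addr.
  have : `|p j - q j| <= ((j + k).+2)%:R^-1.
    apply: (chain_inj Ee cp cq) => // i im.
    have := HE _ _ _ cq im; have := HE _ _ _ cp im; rewrite pq !ler_norml.
    by move=> /andP[? ?] /andP[? ?]; apply/andP; split; lra.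
  apply/negP; rewrite -ltNge invf_plt ?posrE// (lt_le_trans kx)// ler_nat.
  by rewrite ltnW// ltnW// !ltnS leq_addl.
(* Truncating [w] after [k] coordinates gives a point of stage [k], the image of some [q k]. Then
   [H (q k)] tends to [w], and the image of the compact cube is closed. *)
have Honto w : (forall k, N k w <= 1) -> exists2 q, cube R q & H q = w.
  move=> w1; have /choice[q qP] : forall k, exists q, cube R q /\
      forall i, (i < k)%N -> E k q i = w i.
    move=> k; pose wk : S := fun i => if (i < k)%N then w i else 0.
    have wkw i : (i < k)%N -> wk i = w i by rewrite /wk => ->.
    have [|q cq Eq] := @homeo_onto _ _ (chain_homeo Ee k) wk.
      split=> [|i ki]; first by rewrite (tower_local tN wkw).
      by rewrite /wk ltnNge ki normr0.
    by exists q; split=> // i ik; rewrite Eq wkw.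
  have cH : closed (H @` cube R).
    apply: compact_closed; first exact: hausdorff_seq.
    by apply: continuous_compact => //; exact: compact_cube.
  suff [q' cq' Hq'] : (H @` cube R) w by exists q'.
  apply: (@closed_cvg _ _ \oo _ (fun k => H (q k)) (H @` cube R) cH).
    by exists 0%N => // k _; exists (q k) => //; case: (qP k).
  apply: cvg_close => k i ik; have [cq Eq] := qP k.
  by rewrite -(Eq i ik) distrC; exact: HE.
pose G w : S := xget (fun=> 0 : R) [set q | cube R q /\ H q = w].
have GP w : (forall k, N k w <= 1) -> cube R (G w) /\ H (G w) = w.
  move=> /Honto[q cq qw].
  by apply: (@xgetPex _ _ [set q | cube R q /\ H q = w]); exists q.
have GK q : cube R q -> G (H q) = q.
  move=> cq; have [cG HG] := GP _ (HW q cq).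
  exact: Hinj.
exists H, G; split => //.
have -> : [set w | forall k, N k w <= 1] = H @` cube R.
  apply/seteqP; split=> w; first by move=> /Honto[q cq qw]; exists q.
  by move=> [q cq <-]; exact: HW.
apply: compact_inverse_continuous => //; [exact: hausdorff_seq|exact: compact_cube].
Qed.

End TowerLimit.
(** * Support functions *)

Section SupportFunctions.
Context {R : realType} {n : nat}.
Notation V := 'rV[R]_n.
Implicit Types (x y z u v : V) (A : set V) (p q h : V -> R).

Definition dot x y : R := \sum_i x ord0 i * y ord0 i.

Lemma dotC x y : dot x y = dot y x.
Proof. by apply: eq_bigr => i _; rewrite mulrC. Qed.

Lemma dotDl x y u : dot (x + y) u = dot x u + dot y u.
Proof. by rewrite -big_split; apply: eq_bigr => i _; rewrite mxE mulrDl. Qed.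

Lemma dotZl a x u : dot (a *: x) u = a * dot x u.
Proof. by rewrite mulr_sumr; apply: eq_bigr => i _; rewrite mxE mulrA. Qed.

Lemma dotNl x u : dot (- x) u = - dot x u.
Proof. by rewrite -scaleN1r dotZl mulN1r. Qed.

Lemma dotBl x y u : dot (x - y) u = dot x u - dot y u.
Proof. by rewrite dotDl dotNl. Qed.

Lemma dotDr x u v : dot x (u + v) = dot x u + dot x v.
Proof. by rewrite !(dotC x) dotDl. Qed.

Lemma dotZr a x u : dot x (a *: u) = a * dot x u.
Proof. by rewrite !(dotC x) dotZl. Qed.

Lemma dotNr x u : dot x (- u) = - dot x u.
Proof. by rewrite !(dotC x) dotNl. Qed.

Lemma dotBr x u v : dot x (u - v) = dot x u - dot x v.
Proof. by rewrite !(dotC x) dotBl. Qed.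

Lemma dot0l u : dot 0 u = 0.
Proof. by rewrite -(scale0r 0) dotZl mul0r. Qed.

Lemma dotxx x : dot x x = enorm x ^+ 2.
Proof. by rewrite sqr_enorm; apply: eq_bigr => i _; rewrite expr2. Qed.

Lemma dot_le_enorm x y : dot x y <= enorm x * enorm y.
Proof. exact: enorm_dot_le. Qed.

Lemma enormZ a x : enorm (a *: x) = `|a| * enorm x.
Proof.
apply: (@pexpIrn _ 2) => //; rewrite ?nnegrE ?enorm_ge0 ?mulr_ge0 ?enorm_ge0//.
by rewrite exprMn -!dotxx dotZl dotZr mulrA -expr2 real_normK ?num_real.
Qed.

Lemma enormN x : enorm (- x) = enorm x.
Proof. by rewrite -scaleN1r enormZ normrN1 mul1r. Qed.

Lemma norm_dot_le x y : `|dot x y| <= enorm x * enorm y.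
Proof.
rewrite ler_norml dot_le_enorm andbT lerNl -dotNl -(enormN x).
exact: dot_le_enorm.
Qed.

Lemma enorm_gt0 x : (0 < enorm x) = (x != 0).
Proof.
rewrite lt_neqAle enorm_ge0 andbT eq_sym; apply/idP/idP; apply: contra_neq.
  by move=> ->; exact: enorm0.
exact: enorm0_eq0.
Qed.

Lemma cts_row i x : continuous_at x (fun y : V => y ord0 i).
Proof. exact: coord_continuous. Qed.

Lemma cts_dot u x : continuous_at x (fun y : V => dot y u).
Proof.
by apply: cts_sum => i _; apply: ctsM; [exact: cts_row|exact: cts_cst].
Qed.

Lemma enorm_lip x y : `|enorm x - enorm y| <= enorm (x - y).
Proof.
have := enormD (x - y) y; have := enormD (y - x) x; rewrite !subrK.
by rewrite -(enorm_subC x y) ler_norml => ? ?; apply/andP; split; lra.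
Qed.

Lemma cts_enorm x : continuous_at x (enorm : V -> R).
Proof.
apply/cts_dist => e e0; have d0 : 0 < e / n.+1%:R by rewrite divr_gt0.
have /cvgrPdist_lt/(_ _ d0) : (y : V) @[y --> x] --> x by exact: cvg_id.
apply: filterS => y xy; apply: le_lt_trans (enorm_lip _ _) _.
apply: le_lt_trans (enorm_le_norm _) _; rewrite -mulr_natr.
apply: (@le_lt_trans _ _ (`|x - y| * n.+1%:R)).
  by rewrite ler_wpM2l// ler_nat.
by rewrite -ltr_pdivlMr.
Qed.

Lemma convexP A : convex_set (A : set (convex_lmodType V)) <->
  (forall x y t, A x -> A y -> 0 <= t <= 1 -> A (x + t *: (y - x))).
Proof.
split=> [cA x y t Ax Ay /andP[t0 t1]|cA x y l /set_mem Ax /set_mem Ay].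
  have /set_mem := cA y x (Itv01 t0 t1) (mem_set Ay) (mem_set Ax).
  congr A; rewrite [LHS]/conv /=; apply/rowP => i.
  by rewrite !mxE /unstable.onem; ring.
apply/mem_set; have l01 : 0 <= l%:num <= 1 by rewrite ge0 le1.
have := cA y x _ Ay Ax l01; congr A; rewrite [RHS]/conv /=.
by apply/rowP => i; rewrite !mxE /unstable.onem; ring.
Qed.

Definition supp A u : R := sup [set dot x u | x in A].

Lemma supp_attained A u : A !=set0 -> compact A ->
  exists x, [/\ A x, dot x u = supp A u & forall y, A y -> dot y u <= dot x u].
Proof.
move=> A0 cA; have [x /set_mem Ax xmax] : exists2 x, x \in A &
    forall y, y \in A -> dot y u <= dot x u.
  apply: compact_EVT_max => //; apply: continuous_in_subspaceT => z _.
  exact: cts_dot.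
have {}xmax y : A y -> dot y u <= dot x u by move=> /mem_set; exact: xmax.
exists x; split => //; apply/eqP; rewrite eq_le; apply/andP; split.
  apply: ub_le_sup; last by exists x.
  by exists (dot x u) => _ [y Ay <-]; exact: xmax.
apply: ge_sup; first by exists (dot x u), x.
by move=> _ [y Ay <-]; exact: xmax.
Qed.

Lemma supp_ge A x u : compact A -> A x -> dot x u <= supp A u.
Proof.
move=> cA Ax; have [|y [Ay <- ymax]] := @supp_attained A u _ cA; first by exists x.
exact: ymax.
Qed.

Lemma supp_le A u c : A !=set0 -> compact A ->
  (forall x, A x -> dot x u <= c) -> supp A u <= c.
Proof. by move=> A0 cA Ac; have [x [Ax <- _]] := supp_attained u A0 cA; exact: Ac. Qed.

Definition sublinear h := (forall u v, h (u + v) <= h u + h v) /\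
  (forall t u, 0 <= t -> h (t *: u) = t * h u).

Lemma supp_sublinear A : A !=set0 -> compact A -> sublinear (supp A).
Proof.
move=> A0 cA; split=> [u v|t u t0].
  by apply: supp_le => // x Ax; rewrite dotDr lerD// supp_ge.
apply/eqP; rewrite eq_le; apply/andP; split.
  by apply: supp_le => // x Ax; rewrite dotZr ler_wpM2l// supp_ge.
have [x [Ax <- _]] := supp_attained u A0 cA.
by rewrite -dotZr supp_ge.
Qed.

(** If the angle at the nearest point were acute, a short move towards [z] would bring it closer to
    [x]. *)
Lemma nearest_point A x : A !=set0 -> compact A ->
  (forall x y t, A x -> A y -> 0 <= t <= 1 -> A (x + t *: (y - x))) ->
  exists2 y, A y & forall z, A z -> dot (z - y) (x - y) <= 0.
Proof.
move=> A0 cA vA; have [y /set_mem Ay ymin] : exists2 y, y \in A &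
    forall z, z \in A -> enorm (y - x) <= enorm (z - x).
  apply: (@compact_EVT_min V R (fun y => enorm (y - x))) => //.
  apply: continuous_in_subspaceT => z _.
  apply: (@cts_comp V V R z (fun y => y - x) enorm); last exact: cts_enorm.
  exact: (@cvgB _ V V (nbhs z) _ id (fun=> x) z x cvg_id (cvg_cst _)).
exists y => // z Az; rewrite leNgt; apply/negP => c0.
set c := dot _ _ in c0; pose b := enorm (z - y) ^+ 2.
have b0 : 0 <= b by exact: sqr_ge0.
(* Small enough for the linear gain [2 * t * c] to beat the quadratic loss [t ^+ 2 * b]. *)
pose t := Num.min 1 (c / (b + 1)).
have t0 : 0 < t by rewrite lt_min ltr01 divr_gt0// ltr_wpDl.
have t1 : t <= 1 by rewrite ge_min lexx.
have tb : t * b < c * 2.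
  have tb1 : t * (b + 1) <= c by rewrite -ler_pdivlMr ?ltr_wpDl// ge_min lexx orbT.
  by have := ltr_wpDl (ltW c0) c0; lra.
have := ymin _ (mem_set (vA y z t Ay Az _)); rewrite (ltW t0) t1 => /(_ isT).
have expand w v : enorm (w + t *: v) ^+ 2 =
    enorm w ^+ 2 + t * (dot v w * 2 + t * enorm v ^+ 2).
  by rewrite -!dotxx dotDl !dotDr !dotZl !dotZr (dotC w v); ring.
rewrite addrAC -ler_sqr ?nnegrE ?enorm_ge0// expand -/b lerDl.
have -> : dot (z - y) (y - x) = - c by rewrite -(opprB x y) dotNr.
rewrite (_ : - c * 2 + t * b = t * b - c * 2); last by ring.
by rewrite pmulr_rge0// subr_ge0 leNgt tb.
Qed.

(** Testing the hypothesis at [u = x - y], with [y] the nearest point of [A], bounds the square of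
    the distance by [e] times the distance. *)
Lemma supp_near A x e : A !=set0 -> compact A ->
  (forall x y t, A x -> A y -> 0 <= t <= 1 -> A (x + t *: (y - x))) ->
  0 <= e -> (forall u, dot x u <= supp A u + e * enorm u) ->
  exists2 y, A y & enorm (x - y) <= e.
Proof.
move=> A0 cA vA e0 xA; have [y Ay ynear] := nearest_point x A0 cA vA.
exists y => //; have [->|xy] := eqVneq (x - y) 0; first by rewrite enorm0.
have : supp A (x - y) <= dot y (x - y).
  by apply: supp_le => // z Az; rewrite -subr_le0 -dotBl ynear.
have := xA (x - y); rewrite -{1}(subrK y x) dotDl dotxx => h1 h2.
have : enorm (x - y) * enorm (x - y) <= e * enorm (x - y) by rewrite -expr2; lra.
by rewrite ler_pM2r// enorm_gt0.
Qed.

Lemma sublinear0 h : sublinear h -> h 0 = 0.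
Proof. by move=> [_ hZ]; rewrite -(scale0r 0) hZ// mul0r. Qed.

Lemma sublinear_ge0 h u : sublinear h -> 0 <= h u + h (- u).
Proof.
by move=> sh; have [hD _] := sh; rewrite -(sublinear0 sh) -(subrr u).
Qed.

(* [tilt p v] is the largest sublinear minorant of [p] that is linear on the
   line of [v] with the same value at [v]. *)
Definition tilt p v u : R := inf [set p (u + t *: v) - t * p v | t in [set t | 0 <= t]].

Lemma tilt_set_neq0 p v u :
  [set p (u + t *: v) - t * p v | t in [set t | 0 <= t]] !=set0.
Proof. by exists (p (u + 0 *: v) - 0 * p v); exists 0 => /=. Qed.

Lemma tilt_le p v u t : sublinear p -> 0 <= t -> tilt p v u <= p (u + t *: v) - t * p v.
Proof.
move=> [pD pZ] t0; apply: ge_inf; last by exists t.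
exists (- p (- u)) => _ [s /= s0 <-].
have := pD (u + s *: v) (- u); rewrite addrAC subrr add0r pZ//; lra.
Qed.

Lemma tilt_ge p v u c : (forall t, 0 <= t -> c <= p (u + t *: v) - t * p v) ->
  c <= tilt p v u.
Proof.
by move=> cp; apply: lb_le_inf; [exact: tilt_set_neq0|move=> _ [t /= /cp ? <-]].
Qed.

Lemma tilt_le_id p v u : sublinear p -> tilt p v u <= p u.
Proof.
by move=> /(tilt_le v u)/(_ (lexx 0)); rewrite scale0r addr0 mul0r subr0.
Qed.

Lemma tiltN p v : sublinear p -> tilt p v (- v) <= - p v.
Proof.
move=> sp; have := tilt_le v (- v) sp ler01.
by rewrite scale1r addNr mul1r (sublinear0 sp) add0r.
Qed.

Lemma tilt_sublinear p v : sublinear p -> sublinear (tilt p v).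
Proof.
move=> sp; have [pD pZ] := sp; split=> [u w|t u].
  rewrite -lerBlDr; apply: tilt_ge => s s0; rewrite lerBlDr -lerBlDl.
  apply: tilt_ge => r r0; rewrite lerBlDl.
  apply: le_trans (tilt_le v _ sp (addr_ge0 r0 s0)) _.
  have := pD (w + r *: v) (u + s *: v).
  rewrite (_ : w + r *: v + _ = u + w + (r + s) *: v); first by lra.
  by apply/rowP => i; rewrite !mxE; ring.
rewrite le_eqVlt => /predU1P[<-|t0].
  rewrite scale0r mul0r; apply/eqP; rewrite eq_le; apply/andP; split.
    by rewrite (le_trans (tilt_le_id _ _ sp))// (sublinear0 sp).
  by apply: tilt_ge => s s0; rewrite add0r pZ// subrr.
(* One inequality for every positive factor suffices: the other one is the same for the inverse
   factor. *)
have half c w : 0 < c -> c * tilt p v w <= tilt p v (c *: w).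
  move=> c0; apply: tilt_ge => s s0.
  have sc : 0 <= s / c by rewrite divr_ge0// ltW.
  have := tilt_le v w sp sc; rewrite -(ler_pM2l c0) => /le_trans; apply.
  rewrite mulrBr -(pZ c (w + _)) ?(ltW c0)// scalerDr scalerA.
  have -> : c * (s / c) = s by rewrite mulrC divfK ?gt_eqF.
  by rewrite [c * _]mulrA [c * (s / c)]mulrC divfK ?gt_eqF.
apply/eqP; rewrite eq_le half// andbT -ler_pdivrMl//.
have := half t^-1 (t *: u); rewrite invr_gt0 t0 => /(_ isT).
by rewrite scalerA mulVf ?gt_eqF// scale1r.
Qed.

(** Tilt at one vector after the other: a later tilt only lowers [q], so the inequality persists at
    the vectors already treated. In finite dimension a basis suffices for [s], and no maximality
    principle is involved. *)
Lemma linear_minorant p (s : seq V) : sublinear p ->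
  exists q, [/\ sublinear q, forall u, q u <= p u &
    forall v, v \in s -> q v + q (- v) <= 0].
Proof.
move=> sp; elim: s => [|v s [q [sq qp qs]]]; first by exists p.
exists (tilt q v); split; first exact: tilt_sublinear.
  by move=> u; apply: le_trans (qp u); exact: tilt_le_id.
move=> w; rewrite inE => /predU1P[->|/qs ws].
  by have := tiltN v sq; have := tilt_le_id v v sq; lra.
by have := tilt_le_id v w sq; have := tilt_le_id v (- w) sq; lra.
Qed.

Lemma sum_sublinear h (I : Type) (r : seq I) (F : I -> V) : sublinear h ->
  h (\sum_(i <- r) F i) <= \sum_(i <- r) h (F i).
Proof.
move=> sh; have [hD _] := sh; elim: r => [|i r IH].
  by rewrite !big_nil sublinear0.
by rewrite !big_cons (le_trans (hD _ _))// lerD2l.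
Qed.

Lemma row_sum_basis u : u = \sum_i u ord0 i *: delta_mx ord0 i.
Proof. exact: row_sum_delta. Qed.

(** The first tilt, at [u0], forces the value there; the following ones make the minorant odd at the
    basis vectors. The linear function with the same values on the basis dominates [q] by
    subadditivity, and by reflection it equals [q]. *)
Lemma hahn_banach h u0 : sublinear h ->
  exists2 x, dot x u0 = h u0 & forall u, dot x u <= h u.
Proof.
move=> sh; have st := tilt_sublinear u0 sh.
have [q [sq qt qlin]] := linear_minorant [seq delta_mx ord0 i | i : 'I_n] st.
have {}qlin i : q (- delta_mx ord0 i) = - q (delta_mx ord0 i).
  apply/eqP; rewrite -subr_eq0 opprK addrC eq_le sublinear_ge0// andbT.
  by apply: qlin; apply: map_f; rewrite mem_enum.
have qh u : q u <= h u by apply: le_trans (qt u) _; exact: tilt_le_id.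
pose x : V := \row_i q (delta_mx ord0 i).
have qZ i t : q (t *: delta_mx ord0 i) = t * q (delta_mx ord0 i).
  have [_ hZ] := sq; have [t0|t0] := leP 0 t; first exact: hZ.
  rewrite -(opprK t) scaleNr -scalerN hZ; last by rewrite oppr_ge0 ltW.
  by rewrite qlin; ring.
have qx u : q u <= dot x u.
  rewrite {1}[u]row_sum_basis; apply: le_trans (sum_sublinear _ _ sq) _.
  by apply: ler_sum => i _; rewrite qZ mxE mulrC.
have xq u : dot x u <= q u.
  by have := qx (- u); have := sublinear_ge0 u sq; rewrite dotNr; lra.
exists x => [|u]; last exact: le_trans (xq u) (qh u).
apply/eqP; rewrite eq_le (le_trans (xq u0) (qh u0))/=.
have := qx u0; have := sublinear_ge0 u0 sq; have := qt (- u0).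
by have := tiltN u0 sh; lra.
Qed.

Lemma sublinear_supp h : sublinear h -> exists K : cc R n, supp K = h.
Proof.
move=> sh; pose A : set V := [set x | forall u, dot x u <= h u].
have A0 : A !=set0 by have [x _ xA] := hahn_banach 0 sh; exists x.
have clA : closed A.
  have -> : A = \bigcap_(u in setT) [set x | dot x u <= h u].
    by apply/seteqP; split=> [x Ax u _|x Ax u]; [exact: Ax|exact: (Ax u I)].
  apply: closed_bigI => u _.
  have -> : [set x | dot x u <= h u] = (dot^~ u) @^-1` [set t | t <= h u] by [].
  by apply: closed_comp; [move=> x _; exact: cts_dot|exact: closed_le].
have bA : bounded_set A.
  pose C := \sum_(i < n) (`|h (delta_mx ord0 i)| + `|h (- delta_mx ord0 i)|).
  exists C; split; first exact: num_real.
  move=> c Cc x Ax; apply: le_trans (ltW Cc); rewrite [leLHS]mx_normrE.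
  have C0 : 0 <= C by apply: sumr_ge0 => i _; rewrite addr_ge0.
  apply: bigmax_le => // -[j i] _ /=; rewrite ord1.
  have xi : dot x (delta_mx ord0 i) = x ord0 i.
    rewrite /dot (bigD1 i)//= mxE !eqxx mulr1 big1 ?addr0// => l li.
    by rewrite mxE eqxx/= (negbTE li) mulr0.
  apply: (@le_trans _ _ (`|h (delta_mx ord0 i)| + `|h (- delta_mx ord0 i)|)).
    have := Ax (delta_mx ord0 i); have := Ax (- delta_mx ord0 i).
    rewrite dotNr xi; have := ler_norm (h (delta_mx ord0 i)).
    have := ler_norm (h (- delta_mx ord0 i)).
    have := normr_ge0 (h (delta_mx ord0 i)); have := normr_ge0 (h (- delta_mx ord0 i)).
    by rewrite ler_norml => ? ? ? ? ? ?; apply/andP; split; lra.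
  by rewrite /C (bigD1 i)//= lerDl; apply: sumr_ge0 => l _; rewrite addr_ge0.
have cA : compact A by exact: bounded_closed_compact.
have vA : convex_set (A : set (convex_lmodType V)).
  apply/convexP => x y t Ax Ay /andP[t0 t1] u.
  rewrite (_ : x + _ = (1 - t) *: x + t *: y); last first.
    by apply/rowP => i; rewrite !mxE; ring.
  rewrite dotDl !dotZl.
  have : (1 - t) * dot x u <= (1 - t) * h u by rewrite ler_wpM2l ?subr_ge0.
  have : t * dot y u <= t * h u by rewrite ler_wpM2l.
  lra.
exists (CC A0 cA vA); apply/funext => u /=; apply/eqP; rewrite eq_le.
apply/andP; split; first by apply: supp_le => // x; exact.
by have [x <- xA] := hahn_banach u sh; exact: supp_ge.
Qed.

Implicit Types (K L : cc R n).

Lemma cc_segment K x y t : cc_set K x -> cc_set K y -> 0 <= t <= 1 -> cc_set K (x + t *: (y - x)).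
Proof. by move: x y t; apply/convexP; exact: cc_convex. Qed.

Lemma cc_supp_near K x e : 0 <= e ->
  (forall u, dot x u <= supp K u + e * enorm u) -> thickening e K x.
Proof.
move=> e0 xK; apply: supp_near => //; [exact: cc_neq0|exact: cc_compact|].
exact: cc_segment.
Qed.

Lemma cc_supp_ge K x u : cc_set K x -> dot x u <= supp K u.
Proof. by move=> Kx; apply: supp_ge => //; exact: cc_compact. Qed.

Lemma cc_supp_attained K u : exists2 x, cc_set K x & dot x u = supp K u.
Proof.
have [|x [Kx xu _]] := @supp_attained K u (cc_neq0 K); first exact: cc_compact.
by exists x.
Qed.

Lemma cc_supp_le K u c : (forall x, cc_set K x -> dot x u <= c) -> supp K u <= c.
Proof. by move=> Kc; have [x Kx <-] := cc_supp_attained K u; exact: Kc. Qed.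

Lemma cc_sublinear K : sublinear (supp K).
Proof. by apply: supp_sublinear; [exact: cc_neq0|exact: cc_compact]. Qed.

(** With [supp_dist_le], this identifies the Hausdorff distance with the least such [e], so the
    topology can be read entirely on support functions. *)
Lemma hausdorff_dist_le K L e : 0 <= e ->
  (forall u, `|supp K u - supp L u| <= e * enorm u) -> hausdorff_dist K L <= e.
Proof.
move=> e0 KL; apply: ge_inf; first exact: hausdorff_radii_lbound.
have near (A B : cc R n) x : (forall u, `|supp A u - supp B u| <= e * enorm u) ->
    cc_set A x -> thickening e B x.
  move=> AB Ax; apply: cc_supp_near => // u.
  by have := AB u; have := cc_supp_ge u Ax; rewrite ler_norml => ? /andP[? ?]; lra.
split=> // x; apply: near => // u.
by rewrite distrC.
Qed.

Lemma supp_dist_le K L u :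
  `|supp K u - supp L u| <= hausdorff_dist K L * enorm u.
Proof.
have half (A B : cc R n) r : A `<=` thickening r B -> supp A u <= supp B u + r * enorm u.
  move=> AB; apply: cc_supp_le => x /AB[y By xy]; rewrite -{1}(subrK y x) dotDl addrC.
  apply: lerD; first exact: cc_supp_ge.
  by apply: le_trans (dot_le_enorm _ _) _; rewrite ler_wpM2r ?enorm_ge0.
have all r : hausdorff_radii K L r -> `|supp K u - supp L u| <= r * enorm u.
  move=> [r0 KL LK]; have := half _ _ _ KL; have := half _ _ _ LK.
  by rewrite ler_norml => ? ?; apply/andP; split; lra.
have radii0 : hausdorff_radii K L !=set0.
  by apply: hausdorff_radii_neq0; [exact: cc_neq0|exact: cc_neq0|
    exact: cc_compact|exact: cc_compact].
have [u0|u0] := eqVneq (enorm u) 0.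
  by have [r /all] := radii0; rewrite u0 !mulr0.
have {}u0 : 0 < enorm u by rewrite lt_neqAle eq_sym u0 enorm_ge0.
rewrite -ler_pdivrMr//; apply: lb_le_inf => // r /all.
by rewrite ler_pdivrMr.
Qed.

Lemma supp_inj K L : supp K = supp L -> K = L.
Proof.
move=> KL; apply: cc_eq.
have sub (A B : cc R n) : supp A = supp B -> A `<=` B.
  move=> AB x Ax; have [|y By xy] := @cc_supp_near B x 0 (lexx 0).
    by move=> u; rewrite mul0r addr0 -AB cc_supp_ge.
  have /eqP : enorm (x - y) = 0.
    by apply/eqP; rewrite eq_le xy enorm_ge0.
  by move=> /eqP/enorm0_eq0/eqP; rewrite subr_eq0 => /eqP ->.
by apply/seteqP; split; exact: sub.
Qed.

(** The two sides of the second equation are the support functions of the difference set and of the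
    ball, and a support function determines its compact convex set. *)
Lemma minkowski_sub_ball K L c r : 0 < r ->
  minkowski_sub K L = eball c r <->
  forall u, supp K u + supp L (- u) = dot c u + r * enorm u.
Proof.
move=> r0.
have attain u : exists x y, [/\ cc_set K x, cc_set L y & dot (x - y) u = supp K u + supp L (- u)].
  have [x Kx <-] := cc_supp_attained K u.
  have [y Ly <-] := cc_supp_attained L (- u).
  by exists x, y; split => //; rewrite dotBl dotNr.
have sub_le x y u : cc_set K x -> cc_set L y -> dot (x - y) u <= supp K u + supp L (- u).
  by move=> Kx Ly; rewrite dotBl -dotNr; apply: lerD; exact: cc_supp_ge.
split=> [KL u|KL].
  apply/eqP; rewrite eq_le; apply/andP; split.
    have [x [y [Kx Ly <-]]] := attain u.
    have : eball c r (x - y) by rewrite -KL; exists x => //; exists y.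
    rewrite /eball /= -{2}(subrK c (x - y)) dotDl => xyc.
    rewrite addrC lerD2l (le_trans (dot_le_enorm _ _))//.
    by rewrite ler_wpM2r ?enorm_ge0.
  have [->|u0] := eqVneq u 0.
    by rewrite oppr0 enorm0 mulr0 addr0 dotC dot0l !sublinear0 ?addr0//; exact: cc_sublinear.
  have eu : 0 < enorm u by rewrite enorm_gt0.
  (* The point of the ball farthest in the direction [u]. *)
  have : eball c r (c + (r / enorm u) *: u).
    rewrite /eball /= addrAC subrr add0r enormZ ger0_norm ?divr_ge0 ?(ltW r0) ?enorm_ge0//.
    by rewrite divfK ?gt_eqF.
  rewrite -KL => -[x Kx [y Ly xy]]; have := sub_le _ _ u Kx Ly.
  by rewrite xy dotDl dotZl dotxx expr2 mulrA divfK ?gt_eqF.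
apply/seteqP; split=> [_ [x Kx [y Ly <-]]|z zc].
  rewrite /eball /=; have [->|xy] := eqVneq (x - y - c) 0.
    by rewrite enorm0 ltW.
  have := sub_le _ _ (x - y - c) Kx Ly; rewrite KL -lerBlDl -dotBl dotxx expr2.
  by rewrite ler_pM2r// enorm_gt0.
pose diff := minkowski_sub K L.
(* With radius 0, [supp_near] turns an inequality of support functions into membership. *)
suff zd : thickening 0 diff z.
  have [_ [x Kx [y Ly <-]] zxy] := zd; exists x => //; exists y => //.
  apply/esym/eqP; rewrite -subr_eq0; apply/eqP/enorm0_eq0/eqP.
  by rewrite eq_le zxy enorm_ge0.
have diff0 : diff !=set0.
  have [[x Kx] [y Ly]] := (cc_neq0 K, cc_neq0 L).
  by exists (x - y), x => //; exists y.
have cdiff : compact diff.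
  have -> : diff = (fun xy : V * V => xy.1 - xy.2) @` (K `*` L).
    apply/seteqP; split=> [_ [x Kx [y Ly <-]]|_ [[x y] [/= Kx Ly] <-]].
      by exists (x, y).
    by exists x => //; exists y.
  apply: continuous_compact; last by apply: compact_setX; exact: cc_compact.
  apply: continuous_subspaceT => xy.
  exact: (@cvgB _ V (V * V)%type (nbhs xy) _ fst snd _ _ cvg_fst cvg_snd).
apply: supp_near => // [_ _ t [x Kx [y Ly <-]] [x' Kx' [y' Ly' <-]] t01|u].
  exists (x + t *: (x' - x)); first exact: cc_segment.
  exists (y + t *: (y' - y)); first exact: cc_segment.
  by apply/rowP => i; rewrite !mxE; ring.
rewrite mul0r addr0; have [x [y [Kx Ly xyu]]] := attain u.
apply: (@le_trans _ _ (dot (x - y) u)).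
  rewrite xyu KL -lerBlDl -dotBl (le_trans (dot_le_enorm _ _))//.
  by rewrite ler_wpM2r ?enorm_ge0.
by apply: supp_ge => //; exists x => //; exists y.
Qed.

End SupportFunctions.
(** * Normalised shapes *)

Section Dominated.
Context {R : realType} {n : nat}.
Notation V := 'rV[R]_n.
Implicit Types (u v w z : V) (g : V -> R) (i : 'I_n).

Definition defect u v : R := enorm u + enorm v - enorm (u + v).

Lemma defect_ge0 u v : 0 <= defect u v.
Proof. by rewrite subr_ge0 enormD. Qed.

Lemma defect_le u v : defect u v <= enorm v *+ 2.
Proof.
have := enormD (u + v) (- v); rewrite addrK enormN /defect; lra.
Qed.

(* [lam * enorm + g] and [lam * enorm - g] are support functions, and [g] is
   normalised by its values at the coordinate vectors so that no linear
   function other than [0] is dominated. *)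
Record dominated (lam : R) g : Prop := Dominated {
  dominatedZ : forall t u, 0 <= t -> g (t *: u) = t * g u ;
  dominated_defect : forall u v, `|g u + g v - g (u + v)| <= lam * defect u v ;
  dominated_even : forall i, g (- delta_mx ord0 i) = g (delta_mx ord0 i) }.

Lemma dominated0 : dominated 0 (fun=> 0).
Proof. by split=> [t u _|u v|//]; rewrite ?mulr0// addr0 subrr normr0 mul0r. Qed.

Lemma dominated_mono lam mu g : lam <= mu -> dominated lam g -> dominated mu g.
Proof.
move=> lm [gZ gd ge]; split=> // u v; apply: le_trans (gd u v) _.
by rewrite ler_wpM2r// defect_ge0.
Qed.

Lemma dominatedD lam mu g h : dominated lam g -> dominated mu h ->
  dominated (lam + mu) (fun u => g u + h u).
Proof.
move=> [gZ gd ge] [hZ hd he]; split=> [t u t0|u v|i].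
- by rewrite gZ// hZ// mulrDr.
- rewrite mulrDl; apply: le_trans (lerD (gd u v) (hd u v)).
  by apply: le_trans (ler_normD _ _); rewrite le_eqVlt; apply/orP; left;
    apply/eqP; congr (`| _ |); ring.
- by rewrite ge he.
Qed.

Lemma dominated_scale a lam g : dominated lam g ->
  dominated (`|a| * lam) (fun u => a * g u).
Proof.
move=> [gZ gd ge]; split=> [t u t0|u v|i]; last by rewrite ge.
  by rewrite gZ// mulrCA.
by rewrite -mulrA -mulrDr -mulrBr normrM ler_wpM2l.
Qed.

Lemma dominated_sublinear lam g : dominated lam g ->
  sublinear (fun u => lam * enorm u + g u).
Proof.
move=> [gZ gd ge]; split=> [u v|t u t0].
  by have := gd u v; rewrite ler_norml /defect => /andP[? ?]; lra.
by rewrite gZ// enormZ ger0_norm//; ring.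
Qed.

Lemma dominatedN lam g : dominated lam g -> dominated lam (fun u => - g u).
Proof.
move=> /(dominated_scale (-1)); rewrite normrN1 mul1r.
by rewrite (_ : (fun u => -1 * g u) = fun u => - g u)//; apply/funext => u; rewrite mulN1r.
Qed.

Lemma enorm_delta i : enorm (delta_mx ord0 i : V) = 1.
Proof.
rewrite /enorm (bigD1 i)//= mxE !eqxx expr1n big1 ?addr0 ?sqrtr1// => j ji.
by rewrite mxE (negbTE ji) expr0n.
Qed.

Lemma coord_le_enorm u i : `|u ord0 i| <= enorm u.
Proof.
have := norm_dot_le u (delta_mx ord0 i); rewrite enorm_delta mulr1.
rewrite /dot (bigD1 i)//= mxE !eqxx mulr1 big1 ?addr0// => j ji.
by rewrite mxE eqxx (negbTE ji) mulr0.
Qed.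

(** By evenness, the defect 2 of opposite basis vectors gives [g <= lam] at each of them;
    subadditivity of [lam * enorm + g] along the basis does the rest. This bound is what the
    normalisation is for: linear functions would escape it. *)
Lemma dominated_le lam g u : 0 <= lam -> dominated lam g ->
  g u <= (lam * n%:R) *+ 2 * enorm u.
Proof.
move=> l0 dg; have [gZ gd ge] := dg; have [hD hZ] := dominated_sublinear dg.
have sh := dominated_sublinear dg; set h := fun u => _ in hD hZ sh.
have g0 : g 0 = 0 by rewrite -(scale0r 0) gZ// mul0r.
have gt i t : g (t *: delta_mx ord0 i) = `|t| * g (delta_mx ord0 i).
  have [t0|t0] := leP 0 t; first by rewrite gZ// ger0_norm.
  rewrite -{1}(opprK t) scaleNr -scalerN gZ ?oppr_ge0 ?(ltW t0)// ge.
  by rewrite ltr0_norm.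
have hi i t : h (t *: delta_mx ord0 i) <= `|t| * (lam *+ 2).
  rewrite /h gt enormZ enorm_delta mulr1 (mulrC lam) -mulrDr ler_wpM2l//.
  have := gd (delta_mx ord0 i) (- delta_mx ord0 i).
  rewrite subrr g0 subr0 ge /defect subrr enorm0 enormN enorm_delta subr0.
  by rewrite ler_norml => /andP[_ gi]; lra.
apply: (@le_trans _ _ (h u)).
  by rewrite /h lerDr mulr_ge0 ?enorm_ge0.
rewrite {1}[u]row_sum_basis; apply: le_trans (sum_sublinear _ _ sh) _.
apply: (@le_trans _ _ (\sum_(i < n) enorm u * (lam *+ 2))).
  apply: ler_sum => i _; apply: le_trans (hi i _) _.
  by rewrite ler_wpM2r ?coord_le_enorm// mulrn_wge0.
rewrite sumr_const card_ord -[_ *+ n]mulr_natr le_eqVlt; apply/orP; left.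
by apply/eqP; ring.
Qed.

Lemma dominated_norm_le lam g u : 0 <= lam -> dominated lam g ->
  `|g u| <= (lam * n%:R) *+ 2 * enorm u.
Proof.
move=> l0 dg; rewrite ler_norml (dominated_le _ l0 dg) andbT lerNl.
exact: dominated_le l0 (dominatedN dg).
Qed.

Lemma dominated_lip lam g u v : 0 <= lam -> dominated lam g ->
  `|g u - g v| <= lam * (n%:R + 1) *+ 2 * enorm (u - v).
Proof.
move=> l0 dg; have := dominated_defect dg v (u - v).
have -> : v + (u - v) = u by rewrite addrC subrK.
have := dominated_norm_le (u - v) l0 dg.
have : lam * defect v (u - v) <= lam * (enorm (u - v) *+ 2).
  by rewrite ler_wpM2l ?defect_le.
by rewrite !ler_norml => ? /andP[? ?] /andP[? ?]; apply/andP; split; lra.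
Qed.

Definition dir u : V := (enorm u)^-1 *: u.

Lemma enorm_dir u : u != 0 -> enorm (dir u) = 1.
Proof.
by rewrite -enorm_gt0 => u0; rewrite enormZ ger0_norm ?invr_ge0 ?ltW// mulVf ?gt_eqF.
Qed.

Lemma enorm_scale_dir u : enorm u *: dir u = u.
Proof.
have [->|] := eqVneq u 0; first by rewrite enorm0 scale0r.
by rewrite -enorm_gt0 => u0; rewrite scalerA mulfV ?gt_eqF// scale1r.
Qed.

(** The positive part is squared to have a Lipschitz derivative: for nearly parallel vectors
    [defect] is of second order and could not absorb the kink of an unsquared one. *)
Definition bump v a u : R := enorm u * Num.max 0 (dot (dir u) v - a) ^+ 2.

Lemma bump_le v a u : enorm u = 1 -> dot u v <= a -> bump v a u = 0.
Proof.
move=> u1 ua; rewrite /bump /dir u1 invr1 scale1r mul1r.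
by rewrite max_l ?subr_le0// expr0n.
Qed.

Lemma bump_center v a : enorm v = 1 -> a < 1 -> bump v a v = (1 - a) ^+ 2.
Proof.
move=> v1 a1; rewrite /bump /dir v1 invr1 scale1r mul1r dotxx v1 expr1n.
by rewrite max_r// subr_ge0 ltW.
Qed.

Lemma bumpZ v a t u : 0 <= t -> bump v a (t *: u) = t * bump v a u.
Proof.
move=> t0; rewrite /bump enormZ ger0_norm// -mulrA.
have [->|t1] := eqVneq t 0; first by rewrite !mul0r.
by rewrite /dir enormZ ger0_norm// scalerA invfM mulrAC mulVf// mul1r.
Qed.

(* Expanding around the direction [z] of [u + w], the first order terms
   telescope and the second order terms are at most
   |u| |u/|u| - z|^2 + |w| |w/|w| - z|^2 <= 2 defect u w. *)
Lemma bump_defect v a u w : enorm v = 1 -> 0 <= a -> a < 1 ->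
  `|bump v a u + bump v a w - bump v a (u + w)| <= 10 * defect u w.
Proof.
move=> v1 a0 a1.
have [z z1 zuw] : exists2 z, enorm z = 1 & enorm (u + w) *: z = u + w.
  have [->|uw0] := eqVneq (u + w) 0; first by exists v; rewrite ?enorm0 ?scale0r.
  by exists (dir (u + w)); [exact: enorm_dir|exact: enorm_scale_dir].
pose phi (s : R) := Num.max 0 s ^+ 2; pose t := dot z v - a.
pose p := Num.max 0 t.
(* [phi] is convex with derivative [2 * p] at [t]; this is its first order expansion, with the
   remainder bounded on both sides. *)
have phiP s : 0 <= phi s - phi t - 2 * p * (s - t) <= (s - t) ^+ 2.
  have s2 := sqr_ge0 s; have t2 := sqr_ge0 t; have st2 := sqr_ge0 (s - t).
  rewrite /phi /p; case: (leP 0 s) => s0; case: (leP 0 t) => t0.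
  - by apply/andP; split; lra.
  - by have := mulr_le0_ge0 (ltW t0) s0 => ?; apply/andP; split; lra.
  - by have := mulr_le0_ge0 (ltW s0) t0 => ?; apply/andP; split; lra.
  - by rewrite expr0n /=; apply/andP; split; lra.
have buw : bump v a (u + w) = enorm (u + w) * phi t.
  have [uw0|uw0] := eqVneq (u + w) 0; first by rewrite /bump uw0 enorm0 !mul0r.
  rewrite /bump /phi /t; congr (_ * Num.max 0 (dot _ v - a) ^+ 2).
  by rewrite /dir -{2}zuw scalerA mulVf ?scale1r// gt_eqF ?enorm_gt0.
have quad x : enorm x * (dot (dir x) v - a - t) ^+ 2 <= 2 * (enorm x - dot x z).
  have -> : dot (dir x) v - a - t = dot (dir x - z) v by rewrite dotBl /t; ring.
  have [->|x0] := eqVneq x 0; first by rewrite enorm0 dot0l mul0r subrr mulr0.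
  have xE : dot x z = enorm x * dot (dir x) z.
    by rewrite -{1}(enorm_scale_dir x) dotZl.
  rewrite xE (_ : 2 * _ = enorm x * (2 * (1 - dot (dir x) z))); last by ring.
  rewrite ler_wpM2l ?enorm_ge0//.
  apply: (@le_trans _ _ (enorm (dir x - z) ^+ 2)).
    rewrite -[leLHS]real_normK ?num_real// ler_sqr ?nnegrE ?enorm_ge0//.
    by rewrite (le_trans (norm_dot_le _ _))// v1 mulr1.
  rewrite -dotxx dotBl !dotBr !dotxx enorm_dir// z1 expr1n (dotC z).
  by rewrite le_eqVlt; apply/orP; left; apply/eqP; ring.
have zv : `|dot z v| <= 1 by rewrite (le_trans (norm_dot_le _ _))// z1 v1 mulr1.
have uwz : dot u z + dot w z = enorm (u + w).
  by rewrite -dotDl -zuw dotZl dotxx z1 expr1n mulr1 enormZ z1 mulr1 ger0_norm ?enorm_ge0.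
have xv x : enorm x * dot (dir x) v = dot x v.
  by rewrite -dotZl enorm_scale_dir.
have uwv : dot u v + dot w v = enorm (u + w) * dot z v.
  by rewrite -dotDl -{1}zuw dotZl.
rewrite buw /bump -/(phi _) -/(phi _).
have qu := quad u; have qw := quad w; have xu := xv u; have xw := xv w.
set su := dot (dir u) v - a in qu *; set sw := dot (dir w) v - a in qw *.
have sE x : dot (dir x) v = dot (dir x) v - a + a by rewrite subrK.
rewrite sE -/su in xu; rewrite sE -/sw in xw; clearbody su sw.
have eu := enorm_ge0 u; have ew := enorm_ge0 w.
have /andP[pu1 pu2] := phiP su; have /andP[pw1 pw2] := phiP sw.
have mu1 := mulr_ge0 eu pu1; have mw1 := mulr_ge0 ew pw1.
have mu2 := ler_wpM2l eu pu2; have mw2 := ler_wpM2l ew pw2.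
have zE : dot z v = t + a by rewrite /t subrK.
have d0 := defect_ge0 u w; rewrite /defect in d0 *.
move: zv; rewrite ler_norml => /andP[zv1 zv2].
have p0 : 0 <= p by rewrite le_max lexx.
have p1 : p <= 1 by rewrite ge_max ler01 /t /=; lra.
have phit : phi t = p ^+ 2 by [].
have pz : `|p * dot z v| <= 1.
  by rewrite normrM ger0_norm// mulr_ile1// ler_norml zv1 zv2.
have dpz : `|(enorm u + enorm w - enorm (u + w)) * (p * dot z v)| <=
    enorm u + enorm w - enorm (u + w).
  by rewrite normrM ger0_norm// ler_piMr.
have pp : 0 <= phi t <= 1 by rewrite phit sqr_ge0 exprn_ile1.
case/andP: pp => pp0 pp1.
have dp0 := mulr_ge0 d0 pp0; have dp1 := ler_wpM2l d0 pp1.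
move: dpz; rewrite !ler_norml => /andP[dpz1 dpz2].
(* An exact identity: the first two terms contribute at most 1 + 2 defects in absolute value, and
   the remainders at most 2 more by [quad], well within the 10 of the statement. *)
have E : enorm u * phi su + enorm w * phi sw - enorm (u + w) * phi t =
   (enorm u + enorm w - enorm (u + w)) * phi t
   - 2 * ((enorm u + enorm w - enorm (u + w)) * (p * dot z v))
   + enorm u * (phi su - phi t - 2 * p * (su - t))
   + enorm w * (phi sw - phi t - 2 * p * (sw - t)).
  have : enorm u * su + enorm w * sw = enorm (u + w) * dot z v - a * (enorm u + enorm w).
    by rewrite -uwv -xu -xw; ring.
  rewrite zE => h.
  have : p * (enorm u * su + enorm w * sw) =
    p * (enorm (u + w) * (t + a) - a * (enorm u + enorm w)) by rewrite h.
  clearbody p t; clear; lra.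
by rewrite E; apply/andP; split; lra.
Qed.

End Dominated.

(** * The norm tower of the values of shapes at a sequence of directions *)

Definition fun_space (R : realType) (T : topologicalType) : Type :=
  prod_topology (fun _ : T => R).

HB.instance Definition _ (R : realType) (T : topologicalType) :=
  Uniform.on (fun_space R T).

(* Directions of evaluation: [dominated] functions are determined by their
   values at a dense set of directions, and a finite set of values can be
   prescribed at distinct directions off the coordinate axes. *)
Record directions (R : realType) (n : nat) (d : nat -> 'rV[R]_n) : Prop :=
  Directions {
  dir_unit : forall k, enorm (d k) = 1 ;
  dir_inj : injective d ;
  dir_offaxis : forall k i, `|d k ord0 i| < 1 ;
  dir_dense : forall u e, enorm u = 1 -> 0 < e -> exists k, enorm (u - d k) < e }.

Section DominatedTower.
Context {R : realType} {n : nat} (d : nat -> 'rV[R]_n).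
Hypothesis dP : directions d.
Notation V := 'rV[R]_n.
Notation S := (rseq R).
Notation F := (fun_space R V).
Implicit Types (x y : S) (g : V -> R) (k : nat).

Lemma finite_sup_lt1 (s : seq R) : (forall z : R, z \in s -> z < 1) ->
  exists a, [/\ 0 <= a, a < 1 & forall z : R, z \in s -> z <= a].
Proof.
elim: s => [_|x s IH s1]; first by exists 0; rewrite ltr01.
have [y ys|a [a0 a1 sa]] := IH; first by apply: s1; rewrite inE ys orbT.
exists (Num.max x a); split.
- by rewrite le_max a0 orbT.
- by rewrite gt_max a1 s1// mem_head.
- by move=> z; rewrite inE le_max => /predU1P[->|/sa ->]; rewrite ?lexx ?orbT.
Qed.

Lemma dot_dir_lt1 j k : j != k -> dot (d j) (d k) < 1.
Proof.
move=> jk; rewrite ltNge; apply/negP => djk.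
have : enorm (d j - d k) ^+ 2 <= 0.
  rewrite -dotxx dotBl !dotBr !dotxx !(dir_unit dP) (dotC (d k)) !expr1n.
  by lra.
rewrite exprn_even_le0//= => /eqP/enorm0_eq0/eqP.
by rewrite subr_eq0 => /eqP/(dir_inj dP) => /eqP; apply/negP.
Qed.

(** A rescaled bump at [d i] whose cap avoids the other listed directions and both ends of every
    coordinate axis; it vanishes on the axes, so evenness is immediate. *)
Lemma dominated_delta k i : exists C g, [/\ 0 <= C, dominated C g, g (d i) = 1 &
  forall j, (j < k)%N -> j != i -> g (d j) = 0].
Proof.
have [|a [a0 a1 sa]] := @finite_sup_lt1
  ([seq dot (d j) (d i) | j <- iota 0 k & j != i] ++
   [seq `|d i ord0 l| | l : 'I_n]).
  move=> x; rewrite mem_cat => /orP[|] /mapP[j].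
    by rewrite mem_filter => /andP[ji _] ->; exact: dot_dir_lt1.
  by move=> _ ->; exact: dir_offaxis.
have c0 : 0 < (1 - a) ^+ 2 by rewrite exprn_gt0// subr_gt0.
have axis s (l : 'I_n) : `|s| = 1 -> bump (d i) a (s *: delta_mx ord0 l) = 0.
  move=> s1; apply: bump_le; first by rewrite enormZ s1 enorm_delta mul1r.
  rewrite dotZl (_ : dot _ _ = d i ord0 l); last first.
    rewrite /dot (bigD1 l)//= mxE !eqxx mul1r big1 ?addr0// => j jl.
    by rewrite mxE eqxx (negbTE jl) mul0r.
  rewrite (le_trans (ler_norm _))// normrM s1 mul1r; apply: sa.
  rewrite mem_cat; apply/orP; right.
  by apply: (map_f (fun l => `|d i ord0 l|)); rewrite mem_enum.
have db : dominated 10 (bump (d i) a).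
  split=> [t u|u v|l]; first exact: bumpZ.
    by apply: bump_defect => //; exact: dir_unit.
  have := axis (-1) l (normrN1 R); have := axis 1 l (normr1 R).
  by rewrite scale1r scaleN1r => -> ->.
have := dominated_scale ((1 - a) ^+ 2)^-1 db.
set C := _ * 10; move=> dg; exists C, (fun u => ((1 - a) ^+ 2)^-1 * bump (d i) a u).
split=> //; first by rewrite mulr_ge0.
  by rewrite bump_center ?(dir_unit dP)// mulVf ?gt_eqF.
move=> j jk ji; rewrite bump_le ?mulr0// ?(dir_unit dP)//; apply: sa.
rewrite mem_cat; apply/orP; left.
by apply: (map_f (fun j => dot (d j) (d i))); rewrite mem_filter ji mem_iota.
Qed.

Definition interpolates k x lam g := [/\ 0 <= lam, dominated lam g &
  forall i, (i < k)%N -> g (d i) = x i].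

Definition dtower k x : R := inf [set lam | exists g, interpolates k x lam g].

(** Combine the functions of [dominated_delta] with coefficients [x i]. The bound becomes
    [tower_bound]: each finite projection contains a neighbourhood of 0. *)
Lemma interpolation k : exists2 C, 0 <= C & forall x, exists lam g,
  interpolates k x lam g /\ lam = C * \sum_(i < k) `|x i|.
Proof.
have /choice[f fP] : forall i, exists Cg : R * (V -> R), [/\ 0 <= Cg.1,
    dominated Cg.1 Cg.2, Cg.2 (d i) = 1 &
    forall j, (j < k)%N -> j != i -> Cg.2 (d j) = 0].
  by move=> i; have [C [g ?]] := dominated_delta k i; exists (C, g).
pose C := \sum_(i < k) (f i).1.
have f0 i : 0 <= (f i).1 by case: (fP i).
have C0 : 0 <= C by apply: sumr_ge0.
exists C => // x; exists (C * \sum_(i < k) `|x i|).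
have dsum m : dominated (\sum_(i < m) `|x i| * (f i).1)
    (fun u => \sum_(i < m) x i * (f i).2 u).
  elim: m => [|m IH].
    rewrite big_ord0 (_ : (fun _ => _) = fun=> 0); first exact: dominated0.
    by apply/funext => u; rewrite big_ord0.
  rewrite big_ord_recr (_ : (fun _ => _) = fun u =>
    \sum_(i < m) x i * (f i).2 u + x m * (f m).2 u); last first.
    by apply/funext => u; rewrite big_ord_recr.
  by apply: dominatedD IH _; apply: dominated_scale; case: (fP m).
exists (fun u => \sum_(i < k) x i * (f i).2 u); split=> //; split.
- by rewrite mulr_ge0// sumr_ge0.
- apply: dominated_mono (dsum k); rewrite mulr_sumr; apply: ler_sum => i _.
  rewrite mulrC ler_wpM2r// /C (bigD1 i)//= lerDl; exact: sumr_ge0.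
- move=> i ik; rewrite (bigD1 (Ordinal ik))//= (_ : (f i).2 (d i) = 1); last by case: (fP i).
  rewrite mulr1 big1 ?addr0// => j ji; have [_ _ _ ->] := fP j; rewrite ?mulr0//.
  by rewrite eq_sym.
Qed.

Lemma dtower_set_neq0 k x : [set lam | exists g, interpolates k x lam g] !=set0.
Proof. by have [C _ /(_ x)[lam [g [xg _]]]] := interpolation k; exists lam, g. Qed.

Lemma dtower_ge0 k x : 0 <= dtower k x.
Proof. by apply: lb_le_inf; [exact: dtower_set_neq0|move=> l [h []]]. Qed.

Lemma dtower_le k x lam g : interpolates k x lam g -> dtower k x <= lam.
Proof.
move=> xg; apply: ge_inf; last by exists g.
by exists 0 => l [h []].
Qed.

Lemma dtower_lt k x c : dtower k x < c -> exists lam g, interpolates k x lam g /\ lam < c.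
Proof.
by move=> /inf_lt -/(_ (dtower_set_neq0 k x))[lam [g xg] lc]; exists lam, g.
Qed.

Lemma dtower_le_of k x c : (forall c', c < c' -> dtower k x <= c') -> dtower k x <= c.
Proof.
move=> h; apply/ler_addgt0Pr => e e0; apply: h; by rewrite ltrDl.
Qed.

(** The factor [n%:R *+ 2] is the bound of [dominated_norm_le] at a unit vector; the summand 1 keeps
    the divisor in the proof positive for every [n]. *)
Lemma dtower_coord k x i : (i < k)%N -> `|x i| <= (n%:R *+ 2 + 1) * dtower k x.
Proof.
move=> ik; rewrite leNgt; apply/negP.
rewrite mulrC -ltr_pdivlMr; last by rewrite ltr_wpDl// mulrn_wge0.
move=> /dtower_lt[lam [g [[l0 dg gx] lx]]].
have := dominated_norm_le (d i) l0 dg; rewrite gx// (dir_unit dP) mulr1.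
apply/negP; rewrite -ltNge.
move: lx; rewrite ltr_pdivlMr; last by rewrite ltr_wpDl// mulrn_wge0.
by apply: le_lt_trans; move: l0; lra.
Qed.

Lemma dtower_norm_tower : norm_tower (n%:R *+ 2 + 1) dtower.
Proof.
split.
- move=> k x y xy; congr inf; apply/seteqP; split=> lam [g [l0 dg gx]];
    exists g; split=> // i ik; by rewrite gx// xy.
- move=> k x y; apply: dtower_le_of => c.
  rewrite -ltrBrDr => /dtower_lt[lam [g [[l0 dg gx]]]].
  rewrite ltrBrDr -ltrBrDl => /dtower_lt[mu [h [[m0 dh hy]]]].
  rewrite ltrBrDl => /ltW; apply: le_trans.
  apply: (@dtower_le _ _ _ (fun u => g u + h u)); split.
  + exact: addr_ge0.
  + exact: dominatedD.
  + by move=> i ik; rewrite gx// hy.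
- have half k a x : a != 0 -> dtower k (fun i => a * x i) <= `|a| * dtower k x.
    move=> a0; apply: dtower_le_of => c.
    rewrite -ltr_pdivlMl ?normr_gt0// => /dtower_lt[lam [g [[l0 dg gx]]]].
    rewrite ltr_pdivlMl ?normr_gt0// => /ltW; apply: le_trans.
    apply: (@dtower_le _ _ _ (fun u => a * g u)); split.
    + by rewrite mulr_ge0.
    + exact: dominated_scale.
    + by move=> i ik; rewrite gx.
  move=> k a x; have [->|a0] := eqVneq a 0.
    rewrite normr0 mul0r; apply/eqP; rewrite eq_le; apply/andP; split.
      apply: (@dtower_le _ _ _ (fun=> 0)); split=> //; first exact: dominated0.
      by move=> i ik; rewrite mul0r.
    exact: dtower_ge0.
  apply/eqP; rewrite eq_le half// -ler_pdivlMl ?normr_gt0//=.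
  have := half k a^-1 (fun i => a * x i); rewrite invr_eq0 normfV => /(_ a0).
  by under eq_fun do rewrite mulKf//.
- move=> k x; apply: dtower_le_of => c /dtower_lt[lam [g [[l0 dg gx] /ltW]]].
  by apply: le_trans; apply: (@dtower_le _ _ _ g); split=> // i ik; apply: gx; exact: ltnW.
(* For [tower_lift], the interpolating function brings along its own value at [d k], at no cost. *)
- move=> k x c /dtower_lt[lam [g [[l0 dg gx] lc]]].
  exists (fun i => g (d i)); first exact: gx.
  by apply: le_lt_trans lc; exact: (@dtower_le _ _ _ g).
- by move=> k x i; exact: dtower_coord.
- move=> k; have [C C0 xC] := interpolation k; exists C => // x.
  by have [lam [g [xg <-]]] := xC x; exact: dtower_le xg.
Qed.

Lemma dominated_tower_le1 g : dominated 1 g -> forall k, dtower k (fun i => g (d i)) <= 1.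
Proof. by move=> dg k; apply: (@dtower_le _ _ _ g). Qed.

Lemma cts_eval (u : V) (g : F) : continuous_at g (fun h : F => h u).
Proof. exact: (@proj_continuous V (fun=> R) u g). Qed.

Lemma closed_le_fun (f : F -> R) c : (forall g : F, continuous_at g f) ->
  closed [set g : F | f g <= c].
Proof.
move=> cf; have -> : [set g : F | f g <= c] = f @^-1` [set t | t <= c] by [].
by apply: closed_comp; [move=> x _; exact: cf|exact: closed_le].
Qed.

(** Tychonoff on the box given by [dominated_norm_le], cut by closed conditions that each involve
    finitely many evaluations; equalities are written with [<= 0] so that [closed_le_fun] covers
    them all. *)
Lemma compact_dominated : compact [set g : F | dominated 1 g].
Proof.
pose b (u : V) := (1 * n%:R) *+ 2 * enorm u : R.
have cB : compact [set g : F | forall u, `[- b u, b u]%classic (g u)].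
  apply: (@tychonoff V (fun=> R) (fun u => `[- b u, b u]%classic)) => u.
  exact: segment_compact.
have -> : [set g : F | dominated 1 g] =
    [set g : F | forall u, `[- b u, b u]%classic (g u)] `&`
    ([set g : F | forall p : R * V, 0 <= p.1 -> `|g (p.1 *: p.2) - p.1 * g p.2| <= 0] `&`
    ([set g : F | forall p : V * V,
        `|g p.1 + g p.2 - g (p.1 + p.2)| <= 1 * defect p.1 p.2] `&`
    [set g : F | forall i, `|g (- delta_mx ord0 i) - g (delta_mx ord0 i)| <= 0])).
  apply/seteqP; split=> [g dg|g [_ [gZ [gd ge]]]]; last first.
    split=> [t u t0|u v|i].
    - by apply/eqP; rewrite -subr_eq0 -normr_le0; exact: (gZ (t, u)).
    - exact: (gd (u, v)).
    - by apply/eqP; rewrite -subr_eq0 -normr_le0.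
  split=> [u|]; first by rewrite /= in_itv /= -ler_norml dominated_norm_le.
  have [gZ gd ge] := dg; split; first by move=> [t u] /= t0; rewrite gZ// subrr normr0.
  by split=> [[u v]|i] /=; [exact: gd|rewrite ge subrr normr0].
apply: compact_closedI cB _; apply: closedI; [|apply: closedI].
- have -> : [set g : F | forall p : R * V, 0 <= p.1 ->
      `|g (p.1 *: p.2) - p.1 * g p.2| <= 0] =
      \bigcap_(p in [set p : R * V | 0 <= p.1])
        [set g : F | `|g (p.1 *: p.2) - p.1 * g p.2| <= 0].
    by apply/seteqP; split=> g gP p; exact: gP.
  apply: closed_bigI => p _; apply: closed_le_fun => g.
  apply: cts_norm; apply: ctsB; first exact: cts_eval.
  by apply: ctsM; [exact: cts_cst|exact: cts_eval].
- have -> : [set g : F | forall p : V * V,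
      `|g p.1 + g p.2 - g (p.1 + p.2)| <= 1 * defect p.1 p.2] =
      \bigcap_(p in setT) [set g : F | `|g p.1 + g p.2 - g (p.1 + p.2)| <= 1 * defect p.1 p.2].
    by apply/seteqP; split=> g gP p => [_|]; exact: gP.
  apply: closed_bigI => p _; apply: closed_le_fun => g.
  by apply: cts_norm; apply: ctsB; [apply: ctsD|]; exact: cts_eval.
- have -> : [set g : F | forall i, `|g (- delta_mx ord0 i) - g (delta_mx ord0 i)| <= 0] =
      \bigcap_(i in setT) [set g : F | `|g (- delta_mx ord0 i) - g (delta_mx ord0 i)| <= 0].
    by apply/seteqP; split=> g gP p => [_|]; exact: gP.
  apply: closed_bigI => p _; apply: closed_le_fun => g.
  by apply: cts_norm; apply: ctsB; exact: cts_eval.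
Qed.

(** The gauges are infima, so each finite stage only realises a slightly larger bound. Dividing by
    [c m] restores the bound 1 at the price of a small error in the values, which vanishes in the
    limit because the values of shapes form a compact set. *)
Lemma dtower_realized x : (forall k, dtower k x <= 1) ->
  exists g, dominated 1 g /\ forall i, g (d i) = x i.
Proof.
move=> x1; pose res (g : F) : S := fun i => g (d i).
have ctsres (g : F) : continuous_at g res by apply: cts_coords => i; exact: cts_eval.
have cres : closed (res @` [set g : F | dominated 1 g]).
  apply: compact_closed; first exact: hausdorff_seq.
  apply: continuous_compact; last exact: compact_dominated.
  exact: continuous_subspaceT.
suff [g dg gx] : (res @` [set g : F | dominated 1 g]) x.
  by exists g; split=> // i; rewrite -gx.
pose c m : R := 1 + m.+1%:R^-1.
have c1 m : 1 < c m by rewrite ltrDl invr_gt0.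
have c0 m : 0 < c m := lt_trans ltr01 (c1 m).
have /choice[g gP] : forall m, exists g, dominated 1 g /\
    forall i, (i < m)%N -> g (d i) = (c m)^-1 * x i.
  move=> m; have [lam [g [[l0 dg gx] lc]]] := dtower_lt (le_lt_trans (x1 m) (c1 m)).
  exists (fun u => (c m)^-1 * g u); split; last by move=> i im; rewrite gx.
  apply: dominated_mono (dominated_scale _ dg).
  by rewrite ger0_norm ?invr_ge0 ?(ltW (c0 m))// mulrC ler_pdivrMr// mul1r ltW.
apply: (@closed_cvg _ _ \oo _ (fun m => res (g m)) _ cres).
  by exists 0%N => // m _; exists (g m) => //; case: (gP m).
apply/(@pointwise_cvgP nat R ((fun m => res (g m)) @ \oo) x _) => i.
apply/cvgrPdist_lt => e e0.
have : 0 <= `|x i| / e by rewrite divr_ge0// ltW.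
move=> /archi_boundP; set j := Num.bound _ => xj.
exists (maxn i.+1 j) => // m /=; rewrite geq_max => /andP[im jm].
rewrite /res; have [_ ->//] := gP m.
have cm : (c m)^-1 = 1 - (m.+1%:R * c m)^-1.
  have N0 : 0 < m.+1%:R :> R by rewrite ltr0n.
  rewrite /c; move: (m.+1%:R) N0 => N N0; field; rewrite (gt_eqF N0) /=.
  by rewrite gt_eqF// addr_gt0.
rewrite cm mulrBl mul1r opprB addrC subrK normrM.
rewrite ger0_norm ?invr_ge0 ?mulr_ge0 ?(ltW (c0 m))//.
rewrite mulrC ltr_pdivrMr ?mulr_gt0//.
move: xj; rewrite ltr_pdivrMr// mulrC => /lt_le_trans; apply.
rewrite ler_pM2l// (@le_trans _ _ m.+1%:R)// ?ler_nat 1?ltnW//.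
by rewrite ler_peMr// ltW.
Qed.

Lemma direction_net e : 0 < e -> exists K, forall u, enorm u = 1 ->
  exists2 k, (k < K)%N & enorm (u - d k) < e.
Proof.
move=> e0; have csph : compact [set u : V | enorm u = 1].
  apply: bounded_closed_compact.
    exists 1; split; first exact: num_real.
    by move=> c c1 u /= u1; rewrite (le_trans (norm_le_enorm _))// u1 ltW.
  have -> : [set u : V | enorm u = 1] = enorm @^-1` [set 1] by [].
  by apply: closed_comp; [move=> x _; exact: cts_enorm|exact: closed_eq].
have near_csph := (compact_near_coveringP _).1 csph.
have [] := near_csph nat \oo (fun K u => exists2 k, (k < K)%N & enorm (u - d k) < e) _.
  move=> u u1; have [k uk] := dir_dense dP u1 e0.
  exists ([set v : V | enorm (v - d k) < e], [set K | (k < K)%N]) => /=.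
    split; last by exists k.+1.
    have cu : continuous_at u (fun v : V => enorm (v - d k)).
      apply: (@cts_comp V V R u (fun v => v - d k) enorm); last exact: cts_enorm.
      exact: (@cvgB _ V V (nbhs u) _ id (fun=> d k) u (d k) cvg_id (cvg_cst _)).
    have ek : 0 < e - enorm (u - d k) by rewrite subr_gt0.
    have /cts_dist/(_ _ ek) := cu; apply: filterS => v /=.
    by rewrite ltr_norml => /andP[? ?]; lra.
  by move=> [v K] [/= vk kK]; exists k.
by move=> K _ /(_ K (leqnn K)) h; exists K => u u1; exact: h.
Qed.

(** Shapes share the Lipschitz constant [L], so closeness on a finite net of directions is uniform:
    moving to the net costs [e / 4] for each function, and the values there differ by less than
    [e / 2]. Thus finitely many values control the Hausdorff distance. *)
Lemma dominated_dist_le e : 0 < e -> exists K delta, 0 < delta /\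
  forall g h, dominated 1 g -> dominated 1 h ->
  (forall k, (k < K)%N -> `|g (d k) - h (d k)| < delta) ->
  forall u, `|g u - h u| <= e * enorm u.
Proof.
move=> e0; pose L : R := 1 * (n%:R + 1) *+ 2.
have L0 : 0 < L by rewrite pmulrn_lgt0// mul1r ltr_wpDl.
have [|K KP] := @direction_net (e / (L * 4)); first by rewrite divr_gt0// mulr_gt0.
exists K, (e / 2); split; first by rewrite divr_gt0.
move=> g h dg dh gh u.
have [->|u0] := eqVneq u 0.
  have z (f : V -> R) : dominated 1 f -> f 0 = 0.
    by move=> [fZ _ _]; rewrite -(scale0r 0) fZ// mul0r.
  by rewrite (z g)// (z h)// subrr normr0 enorm0 mulr0.
have [k kK uk] := KP _ (enorm_dir u0).
have hom (f : V -> R) : dominated 1 f -> f u = enorm u * f (dir u).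
  by move=> [fZ _ _]; rewrite -fZ ?enorm_ge0// enorm_scale_dir.
rewrite (hom g)// (hom h)// -mulrBr normrM ger0_norm ?enorm_ge0// mulrC ler_wpM2r ?enorm_ge0//.
have := dominated_lip (dir u) (d k) ler01 dg.
have := dominated_lip (dir u) (d k) ler01 dh; have := gh _ kK.
have : L * enorm (dir u - d k) <= e / 4.
  rewrite mulrC -ler_pdivlMr// -mulrA -invfM (mulrC 4); exact: ltW.
rewrite -/L !ler_norml ltr_norml => ? /andP[? ?] /andP[? ?] /andP[? ?].
by apply/andP; split; lra.
Qed.

End DominatedTower.

(** * A dense sequence of directions off the coordinate axes *)

Section DirectionsExist.
Context {R : realType} {n : nat}.
Notation V := 'rV[R]_n.

Definition of_rat (q : 'rV[rat]_n) : V := \row_i ratr (q ord0 i).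

(** No coordinate may vanish: a second nonzero coordinate is what keeps each coordinate of the unit
    vector below 1 in absolute value. *)
Definition rational_directions : set V :=
  [set dir (of_rat q) | q in [set q : 'rV[rat]_n | forall i, q ord0 i != 0]].

Lemma countable_rational_directions : countable rational_directions.
Proof. exact: card_le_trans (card_image_le _ _) (countableP _). Qed.

Lemma of_rat_neq0 (i0 : 'I_n) (q : 'rV[rat]_n) : (forall i, q ord0 i != 0) -> of_rat q != 0.
Proof.
move=> q0; apply/negP => /eqP/rowP/(_ i0); rewrite !mxE => /eqP.
by rewrite fmorph_eq0 (negbTE (q0 i0)).
Qed.

Lemma rational_directions_dense (i0 : 'I_n) (u : V) e : enorm u = 1 -> 0 < e ->
  exists2 v, rational_directions v & enorm (u - v) < e.
Proof.
move=> u1 e0; pose c := e / (n.+1%:R * 4).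
have c0 : 0 < c by rewrite divr_gt0// mulr_gt0.
(* The rational is taken on the side of [u ord0 i] away from 0, hence nonzero. *)
have /choice[f fP] : forall i, exists q : rat, q != 0 /\ `|u ord0 i - ratr q| <= c.
  move=> i; have [ui|ui] := leP 0 (u ord0 i).
    have [|q] := @rat_in_itvoo R (u ord0 i) (u ord0 i + c); first by rewrite ltrDl.
    rewrite in_itv /= => /andP[q1 q2]; exists q; split.
      by rewrite -(fmorph_eq0 (@ratr R)) gt_eqF// (le_lt_trans ui).
    by rewrite distrC ger0_norm ?subr_ge0 1?ltW// ltrBlDl.
  have [|q] := @rat_in_itvoo R (u ord0 i - c) (u ord0 i); first by rewrite gtrBl.
  rewrite in_itv /= => /andP[q1 q2]; exists q; split.
    by rewrite -(fmorph_eq0 (@ratr R)) lt_eqF// (lt_trans q2).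
  by rewrite ger0_norm ?subr_ge0 1?ltW// ltrBlDr -ltrBlDl.
pose q : 'rV[rat]_n := \row_i f i.
have q0 i : q ord0 i != 0 by rewrite mxE; case: (fP i).
exists (dir (of_rat q)); first by exists q.
have uq : enorm (u - of_rat q) < e / 2.
  apply: le_lt_trans (enorm_le_norm _) _.
  have : `|u - of_rat q| <= c.
    rewrite [leLHS]mx_normrE; apply: bigmax_le => [|[j i] _] /=; first exact: ltW.
    by rewrite !mxE ord1; case: (fP i).
  move=> /(ler_wMn2r n)/le_lt_trans; apply.
  rewrite -[c *+ n]mulr_natr /c; apply: (@le_lt_trans _ _ (e / 4)).
    rewrite invfM mulrA mulrAC ler_pM2r ?invr_gt0// -mulrA ler_piMr ?(ltW e0)//.
    by rewrite mulrC ler_pdivrMr// mul1r ler_nat.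
  by rewrite ltr_pM2l// ltf_pV2 ?posrE// ltr_nat.
have v0 := of_rat_neq0 i0 q0.
(* Normalising moves the approximation no farther than it already is from [u], which has norm 1. *)
have vd : enorm (of_rat q - dir (of_rat q)) = `|enorm (of_rat q) - enorm u|.
  rewrite u1 -{1}(enorm_scale_dir (of_rat q)) -{2}[dir _]scale1r -scalerBl enormZ.
  by rewrite (enorm_dir v0) mulr1.
have := enorm_lip (of_rat q) u; rewrite -vd (enorm_subC _ u) => vu.
have := enormD (u - of_rat q) (of_rat q - dir (of_rat q)).
by rewrite subrKA; lra.
Qed.

Lemma infinite_rational_directions (i0 i1 : 'I_n) : i0 != i1 ->
  infinite_set rational_directions.
Proof.
move=> i01.
(* The ratio of the coordinates [i0] and [i1] is [m.+1], so distinct [m] give distinct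
   directions. *)
pose q (m : nat) : 'rV[rat]_n := \row_i (if i == i0 then m.+1%:R else 1).
have q0 m i : q m ord0 i != 0 by rewrite mxE; case: ifP; rewrite ?pnatr_eq0 ?oner_eq0.
have qinj : injective (fun m => dir (of_rat (q m))).
  move=> m k mk; have i10 : (i1 == i0) = false by rewrite eq_sym (negbTE i01).
  have r j : dir (of_rat (q j)) ord0 i0 = j.+1%:R * dir (of_rat (q j)) ord0 i1.
    rewrite !mxE eqxx i10 ratr_nat rmorph1 mulr1.
    by rewrite mulrC.
  have d1 j : dir (of_rat (q j)) ord0 i1 != 0.
    rewrite !mxE mulf_neq0 ?invr_eq0 ?fmorph_eq0//.
      by rewrite gt_eqF// enorm_gt0 (of_rat_neq0 i0).
    by rewrite i10 oner_eq0.
  have := r m; rewrite mk r => /(mulIf (d1 k)) /eqP.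
  by rewrite eqr_nat eqSS => /eqP.
apply/infiniteP; apply: (@card_le_trans _ _ _ ((fun m => dir (of_rat (q m))) @` setT)).
  have qinj2 : {in [set: nat] &, injective (fun m => dir (of_rat (q m)))}.
    by move=> m k _ _; exact: qinj.
  by have /card_eqPle[] := inj_card_eq qinj2.
by apply: subset_card_le => _ [m _ <-]; exists (q m).
Qed.

Lemma directions_exist : (2 <= n)%N -> exists d : nat -> V, directions d.
Proof.
move=> n2; pose i0 : 'I_n := Ordinal (ltnW n2); pose i1 : 'I_n := Ordinal n2.
have i01 : i0 != i1 by [].
have : ([set: nat] #= rational_directions)%card.
  apply/card_eqPle; split; first exact/infiniteP/(infinite_rational_directions i01).
  exact: countable_rational_directions.
move=> /card_set_bijP[d [dA dinj dsurj]]; exists d; split.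
- move=> k; have [q /(of_rat_neq0 i0) q0 <-] := dA k I; exact: enorm_dir.
- by move=> j k; apply: dinj; rewrite in_setT.
- move=> k i; have [q q0 <-] := dA k I.
  have dir1 := enorm_dir (of_rat_neq0 i0 q0).
  have dn0 j : dir (of_rat q) ord0 j != 0.
    rewrite !mxE mulf_neq0 ?invr_eq0 ?fmorph_eq0//.
    by rewrite gt_eqF// enorm_gt0 (of_rat_neq0 i0).
  have [j ji] : exists j : 'I_n, j != i.
    by have [->|] := eqVneq i i0; [exists i1; rewrite eq_sym|exists i0; rewrite eq_sym].
  rewrite -(@ltr_pXn2r _ 2)// ?nnegrE// expr1n.
  have := sqr_enorm (dir (of_rat q)); rewrite dir1 expr1n => ->.
  rewrite (bigD1 i)//= real_normK ?num_real// ltrDl (bigD1 j)//=.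
  rewrite ltr_wpDr//; first by apply: sumr_ge0 => l _; exact: sqr_ge0.
  by rewrite lt_neqAle sqr_ge0 eq_sym sqrf_eq0 dn0.
- move=> u e u1 e0; have [v Av uv] := rational_directions_dense i0 u1 e0.
  by have [k _ kv] := dsurj _ Av; exists k; rewrite kv.
Qed.

End DirectionsExist.
(** * Charts in the Hilbert cube *)

(** Relative continuity at a point. It is needed because [open_cube m] is not open in the space of
    all sequences, and chart inverses take junk values off it. *)
Definition cts_on (T U : topologicalType) (A : set T) (f : T -> U) (x : T) :=
  f y @[y --> within A (nbhs x)] --> f x.

Section ContinuousOn.
Context {T U W : topologicalType}.
Implicit Types (A : set T) (B : set U).

Lemma cts_onP A (f : T -> U) x : cts_on A f x <->
  forall P, nbhs (f x) P -> nbhs x [set y | A y -> P (f y)].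
Proof. by []. Qed.

Lemma cts_on_at A (f : T -> U) x : continuous_at x f -> cts_on A f x.
Proof.
move=> fx; apply/cts_onP => P Pfx; have h : nbhs x (f @^-1` P) := fx P Pfx.
by apply: filterS h => y Py _.
Qed.

Lemma cts_on_comp A B (f : T -> U) (g : U -> W) x : (forall y, A y -> B (f y)) ->
  cts_on A f x -> cts_on B g (f x) -> cts_on A (fun y => g (f y)) x.
Proof.
move=> AB fx gx P Pgf.
suff : nbhs x [set y | A y -> P (g (f y))] by [].
have hg : nbhs (f x) [set y | B y -> P (g y)] := gx P Pgf.
have hf : nbhs x [set y | A y -> B (f y) -> P (g (f y))] := fx _ hg.
by apply: filterS hf => y Pfy Ay; exact: Pfy Ay (AB _ Ay).
Qed.

Lemma cts_on_total A (f : T -> U) (x : T) : (forall y, A y) -> cts_on A f x ->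
  continuous_at x f.
Proof.
move=> At fx P Pfx; have h : nbhs x [set y | A y -> P (f y)] := fx P Pfx.
by suff : nbhs x (f @^-1` P) by []; apply: filterS h => y; exact.
Qed.

Lemma within_cts_on A (f : T -> U) : {within A, continuous f} <->
  forall x, A x -> cts_on A f x.
Proof. by split=> [/subspace_continuousP//|fA]; exact/subspace_continuousP. Qed.

End ContinuousOn.

Lemma cts_set_val (T : topologicalType) (A : set T) (x : set_type A) :
  continuous_at x (set_val : set_type A -> T).
Proof. exact: initial_continuous. Qed.

Lemma cts_to_set_type (T U : topologicalType) (A : set U) (f : T -> set_type A) x :
  continuous_at x (fun y => set_val (f y)) -> continuous_at x f.
Proof.
move=> fx P; rewrite nbhsE => -[Q [oQ Qx] QP].
have [B oB BQ] := oQ.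
have := fx B; rewrite /fmap /=.
move=> h; have : nbhs x ((fun y => set_val (f y)) @^-1` B).
  by apply: h; apply: open_nbhs_nbhs; split=> //; rewrite -BQ in Qx.
by apply: filterS => y By; apply: QP; rewrite -BQ.
Qed.

Lemma cts_to_prod (I : Type) (K : I -> topologicalType) (T : topologicalType)
    (x : T) (f : T -> prod_topology K) :
  (forall i, continuous_at x (fun y => f y i)) -> continuous_at x f.
Proof.
move=> fx; apply/cvg_sup => i U [/= _ [[B oB <-] /= Bfx]] BU.
have h : nbhs x ((fun y => f y i) @^-1` B).
  by apply: fx; apply: open_nbhs_nbhs.
by suff : nbhs x (f @^-1` U) by []; apply: filterS h => y By; exact: BU.
Qed.

Section CubeCharts.
Context {R : realType}.
Notation S := (rseq R).

Definition open_cube (m : nat) : set S :=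
  [set x | cube R x /\ forall i, (i < m)%N -> `|x i| < 1].

Lemma open_cubeZ m x s : 0 <= s <= 1 -> open_cube m x ->
  open_cube m (fun i => s * x i).
Proof.
move=> /andP[s0 s1] [cx ox]; split=> i => [|im]; rewrite normrM ger0_norm//.
  by rewrite mulr_ile1.
by rewrite (le_lt_trans _ (ox i im))// ler_piMl.
Qed.

(** Clamping makes the affine change of interval total and continuous on all sequences; on the cube
    it has no effect. *)
Definition unit_clamp (t : R) : R := Num.min 1 (Num.max 0 ((t + 1) / 2)).

Lemma unit_clamp_in t : `[0, 1]%classic (unit_clamp t).
Proof.
by rewrite /unit_clamp /= in_itv /= le_min ler01 le_max lexx ge_min lexx.
Qed.

Lemma unit_clampE t : `|t| <= 1 -> unit_clamp t = (t + 1) / 2.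
Proof.
rewrite ler_norml => /andP[t1 t2]; rewrite /unit_clamp max_r; last by lra.
by rewrite min_r//; lra.
Qed.

Definition to_hilbert (x : S) : hilbert_cube R :=
  fun i => exist _ (unit_clamp (x i)) (mem_set (unit_clamp_in (x i))).

Definition of_hilbert (q : hilbert_cube R) : S := fun i => 2 * set_val (q i) - 1.

Lemma cube_of_hilbert q : cube R (of_hilbert q).
Proof.
move=> i; rewrite /of_hilbert; have := set_valP (q i).
have aux (t : R) : `[0, 1]%classic t -> `|2 * t - 1| <= 1; last exact: aux.
by rewrite /= in_itv /= => /andP[? ?]; rewrite ler_norml; apply/andP; split; lra.
Qed.

Lemma to_hilbertK x : cube R x -> of_hilbert (to_hilbert x) = x.
Proof.
move=> cx; apply/funext => i; rewrite /of_hilbert /to_hilbert /set_val /=.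
have aux (t : R) : 2 * ((t + 1) / 2) - 1 = t by field.
by rewrite unit_clampE//; exact: aux.
Qed.

Lemma of_hilbertK q : to_hilbert (of_hilbert q) = q.
Proof.
have aux (t : R) : (2 * t - 1 + 1) / 2 = t by field.
apply/funext => i; apply/val_inj; rewrite [LHS]unit_clampE ?cube_of_hilbert//.
exact: aux.
Qed.

Lemma cts_to_hilbert x : continuous_at x to_hilbert.
Proof.
apply: (@cts_to_prod nat (fun=> set_type `[(0:R), 1]%classic) S x to_hilbert) => i.
apply: (@cts_to_set_type S R _ (fun y => to_hilbert y i)).
have : continuous_at x (fun y : S => unit_clamp (y i)); last exact.
apply: (@cts_comp S R R x (fun y : S => y i)); first exact: cts_coord.
rewrite /unit_clamp.
have cmin (t : R) (g h : R -> R) : continuous_at t g -> continuous_at t h ->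
    continuous_at t (fun s => Num.min (g s) (h s)).
  by move=> gt ht; exact: (@continuous_min _ _ g h).
apply: cmin; first exact: cts_cst.
apply: cts_max; first exact: cts_cst.
apply: ctsM; last exact: cts_cst.
by apply: ctsD; [exact: cvg_id|exact: cts_cst].
Qed.

Lemma cts_of_hilbert q : continuous_at q of_hilbert.
Proof.
apply: cts_coords => i; apply: ctsB; last exact: cts_cst.
apply: ctsM; first exact: cts_cst.
apply: (@cts_comp _ (set_type `[(0:R), 1]%classic) R q (fun q : hilbert_cube R => q i) set_val).
  exact: (@proj_continuous nat (fun=> set_type `[(0:R), 1]%classic) i q).
exact: cts_set_val.
Qed.

Lemma open_hilbert_cube m : open [set q | open_cube m (of_hilbert q)].
Proof.
have -> : [set q | open_cube m (of_hilbert q)] =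
    [set q | forall i, (i < m)%N -> `|of_hilbert q i| < 1].
  apply/seteqP; split=> [q [_ qm]//|q qm].
  by split=> [|i im]; [exact: cube_of_hilbert|exact: qm].
elim: m => [|m IH].
  by rewrite (_ : mkset _ = setT); [exact: openT|apply/seteqP; split].
rewrite (_ : mkset _ = [set q | forall i, (i < m)%N -> `|of_hilbert q i| < 1] `&`
    (fun q => `|of_hilbert q m|) @^-1` [set t | t < 1]); last first.
  apply/seteqP; split=> [q qm|q [qm qi] i].
    by split=> [i im|]; apply: qm => //; exact: ltnW.
  by rewrite ltnS leq_eqVlt => /predU1P[->//|]; exact: qm.
apply: openI => //; apply: open_comp; last exact: open_lt.
move=> q _; apply: cts_norm.
apply: (@cts_comp (hilbert_cube R) S R q of_hilbert (fun x => x m)); first exact: cts_of_hilbert.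
exact: cts_coord.
Qed.

(* A homeomorphism from [X] onto [open_cube m], with inverse [g], read in the
   ambient space of all sequences. *)
Record cube_chart (X : topologicalType) (m : nat) (f : X -> S) (g : S -> X) : Prop :=
  CubeChart {
  chart_in : forall x, open_cube m (f x) ;
  chartK : forall x, g (f x) = x ;
  chartVK : forall y, open_cube m y -> f (g y) = y ;
  chart_cts : forall x, continuous_at x f ;
  chartV_cts : forall y, open_cube m y -> cts_on (open_cube m) g y }.

Lemma cube_chart_homeomorphic (X : topologicalType) m (f : X -> S) g :
  cube_chart m f g -> exists2 V : set (hilbert_cube R), open V &
    homeomorphic X (set_type V).
Proof.
move=> [fin gf fg fc gc].
exists [set q | open_cube m (of_hilbert q)]; first exact: open_hilbert_cube.
have fV x : [set q | open_cube m (of_hilbert q)] (to_hilbert (f x)).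
  by rewrite /= to_hilbertK; [exact: fin|case: (fin x)].
pose F x : set_type [set q | open_cube m (of_hilbert q)] :=
  exist _ (to_hilbert (f x)) (mem_set (fV x)).
exists F, (fun v => g (of_hilbert (set_val v))); split.
- by move=> x; rewrite /set_val /= to_hilbertK ?gf//; case: (fin x).
- move=> v; apply/val_inj; rewrite [LHS]/=.
  by rewrite fg; [exact: of_hilbertK|exact: (set_valP v)].
- move=> x; apply: cts_to_set_type.
  have : continuous_at x (fun y => to_hilbert (f y)); last exact.
  by apply: (@cts_comp X S _ x f); [exact: fc|exact: cts_to_hilbert].
- move=> v; apply: (@cts_on_total _ _ setT) => //.
  apply: (@cts_on_comp _ S X setT (open_cube m) (fun v => of_hilbert (set_val v)) g).
  + by move=> y _; exact: (set_valP y).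
  + apply: cts_on_at.
    apply: (@cts_comp _ (hilbert_cube R) S v set_val); first exact: cts_set_val.
    exact: cts_of_hilbert.
  + by apply: gc; exact: (set_valP v).
Qed.

Lemma cube_chart_contractible (X : topologicalType) m (f : X -> S) g :
  cube_chart m f g -> contractible R X.
Proof.
move=> [fin gf fg fc gc].
exists (g (fun=> 0)), (fun xt => g (fun i => (1 - xt.2) * f xt.1 i)); split.
- apply/within_cts_on => -[x t] [_ /=]; rewrite in_itv /= => t01.
  apply: (@cts_on_comp (X * R)%type S X _ (open_cube m)
    (fun xt i => (1 - xt.2) * f xt.1 i) g).
  + move=> [y s] [_ /=]; rewrite in_itv /= => /andP[s0 s1].
    by apply: open_cubeZ (fin y); rewrite subr_ge0 s1 lerBlDr lerDl.
  + apply: cts_on_at; apply: cts_coords => i; apply: ctsM.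
      by apply: ctsB; [exact: cts_cst|exact: cvg_snd].
    apply: (@cts_comp (X * R)%type S R (x, t) (fun xt => f xt.1) (fun y => y i)).
      by apply: (@cts_comp (X * R)%type X S (x, t) fst f); [exact: cvg_fst|exact: fc].
    exact: cts_coord.
  + apply: gc; case/andP: t01 => t0 t1 /=.
    by apply: open_cubeZ (fin x); rewrite subr_ge0 t1 lerBlDr lerDl.
- move=> x /=; rewrite -[RHS]gf; congr g; apply/funext => i.
  by rewrite subr0 mul1r.
- by move=> x /=; congr g; apply/funext => i; rewrite subrr mul0r.
Qed.

Lemma cube_chart_separable (X : topologicalType) m (f : X -> S) g :
  cube_chart m f g -> separable X.
Proof.
move=> [fin gf fg fc gc].
pose sq (s : seq rat) : S := fun i => ratr (nth 0 s i).
exists [set g (sq s) | s in [set s | open_cube m (sq s)]].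
  by apply: card_le_trans (card_image_le _ _) (countableP _).
move=> B [x Bx] oB.
have /choice[r rP] : forall ik : nat * nat, exists q : rat,
    `|ratr q| < 1 :> R /\ `|f x ik.1 - ratr q| < ik.2.+1%:R^-1.
  move=> [i k] /=; have := (fin x).1 i; rewrite ler_norml => /andP[x1 x2].
  have k0 : 0 < k.+1%:R^-1 :> R by rewrite invr_gt0.
  move: (k.+1%:R^-1) k0 => c c0.
  (* Intersecting with []-1, 1[] keeps the rational strictly inside even when [f x i] is an end
     point, so the approximating sequences lie in [open_cube m]. *)
  have [|q] := @rat_in_itvoo R (Num.max (-1) (f x i - c)) (Num.min 1 (f x i + c)).
    by rewrite lt_min !gt_max; apply/andP; split; apply/andP; split; lra.
  rewrite in_itv /= lt_min gt_max => /andP[/andP[q1 q2] /andP[q3 q4]].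
  by exists q; rewrite !ltr_norml; split; apply/andP; split; lra.
pose s k := mkseq (fun i => r (i, k)) k.
have sqE k i : (i < k)%N -> sq (s k) i = ratr (r (i, k)).
  by move=> ik; rewrite /sq nth_mkseq.
have sV k : open_cube m (sq (s k)).
  have lt1 i : `|sq (s k) i| < 1.
    have [ik|ki] := ltnP i k; first by rewrite sqE//; case: (rP (i, k)).
    by rewrite /sq nth_default ?size_mkseq// rmorph0 normr0.
  by split=> [i|i _]; [apply: ltW|]; exact: lt1.
have sx : (fun k => sq (s k)) @ \oo --> f x.
  apply/(@pointwise_cvgP nat R ((fun k => sq (s k)) @ \oo) (f x) _) => i.
  apply/cvgrPdist_lt => e e0.
  exists (maxn i.+1 (Num.bound e^-1)) => // k /=; rewrite geq_max => /andP[ik ek].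
  rewrite sqE//; have [_ /lt_trans] := rP (i, k); apply => /=.
  rewrite invf_plt ?posrE//.
  have : e^-1 < (Num.bound e^-1)%:R by apply: archi_boundP; rewrite invr_ge0 ltW.
  move=> /lt_le_trans; apply; rewrite ler_nat; exact: leqW.
have nB : nbhs (f x) [set y | open_cube m y -> B (g y)].
  have := gc _ (fin x); apply; rewrite gf.
  by apply: open_nbhs_nbhs.
have [k _ /(_ k (leqnn k)) sB] := sx _ nB.
by exists (g (sq (s k))); split; [exact: sB (sV k)|exists (s k); [exact: sV|]].
Qed.

End CubeCharts.
(** * The chart of pairs of constant relative width *)

Section Squash.
Context {R : realType}.
Implicit Types t y : R.

Definition squash t : R := t / (1 + `|t|).
Definition unsquash y : R := y / (1 - `|y|).

Let den_gt0 t : 0 < 1 + `|t|.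
Proof. by rewrite ltr_pwDl. Qed.

Lemma squash_lt1 t : `|squash t| < 1.
Proof.
rewrite normrM normfV [`|1 + _|]gtr0_norm// ltr_pdivrMr// mul1r.
by rewrite ltrDr.
Qed.

Lemma squashK t : unsquash (squash t) = t.
Proof.
have t0 := den_gt0 t; rewrite /unsquash {2}/squash normrM normfV.
rewrite [`|1 + _|]gtr0_norm// /squash; move: (`|t|) t0 => s s0.
rewrite -[X in X - s / _](divff (lt0r_neq0 s0)) -mulrBl addrK div1r invrK.
by rewrite divfK ?gt_eqF.
Qed.

Lemma unsquashK y : `|y| < 1 -> squash (unsquash y) = y.
Proof.
move=> y1; have y0 : 0 < 1 - `|y| by rewrite subr_gt0.
rewrite /squash {2}/unsquash normrM normfV [`|1 - _|]gtr0_norm// /unsquash.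
move: (`|y|) y0 => s s0.
rewrite -[X in X + s / _](divff (lt0r_neq0 s0)) -mulrDl subrK div1r invrK.
by rewrite divfK ?gt_eqF.
Qed.

Lemma cts_squash t : continuous_at t squash.
Proof.
apply: ctsM; first exact: cvg_id.
apply: ctsV; first by rewrite gt_eqF.
by apply: ctsD; [exact: cts_cst|apply: cts_norm; exact: cvg_id].
Qed.

Lemma cts_unsquash y : `|y| < 1 -> continuous_at y unsquash.
Proof.
move=> y1; apply: ctsM; first exact: cvg_id.
apply: ctsV; first by rewrite subr_eq0 gt_eqF.
by apply: ctsB; [exact: cts_cst|apply: cts_norm; exact: cvg_id].
Qed.

End Squash.

(** * Splitting a pair into translations, radius and shape *)

Section Decomposition.
Context {R : realType} {n : nat} (i0 : 'I_n).
Notation V := 'rV[R]_n.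
Implicit Types (l u : V) (g h : V -> R) (r : R) (K : cc R n * cc R n).

Definition shape_fun l r g u : R := dot l u + r * (enorm u + g u).

Definition reflect_fun g u : R := - g (- u).

Lemma dominated_reflect g : dominated 1 g -> dominated 1 (reflect_fun g).
Proof.
move=> [gZ gd ge]; split=> [t u t0|u v|i]; rewrite /reflect_fun.
- by rewrite -scalerN gZ// mulrN.
- have := gd (- u) (- v); rewrite -normrN /defect -opprD !enormN.
  by rewrite !opprD !opprK.
- by rewrite ge opprK.
Qed.

Lemma shape_sublinear l r g : 0 <= r -> dominated 1 g -> sublinear (shape_fun l r g).
Proof.
move=> r0 /dominated_sublinear[hD hZ]; split=> [u v|t u t0].
  have := ler_wpM2l r0 (hD u v); rewrite /shape_fun dotDr !mul1r; lra.
have := hZ t u t0; rewrite /shape_fun dotZr !mul1r => ->.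
by rewrite !mulrDr; ring.
Qed.

(** Indexed by all naturals, with value 0 from [n] on, so that [code] needs no proofs of bounds. *)
Definition evec (i : nat) : V := \row_j ((j : nat) == i)%:R.

Lemma evecE (i : 'I_n) : evec i = delta_mx ord0 i.
Proof. by apply/rowP => j; rewrite !mxE eqxx. Qed.

(** Coordinate [i] of the centre of the bounding box of the body; evenness at the coordinate vectors
    makes it the coordinate of the translation. *)
Definition midpoint h (i : nat) : R := (h (evec i) - h (- evec i)) / 2.

(* For a pair with difference [eball c r] this is [r / 2]. *)
Definition half_width h1 h2 : R :=
  (h1 (evec i0) + h1 (- evec i0) + h2 (evec i0) + h2 (- evec i0)) / 4.

Definition profile h1 h2 u : R :=
  (h1 u - dot (\row_i midpoint h1 i) u) / half_width h1 h2 - enorm u.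

Lemma shape_midpoint l r g (i : 'I_n) : dominated 1 g ->
  midpoint (shape_fun l r g) i = l ord0 i.
Proof.
move=> [_ _ ge]; rewrite /midpoint /shape_fun evecE enormN ge dotNr.
rewrite (_ : dot l _ = l ord0 i); first by field.
rewrite /dot (bigD1 i)//= mxE !eqxx mulr1 big1 ?addr0// => j ji.
by rewrite mxE eqxx (negbTE ji) mulr0.
Qed.

Lemma shape_half_width l1 l2 r g : dominated 1 g ->
  half_width (shape_fun l1 r g) (shape_fun l2 r (reflect_fun g)) = r.
Proof.
move=> [_ _ ge]; rewrite /half_width /shape_fun /reflect_fun evecE opprK.
by rewrite enormN ge !dotNr enorm_delta; field.
Qed.

Lemma shape_profile l1 l2 r g : 0 < r -> dominated 1 g ->
  profile (shape_fun l1 r g) (shape_fun l2 r (reflect_fun g)) = g.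
Proof.
move=> r0 dg; apply/funext => u; rewrite /profile shape_half_width//.
rewrite (_ : \row_i _ = l1); last first.
  by apply/rowP => i; rewrite mxE shape_midpoint.
rewrite /shape_fun addrAC subrr add0r mulrC mulrA mulVf ?gt_eqF// mul1r.
by rewrite addrAC subrr add0r.
Qed.

(** Taking the translation of the first body from its midpoints makes the remaining [g] even at the
    coordinate vectors; the equation of the ball then determines the second support function. *)
Lemma crwP K : crw R n K <-> exists l1 l2 r g, [/\ 0 < r, dominated 1 g,
  supp K.1 = shape_fun l1 r g & supp K.2 = shape_fun l2 r (reflect_fun g)].
Proof.
split=> [[c [r [r0 /(minkowski_sub_ball K.1 K.2 c r0) Kcr]]]|]; last first.
  move=> [l1 [l2 [r [g [r0 dg K1 K2]]]]]; exists (l1 - l2), (r + r).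
  have rr0 : 0 < r + r by rewrite addr_gt0.
  split=> //; apply/(minkowski_sub_ball K.1 K.2 (l1 - l2) rr0) => u.
  rewrite K1 K2 /shape_fun /reflect_fun opprK enormN dotNr dotBl; ring.
set h1 := supp K.1; set h2 := supp K.2.
pose l1 : V := \row_i midpoint h1 i.
pose r2 := r / 2; have r20 : 0 < r2 by rewrite divr_gt0.
pose g u := (h1 u - dot l1 u) / r2 - enorm u.
have h1E u : h1 u = shape_fun l1 r2 g u.
  by rewrite /shape_fun /g addrCA subrr addr0 mulrC divfK ?gt_eqF// addrC subrK.
have h2E u : h2 u = shape_fun (l1 - c) r2 (reflect_fun g) u.
  have := Kcr (- u); rewrite -/h1 -/h2 opprK enormN dotNr h1E.
  rewrite /shape_fun /reflect_fun enormN dotNr dotBl => E.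
  have rE : r = r2 + r2 by rewrite /r2 -splitr.
  move: E; rewrite rE; lra.
have [h1D h1Z] : sublinear h1 := cc_sublinear K.1.
have [h2D h2Z] : sublinear h2 := cc_sublinear K.2.
exists l1, (l1 - c), r2, g; split=> //; last 2 first.
- exact/funext.
- exact/funext.
split=> [t u t0|u v|i].
- by rewrite /g h1Z// dotZr enormZ ger0_norm//; ring.
(* Sublinearity of [h1] at [u], [v] and of [h2] at [- u], [- v] give the two sides of the absolute
   value. *)
- have := h1D u v; have := h2D (- u) (- v); rewrite !h1E !h2E /shape_fun /reflect_fun.
  rewrite -opprD !dotNr !opprK !enormN dotDr dotDr => E2 E1.
  have : r2 * (g (u + v) - g u - g v) <= r2 * defect u v by rewrite /defect; lra.
  have : r2 * (g u + g v - g (u + v)) <= r2 * defect u v.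
    by rewrite /defect; lra.
  rewrite !ler_pM2l// mul1r ler_norml => ? ?.
  by apply/andP; split; lra.
- rewrite /g enormN -evecE; congr (_ / _ - _).
  rewrite dotNr.
  rewrite (_ : dot l1 _ = midpoint h1 i); first by rewrite /midpoint; field.
  rewrite evecE /dot (bigD1 i)//= !mxE !eqxx mulr1 big1 ?addr0// => j ji.
  by rewrite !mxE eqxx (negbTE ji) mulr0.
Qed.

End Decomposition.

Section CrwTopology.
Context {R : realType} {n : nat}.
Notation V := 'rV[R]_n.

Lemma cts_supp (K : cc R n) (u : V) : continuous_at K (fun L : cc R n => supp L u).
Proof.
apply/cts_dist => e e0; have d0 : 0 < e / (enorm u + 1).
  by rewrite divr_gt0// ltr_wpDl ?enorm_ge0.
apply/nbhs_ballP; exists (e / (enorm u + 1)) => // L.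
rewrite ballEmdist /= => KL; apply: le_lt_trans (supp_dist_le K L u) _.
apply: (@le_lt_trans _ _ (e / (enorm u + 1) * enorm u)).
  by rewrite ler_wpM2r ?enorm_ge0//; exact: ltW.
rewrite mulrAC ltr_pdivrMr ?ltr_wpDl ?enorm_ge0//.
by rewrite ltr_pM2l// ltrDl.
Qed.

Lemma cts_supp1 (K : set_type (crw R n)) (u : V) :
  continuous_at K (fun L : set_type (crw R n) => supp (set_val L).1 u).
Proof.
apply: (@cts_comp _ (cc R n) R K (fun L => (set_val L).1) (fun L => supp L u)).
  apply: (@cts_comp _ (cc R n * cc R n)%type (cc R n) K set_val fst).
    exact: cts_set_val.
  exact: cvg_fst.
exact: cts_supp.
Qed.

Lemma cts_supp2 (K : set_type (crw R n)) (u : V) :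
  continuous_at K (fun L : set_type (crw R n) => supp (set_val L).2 u).
Proof.
apply: (@cts_comp _ (cc R n) R K (fun L => (set_val L).2) (fun L => supp L u)).
  apply: (@cts_comp _ (cc R n * cc R n)%type (cc R n) K set_val snd).
    exact: cts_set_val.
  exact: cvg_snd.
exact: cts_supp.
Qed.

Lemma cts_on_cc (T : topologicalType) (A : set T) (f : T -> cc R n) x : A x ->
  (forall e, 0 < e -> \forall y \near x, A y ->
    forall u, `|supp (f x) u - supp (f y) u| <= e * enorm u) -> cts_on A f x.
Proof.
move=> Ax fe P /nbhs_ballP[e /= e0 eP].
have e2 : 0 < e / 2 by rewrite divr_gt0.
suff : nbhs x [set y | A y -> P (f y)] by [].
apply: filterS (fe _ e2) => y xy Ay; apply: eP; rewrite ballEmdist /=.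
apply: (@le_lt_trans _ _ (e / 2)); last by rewrite ltr_pdivrMr// ltr_pMr// ltr1n.
by apply: hausdorff_dist_le (xy Ay); exact: ltW.
Qed.

Lemma cts_on_crw (T : topologicalType) (A : set T) (f : T -> set_type (crw R n)) x :
  cts_on A (fun y => (set_val (f y)).1) x -> cts_on A (fun y => (set_val (f y)).2) x ->
  cts_on A f x.
Proof.
move=> f1 f2 P; rewrite nbhsE => -[Q [[B oB BQ] Qx] QP].
have [[B1 B2] /= [B1x B2x] BB] : nbhs (set_val (f x)) B.
  by apply: open_nbhs_nbhs; split=> //; rewrite -BQ in Qx.
have h1 : nbhs x [set y | A y -> B1 (set_val (f y)).1] := f1 _ B1x.
have h2 : nbhs x [set y | A y -> B2 (set_val (f y)).2] := f2 _ B2x.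
suff : nbhs x [set y | A y -> P (f y)] by [].
apply: filterS (filterI h1 h2) => y [y1 y2] Ay.
apply: QP; rewrite -BQ /=; apply: BB; split => /=; [exact: y1|exact: y2].
Qed.

End CrwTopology.

Section CrwChart.
Context {R : realType} {n : nat} (d : nat -> 'rV[R]_n) (i0 : 'I_n).
Hypothesis dP : directions d.
Notation V := 'rV[R]_n.
Notation S := (rseq R).
Notation X := (set_type (crw R n)).
Implicit Types (x y : S) (u l : V) (K L : X) (g : V -> R) (r : R).

Let W : set S := [set w | forall k, dtower d k w <= 1].

Variables (H G : S -> S).
Hypothesis HW : forall q, cube R q -> W (H q).
Hypothesis GP : forall w, W w -> cube R (G w) /\ H (G w) = w.
Hypothesis GK : forall q, cube R q -> G (H q) = q.
Hypothesis ctsH : {within cube R, continuous H}.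
Hypothesis ctsG : {within W, continuous G}.

Let m := (n + n).+1.

Lemma dominated_inj g h : dominated 1 g -> dominated 1 h ->
  (forall k, g (d k) = h (d k)) -> g = h.
Proof.
move=> dg dh gh; apply/funext => u; apply/eqP.
rewrite -subr_eq0 -normr_le0; apply/ler_addgt0Pr => e e0; rewrite add0r.
have eu : 0 < e / (enorm u + 1) by rewrite divr_gt0// ltr_wpDl ?enorm_ge0.
have [k [c [c0 kc]]] := dominated_dist_le dP eu.
apply: le_trans (kc g h dg dh _ u) _.
  by move=> j _; rewrite gh subrr normr0.
rewrite mulrAC ler_pdivrMr ?ltr_wpDl ?enorm_ge0// ler_wpM2l ?(ltW e0)//.
by rewrite lerDl.
Qed.

Definition interpolant (w : S) : V -> R :=
  xget (fun=> 0 : R) [set g : V -> R | dominated 1 g /\ forall k, g (d k) = w k].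

Lemma interpolantP w : W w ->
  dominated 1 (interpolant w) /\ forall k, interpolant w (d k) = w k.
Proof.
move=> /(dtower_realized dP)[g gP].
by apply: (@xgetPex _ _ [set g : V -> R | dominated 1 g /\ forall k, g (d k) = w k]); exists g.
Qed.

Definition center1 x : V := \row_(i < n) unsquash (x i).
Definition center2 x : V := \row_(i < n) unsquash (x (n + i)%N).
Definition radius x : R := expR (unsquash (x (n + n)%N)).
Definition tail x : S := fun k => x (m + k)%N.

Definition dec1 x := shape_fun (center1 x) (radius x) (interpolant (H (tail x))).
Definition dec2 x :=
  shape_fun (center2 x) (radius x) (reflect_fun (interpolant (H (tail x)))).

Lemma cube_tail x : open_cube m x -> cube R (tail x).
Proof. by move=> [cx _] k; exact: cx. Qed.

Lemma interpolant_tail x : open_cube m x -> dominated 1 (interpolant (H (tail x))).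
Proof. by move=> /cube_tail/HW/interpolantP[]. Qed.

Lemma dec_exists x : open_cube m x ->
  exists K, supp (set_val K).1 = dec1 x /\ supp (set_val K).2 = dec2 x.
Proof.
move=> ox; have dg := interpolant_tail ox.
have r0 : 0 < radius x by exact: expR_gt0.
have [K1 K1E] := sublinear_supp (shape_sublinear (center1 x) (ltW r0) dg).
have [K2 K2E] := sublinear_supp
  (shape_sublinear (center2 x) (ltW r0) (dominated_reflect dg)).
have cK : crw R n (K1, K2).
  apply/crwP; exists (center1 x), (center2 x), (radius x).
  by exists (interpolant (H (tail x))).
by exists (exist _ (K1, K2) (mem_set cK)).
Qed.

Lemma crw_pair_inj K L : supp (set_val K).1 = supp (set_val L).1 ->
  supp (set_val K).2 = supp (set_val L).2 -> K = L.
Proof.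
move=> /supp_inj K1 /supp_inj K2; apply/val_inj.
have : set_val K = set_val L; last by [].
by rewrite [LHS]surjective_pairing K1 K2 -surjective_pairing.
Qed.

Variable K0 : X.

(* The value is the junk [K0] off [open_cube m]. *)
Definition decode x : X := xget K0
  [set K : X | supp (set_val K).1 = dec1 x /\ supp (set_val K).2 = dec2 x].

Lemma decodeP x : open_cube m x ->
  supp (set_val (decode x)).1 = dec1 x /\ supp (set_val (decode x)).2 = dec2 x.
Proof. by move=> /dec_exists; exact: xgetPex. Qed.

Definition tail_of K : S :=
  fun k => profile i0 (supp (set_val K).1) (supp (set_val K).2) (d k).

(* Coordinates: [n] for the translation of each body, one for the logarithm of
   the radius, and the remaining ones for the normalised shape. *)
Definition code K : S := fun i =>
  if (i < n)%N then squash (midpoint (supp (set_val K).1) i)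
  else if (i < n + n)%N then squash (midpoint (supp (set_val K).2) (i - n)%N)
  else if i == (n + n)%N then
    squash (ln (half_width i0 (supp (set_val K).1) (supp (set_val K).2)))
  else G (tail_of K) (i - m)%N.

Lemma tail_of_in K : W (tail_of K).
Proof.
have [l1 [l2 [r [g [r0 dg K1 K2]]]]] := (crwP _).1 (set_valP K).
by rewrite /tail_of K1 K2 shape_profile//; exact: dominated_tower_le1.
Qed.

Lemma code_in K : open_cube m (code K).
Proof.
split=> [i|i]; rewrite /code; last first.
  rewrite ltnS leq_eqVlt => /predU1P[->|inn].
    by rewrite ltnn ifF ?eqxx ?squash_lt1// ltnNge leq_addr.
  by rewrite inn; case: ifP => _; exact: squash_lt1.
case: ifP => _; first exact/ltW/squash_lt1.
case: ifP => _; first exact/ltW/squash_lt1.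
case: ifP => _; first exact/ltW/squash_lt1.
by have [cG _] := GP (tail_of_in K); exact: cG.
Qed.

Lemma code_lo K (i : 'I_n) : code K i = squash (midpoint (supp (set_val K).1) i).
Proof. by rewrite /code ltn_ord. Qed.

Lemma code_mid K (i : 'I_n) :
  code K (n + i)%N = squash (midpoint (supp (set_val K).2) i).
Proof. by rewrite /code ltnNge leq_addr/= ltn_add2l ltn_ord addKn. Qed.

Lemma code_radius K : code K (n + n)%N =
  squash (ln (half_width i0 (supp (set_val K).1) (supp (set_val K).2))).
Proof. by rewrite /code ltnNge leq_addr/= ltnn eqxx. Qed.

Lemma code_tail K : tail (code K) = G (tail_of K).
Proof.
apply/funext => k; have mk : (n + n < m + k)%N by rewrite /m addSn ltnS leq_addr.
rewrite /tail /code !ltnNge (ltnW mk) (leq_trans (leq_addr n n) (ltnW mk)) /=.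
by rewrite gtn_eqF// addKn.
Qed.

Lemma codeK K : decode (code K) = K.
Proof.
have [D1 D2] := decodeP (code_in K).
have [l1 [l2 [r [g [r0 dg K1 K2]]]]] := (crwP _).1 (set_valP K).
have c1 : center1 (code K) = l1.
  by apply/rowP => i; rewrite mxE code_lo squashK K1 shape_midpoint.
have c2 : center2 (code K) = l2.
  apply/rowP => i; rewrite mxE code_mid squashK K2 shape_midpoint//.
  exact: dominated_reflect.
have cr : radius (code K) = r.
  by rewrite /radius code_radius squashK K1 K2 shape_half_width// lnK.
have ct : interpolant (H (tail (code K))) = g.
  have [_ HG] := GP (tail_of_in K); rewrite code_tail HG.
  have [di ig] := interpolantP (tail_of_in K).
  by apply: dominated_inj => // k; rewrite ig /tail_of K1 K2 shape_profile.
apply: crw_pair_inj.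
  by rewrite D1 K1 /dec1 c1 cr ct.
by rewrite D2 K2 /dec2 c2 cr ct.
Qed.

Lemma decodeK x : open_cube m x -> code (decode x) = x.
Proof.
move=> ox; have [D1 D2] := decodeP ox; have dg := interpolant_tail ox.
have r0 : 0 < radius x by exact: expR_gt0.
have [cx x1] := ox.
apply/funext => i; rewrite /code /tail_of D1 D2.
have [ii|ni] := ltnP i n.
  rewrite (shape_midpoint _ _ (Ordinal ii) dg) mxE unsquashK//.
  by apply: x1; rewrite ltnS ltnW// ltn_addr.
have [inn|nni] := ltnP i (n + n)%N.
  have jn : (i - n < n)%N by rewrite ltn_subLR.
  rewrite (shape_midpoint _ _ (Ordinal jn) (dominated_reflect dg)) mxE /=.
  by rewrite subnKC// unsquashK// x1// ltnS ltnW.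
case: eqVneq => [->|inn].
  by rewrite shape_half_width// expRK unsquashK// x1.
have mi : (m <= i)%N by rewrite ltn_neqAle eq_sym inn.
rewrite (_ : (fun k => _) = H (tail x)).
  rewrite GK; last exact: cube_tail.
  by rewrite /tail; congr (x _); exact: subnKC.
apply/funext => k; rewrite shape_profile//.
by have [_ ->] := interpolantP (HW (cube_tail ox)).
Qed.

Lemma cts_code K : continuous_at K code.
Proof.
have cm (h : X -> V -> R) i : (forall u, continuous_at K (h^~ u)) ->
    continuous_at K (fun L => midpoint (h L) i).
  by move=> ch; apply: ctsM; [apply: ctsB; exact: ch|exact: cts_cst].
have c1 u : continuous_at K (fun L => supp (set_val L).1 u) by exact: cts_supp1.
have c2 u : continuous_at K (fun L => supp (set_val L).2 u) by exact: cts_supp2.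
have cw : continuous_at K
    (fun L => half_width i0 (supp (set_val L).1) (supp (set_val L).2)).
  apply: ctsM; last exact: cts_cst.
  by apply: ctsD; [apply: ctsD; [apply: ctsD|]|].
have w0 : 0 < half_width i0 (supp (set_val K).1) (supp (set_val K).2).
  have [l1 [l2 [r [g [r0 dg -> ->]]]]] := (crwP _).1 (set_valP K).
  by rewrite shape_half_width.
apply: cts_coords => i; rewrite /code.
case: (i < n)%N.
  apply: (@cts_comp X R R K (fun L => midpoint (supp (set_val L).1) i) squash).
    exact: (cm (fun L => supp (set_val L).1)).
  exact: cts_squash.
case: (i < n + n)%N.
  apply: (@cts_comp X R R K (fun L => midpoint (supp (set_val L).2) (i - n)) squash).
    exact: (cm (fun L => supp (set_val L).2)).
  exact: cts_squash.
case: (i == _).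
  apply: (@cts_comp X R R K _ squash); last exact: cts_squash.
  apply: (@cts_comp X R R K _ (@ln R)); first exact: cw.
  exact: continuous_ln.
have ct : continuous_at K tail_of.
  apply: cts_coords => k; apply: ctsB; last exact: cts_cst.
  apply: ctsM; last by apply: ctsV => //; rewrite gt_eqF.
  apply: ctsB; first exact: c1.
  apply: cts_sum => j _; apply: ctsM; last exact: cts_cst.
  under eq_fun do rewrite mxE.
  exact: (cm (fun L => supp (set_val L).1)).
apply: (@cts_comp X S R K (fun L => G (tail_of L)) (fun y => y (i - m)%N)); last exact: cts_coord.
apply: (@cts_on_total _ _ setT) => //.
apply: (@cts_on_comp X S S setT W tail_of G).
- by move=> L _; exact: tail_of_in.
- exact: cts_on_at.
- by apply: (within_cts_on _ _).1 => //; exact: tail_of_in.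
Qed.

Lemma shape_fun_dist l l' r r' g h c u : 0 <= r -> dominated 1 h ->
  (forall u, `|g u - h u| <= c * enorm u) ->
  `|shape_fun l r g u - shape_fun l' r' h u| <=
  (enorm (l - l') + `|r - r'| * (n%:R *+ 2 + 1) + r * c) * enorm u.
Proof.
move=> r0 dh gh.
rewrite (_ : _ - _ = dot (l - l') u + (r - r') * (enorm u + h u) + r * (g u - h u)); last first.
  by rewrite /shape_fun dotBl; ring.
apply: le_trans (ler_normD _ _) _; rewrite [leRHS]mulrDl; apply: lerD; last first.
  by rewrite normrM ger0_norm// -mulrA ler_wpM2l.
apply: le_trans (ler_normD _ _) _; rewrite [leRHS]mulrDl; apply: lerD.
  exact: norm_dot_le.
rewrite normrM -mulrA ler_wpM2l//.
have := dominated_norm_le u ler01 dh; rewrite mul1r ler_norml => /andP[h1 h2].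
have hn : 0 <= n%:R *+ 2 * enorm u :> R by rewrite mulr_ge0 ?enorm_ge0 ?mulrn_wge0.
by rewrite ler_norml; have := enorm_ge0 u => ?; apply/andP; split; lra.
Qed.

(** Applied with [F] the identity for the first body and [reflect_fun] for the second. By
    [dominated_dist_le] the shape is controlled by finitely many coordinates of [H (tail x)]. *)
Lemma near_shape (L : S -> V) (F : (V -> R) -> V -> R) x e :
  (forall g, dominated 1 g -> dominated 1 (F g)) ->
  (forall c g h, (forall u, `|g u - h u| <= c * enorm u) ->
    forall u, `|F g u - F h u| <= c * enorm u) ->
  continuous_at x (fun y => enorm (L x - L y)) ->
  open_cube m x -> 0 < e ->
  \forall y \near x, open_cube m y -> forall u,
    `|shape_fun (L x) (radius x) (F (interpolant (H (tail x)))) u -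
      shape_fun (L y) (radius y) (F (interpolant (H (tail y)))) u| <= e * enorm u.
Proof.
move=> dF lF cL ox e0; have r0 : 0 < radius x by exact: expR_gt0.
(* Each of the three terms of [shape_fun_dist] gets at most [e / 4]; this choice settles the last
   one. *)
pose c := e / (4 * (radius x + 1)).
have c0 : 0 < c by rewrite divr_gt0// mulr_gt0// addr_gt0.
have rc : radius x * c <= e / 4.
  rewrite (_ : _ * c = e / 4 * (radius x / (radius x + 1))); last first.
    by rewrite /c invfM mulrCA -!mulrA; congr (_ * _); rewrite mulrCA.
  rewrite ler_piMr//; first by rewrite divr_ge0// ltW.
  by rewrite ler_pdivrMr ?addr_gt0// mul1r lerDl.
have [k [dl [dl0 kP]]] := dominated_dist_le dP c0.
have ctail : cts_on (open_cube m) (fun y => H (tail y)) x.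
  apply: (@cts_on_comp S S S (open_cube m) (cube R) tail H).
  - exact: cube_tail.
  - apply: cts_on_at; apply: cts_coords => i; exact: cts_coord.
  - by apply: (within_cts_on _ _).1 => //; exact: cube_tail.
have nw : nbhs x [set y | open_cube m y ->
    forall i, (i < k)%N -> `|H (tail x) i - H (tail y) i| < dl].
  exact: ctail _ (near_coords (H (tail x)) k dl0).
have nl : nbhs x [set y | enorm (L x - L y) < e / 4].
  have e4 : 0 < e / 4 by rewrite divr_gt0.
  have /cts_dist/(_ _ e4) := cL; apply: filterS => y /=.
  by rewrite subrr enorm0 sub0r normrN ger0_norm ?enorm_ge0.
have nr : nbhs x [set y | `|radius x - radius y| * (n%:R *+ 2 + 1) < e / 4].
  have M0 : 0 < n%:R *+ 2 + 1 :> R by rewrite ltr_wpDl// mulrn_wge0.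
  have eM : 0 < e / 4 / (n%:R *+ 2 + 1) by rewrite !divr_gt0.
  have crad : continuous_at x radius.
    apply: (@cts_comp S R R x _ (@expR R)); last exact: continuous_expR.
    apply: (@cts_comp S R R x (fun y => y (n + n)%N) unsquash); first exact: cts_coord.
    by apply: cts_unsquash; case: ox => _; apply.
  have /cts_dist/(_ _ eM) := crad; apply: filterS => y /=.
  by rewrite ltr_pdivlMr.
apply: filterS (filterI nw (filterI nl nr)) => y [yw [yl yr]] oy u.
have dgx := interpolant_tail ox; have dgy := interpolant_tail oy.
have gxy : forall u, `|interpolant (H (tail x)) u - interpolant (H (tail y)) u| <= c * enorm u.
  apply: kP => // i ik; have [_ ->] := interpolantP (HW (cube_tail ox)).
  by have [_ ->] := interpolantP (HW (cube_tail oy)); exact: yw.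
apply: le_trans (shape_fun_dist _ _ _ _ (ltW r0) (dF _ dgy) (lF _ _ _ gxy)) _.
rewrite ler_wpM2r ?enorm_ge0//; move: yl yr rc; rewrite /=; lra.
Qed.

Lemma cts_center (j : nat) x : (forall i, (i < n)%N -> `|x (j + i)%N| < 1) ->
  continuous_at x (fun y : S =>
    enorm ((\row_(i < n) unsquash (x (j + i)%N)) - \row_(i < n) unsquash (y (j + i)%N) : V)).
Proof.
move=> x1; apply: (@cts_comp S R R x _ (@Num.sqrt R)); last exact: sqrt_continuous.
apply: cts_sum => i _.
rewrite (_ : (fun y => _) = fun y : S =>
    (unsquash (x (j + i)%N) - unsquash (y (j + i)%N)) *
    (unsquash (x (j + i)%N) - unsquash (y (j + i)%N))); last first.
  by apply/funext => y; rewrite !mxE expr2.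
have cu : continuous_at x (fun y : S => unsquash (x (j + i)%N) - unsquash (y (j + i)%N)).
  apply: ctsB; first exact: cts_cst.
  apply: (@cts_comp S R R x (fun y => y (j + i)%N) unsquash); first exact: cts_coord.
  by apply: cts_unsquash; exact: x1.
exact: ctsM.
Qed.

Lemma cts_on_decode x : open_cube m x -> cts_on (open_cube m) decode x.
Proof.
move=> ox; have [D1 D2] := decodeP ox; have [_ x1] := ox.
apply: cts_on_crw; apply: cts_on_cc => // e e0.
  have cc1 : continuous_at x (fun y => enorm (center1 x - center1 y)).
    by apply: (@cts_center 0) => i ilt; rewrite x1// ltnS ltnW// ltn_addr.
  have := @near_shape center1 id x e (fun g dg => dg) (fun c g h gh => gh) cc1 ox e0.
  apply: filterS => y xy oy u; rewrite D1; have [-> _] := decodeP oy.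
  exact: xy.
have cc2 : continuous_at x (fun y => enorm (center2 x - center2 y)).
  by apply: (@cts_center n) => i ilt; rewrite x1// ltnS ltnW// ltn_add2l.
have lref c (g h : V -> R) : (forall u, `|g u - h u| <= c * enorm u) ->
    forall u, `|reflect_fun g u - reflect_fun h u| <= c * enorm u.
  by move=> gh u; rewrite /reflect_fun -opprD normrN -(enormN u) gh.
have := @near_shape center2 reflect_fun x e dominated_reflect lref cc2 ox e0.
apply: filterS => y xy oy u; rewrite D2; have [_ ->] := decodeP oy.
exact: xy.
Qed.

Lemma crw_chart : cube_chart m code decode.
Proof.
split; [exact: code_in|exact: codeK|exact: decodeK|exact: cts_code|].
exact: cts_on_decode.
Qed.

End CrwChart.

(** * Metrizability of the space of pairs *)

Section CrwMetric.
Context {R : realType} {n : nat}.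

(** The maximum is chosen because its balls are those that the subtype inherits from the product, so
    the metric space has the same topology and the identity is the homeomorphism. *)
Definition crw_dist (K L : set_type (crw R n)) : R :=
  Num.max (mdist (set_val K).1 (set_val L).1) (mdist (set_val K).2 (set_val L).2).

Let crw_dist_ge0 K L : 0 <= crw_dist K L.
Proof. by rewrite le_max mdist_ge0. Qed.

Let crw_dist_eq0 K L : crw_dist K L = 0 -> K = L.
Proof.
move=> KL; have eq0 i j : Num.max (i : R) j = 0 -> 0 <= i -> 0 <= j -> i = 0 /\ j = 0.
  move=> ij i0 j0; split; apply/eqP; rewrite eq_le ?i0 ?j0 andbT -ij le_max lexx ?orbT//.
have [/mdist_positivity K1 /mdist_positivity K2] := eq0 _ _ KL (mdist_ge0 _ _) (mdist_ge0 _ _).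
apply/val_inj; have : set_val K = set_val L; last by [].
by rewrite [LHS]surjective_pairing K1 K2 -surjective_pairing.
Qed.

Let crw_ball (K : set_type (crw R n)) e : ball K e = [set L | crw_dist K L < e].
Proof.
apply/seteqP; split=> L.
  move=> [K1 K2]; rewrite /= /crw_dist gt_max.
  by move: K1 K2; rewrite !ballEmdist /= => -> ->.
rewrite /= /crw_dist gt_max => /andP[K1 K2].
by split; rewrite ballEmdist.
Qed.

HB.instance Definition _ := PseudoMetric_isMetric.Build R (set_type (crw R n))
  crw_dist_ge0 crw_dist_eq0 crw_ball.

Lemma crw_metrizable : metrizable R (set_type (crw R n)).
Proof.
exists (set_type (crw R n) : metricType R).
by exists id, id; split=> // x; exact: cvg_id.
Qed.

End CrwMetric.

Lemma homeomorphic_setT (T U : topologicalType) : homeomorphic T U ->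
  homeomorphic (set_type [set: T]) U.
Proof.
move=> [f [g [fK gK cf cg]]].
exists (fun x => f (set_val x)), (fun y => exist _ (g y) (mem_set I)); split.
- by move=> x; apply/val_inj; rewrite /= fK.
- by move=> y; rewrite /set_val /= gK.
- move=> x; apply: (@cts_comp _ T U x set_val f); first exact: cts_set_val.
  exact: cf.
- move=> y; apply: cts_to_set_type; exact: cg.
Qed.

Theorem theorem3p1 (R : realType) (n : nat) (hn : (2 <= n)%N) :
  contractible R (set_type (crw R n)) /\ Q_manifold R (set_type (crw R n)).
Proof.
have [d dP] := @directions_exist R n hn.
have M0 : 0 < n%:R *+ 2 + 1 :> R by rewrite ltr_wpDl// mulrn_wge0.
have [H [G [HW GP GK ctsH ctsG]]] := tower_keller M0 (dtower_norm_tower dP).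
(* The origin lies in the domain of the chart; the pair it describes serves as the default value of
   [decode]. *)
have o0 : open_cube (n + n).+1 (fun=> 0 : R).
  by split=> [i|i _]; rewrite normr0 ?ler01 ?ltr01.
have [K0 _] := dec_exists dP HW o0.
have chart := crw_chart (Ordinal hn) dP HW GP GK ctsH ctsG K0.
split; first exact: cube_chart_contractible chart.
split; [exact: cube_chart_separable chart|exact: crw_metrizable|].
(* A single chart covers the whole space. *)
move=> x; exists setT; split; first by split=> //; exact: openT.
have [V oV TV] := cube_chart_homeomorphic chart.
by exists V => //; exact: homeomorphic_setT.
Qed.
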